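(* (i) Let $\Omega\subset\mathbb C$ be an arbitrary bounded open set. Then the set of $g\in\bigcap_{p<2}\mathcal{O}L^p(\Omega)$ which are totally unbounded in $\Omega$ is dense and $G_\delta$ in $\bigcap_{p<2}\mathcal{O}L^p(\Omega)$. (ii) Let $\Omega\subset\mathbb C$ be a bounded open set such that for every $\zeta\in\partial\Omega$ the connected component $C_\zeta$ of $\mathbb C\setminus\Omega$ containing $\zeta$ satisfies $C_\zeta\setminus\{\zeta\}\ne\emptyset$. Then for each $q$ with $1<q<\infty$, the set of $g\in\bigcap_{p<q}\mathcal{O}L^p(\Omega)$ which are totally unbounded in $\Omega$ is dense and $G_\delta$ in $\bigcap_{p<q}\mathcal{O}L^p(\Omega)$. (iii) Let $\Omega\subset\mathbb C$ be a bounded open set with $C^1$ boundary and $1<q\le\infty$. Then the set $$\Big\{g\in\bigcap_{p<q}\mathcal{O}L^p(\Omega): g\text{ totally unbounded in }\Omega,\ g\notin\mathcal{O}L^q(B(\zeta,\varepsilon)\cap\Omega)\ \forall\zeta\in\partial\Omega,\ \forall\varepsilon>0\Big\}$$ is dense and $G_\delta$ in $\bigcap_{p<q}\mathcal{O}L^p(\Omega)$.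
   Context: For an open bounded set $D$ and $p\ge1$, $\mathcal{O}L^p(D)$ is the space of holomorphic $f$ on $D$ with $\int_D|f|^p\,dv<\infty$; $\mathcal{O}L^\infty(D)$ is the space of bounded holomorphic functions. For $1<q\le\infty$, $\bigcap_{p<q}\mathcal{O}L^p(\Omega)$ carries the complete metric $d(f,g)=\sum_j2^{-j}\frac{\|f-g\|_{p_j}}{1+\|f-g\|_{p_j}}$ with $1<p_1<p_2<\dots$, $p_j\to q$; convergence means $\|f_k-f\|_p\to0$ for all $p<q$. A holomorphic $f$ is totally unbounded in $\Omega$ if for every $w\in\partial\Omega$, $\delta>0$ and every connected component $E$ of $B(w,\delta)\cap\Omega$, $\sup_E|f|=\infty$. *)

(* Defs.v *)
(* mathcomp-analysis over an abstract [R : realType];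
   the complex plane is [R[i]] (mathcomp-real-closed), viewed through the
   regular normed-module alias [(R[i])^o] to get its topology and the
   complex derivative. *)
From HB Require Import structures.
From mathcomp Require Import all_boot all_order all_algebra.
From mathcomp Require Import all_classical all_reals all_analysis.
From mathcomp Require Import complex.
Import Order.TTheory GRing.Theory Num.Theory.
Import numFieldNormedType.Exports.
Set Implicit Arguments.
Unset Strict Implicit.
Unset Printing Implicit Defensive.
Local Open Scope classical_set_scope.
Local Open Scope ring_scope.

Notation CC R := ((complex R)^o).

Definition cmod {R : realType} (z : CC R) : R :=
  let: (a +i* b)%C := z in Num.sqrt (a ^+ 2 + b ^+ 2).

Definition toC {R : realType} (xy : R * R) : CC R := (xy.1 +i* xy.2)%C.

Definition disk {R : realType} (w : CC R) (r : R) : set (CC R) :=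
  [set z | cmod (z - w) < r].

Definition bounded_C {R : realType} (D : set (CC R)) : Prop :=
  exists M : R, forall z, D z -> cmod z <= M.

Definition leb2 (R : realType) := (@lebesgue_measure R \x @lebesgue_measure R)%E.

Definition holomorphic_on {R : realType} (D : set (CC R)) (f : CC R -> CC R) :=
  forall z, D z -> derivable f z 1.

Definition pint {R : realType} (D : set (CC R)) (p : R) (f : CC R -> CC R)
  : \bar R :=
  (\int[@leb2 R]_(xy in toC @^-1` D) ((cmod (f (toC xy))) `^ p)%:E)%E.

(* ||f||_{L^p(D)} (meaningful when pint D p f is finite) *)
Definition Lpnorm {R : realType} (D : set (CC R)) (p : R) (f : CC R -> CC R)
  : R := (fine (pint D p f)) `^ (p^-1).

Definition OL {R : realType} (D : set (CC R)) (q : \bar R) (f : CC R -> CC R)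
  : Prop :=
  holomorphic_on D f /\
  match q with
  | +oo%E => exists M : R, forall z, D z -> cmod (f z) <= M
  | (r%:E)%E => (pint D r f < +oo)%E
  | -oo%E => False
  end.

Definition OLlt {R : realType} (D : set (CC R)) (q : \bar R) (f : CC R -> CC R)
  : Prop :=
  holomorphic_on D f /\
  forall p : R, 1 <= p -> (p%:E < q)%E -> (pint D p f < +oo)%E.

Definition exponent_seq {R : realType} (q : \bar R) (ps : nat -> R) : Prop :=
  1 < ps 0%N /\ (forall j, ps j < ps j.+1) /\
  ((fun j => (ps j)%:E) @ \oo --> q)%E.

(* the metric d(f,g) = sum_j 2^{-j} ||f-g||_{p_j} / (1 + ||f-g||_{p_j})
   (indices shifted to start at 0) *)
Definition dist_OL {R : realType} (D : set (CC R)) (ps : nat -> R)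
  (f g : CC R -> CC R) : R :=
  limn (fun n => \sum_(0 <= j < n)
    ((2 ^- j.+1) * (Lpnorm D (ps j) (f \- g) / (1 + Lpnorm D (ps j) (f \- g))))).

Definition OL_open {R : realType} (D : set (CC R)) (q : \bar R) (ps : nat -> R)
  (U : set (CC R -> CC R)) : Prop :=
  U `<=` OLlt D q /\
  forall f, U f -> exists r : R, 0 < r /\
    forall g, OLlt D q g -> dist_OL D ps f g < r -> U g.

Definition OL_dense {R : realType} (D : set (CC R)) (q : \bar R) (ps : nat -> R)
  (S : set (CC R -> CC R)) : Prop :=
  S `<=` OLlt D q /\
  forall f, OLlt D q f -> forall r : R, 0 < r ->
    exists g, S g /\ dist_OL D ps f g < r.

Definition OL_Gdelta {R : realType} (D : set (CC R)) (q : \bar R)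
  (ps : nat -> R) (S : set (CC R -> CC R)) : Prop :=
  S `<=` OLlt D q /\
  exists U : nat -> set (CC R -> CC R),
    (forall n, OL_open D q ps (U n)) /\ S = \bigcap_n U n.

Definition bdry {R : realType} (A : set (CC R)) : set (CC R) :=
  closure A `\` interior A.

Definition is_component {R : realType} (A E : set (CC R)) : Prop :=
  exists x, A x /\ E = connected_component A x.

Definition totally_unbounded {R : realType} (D : set (CC R))
  (f : CC R -> CC R) : Prop :=
  forall w, bdry D w -> forall d : R, 0 < d ->
  forall E, is_component (disk w d `&` D) E ->
  forall M : R, exists z, E z /\ M < cmod (f z).

Definition dx {R : realType} (rho : CC R -> R) (z : CC R) : R :=
  derive1 (fun t : R => rho (z + (t +i* 0)%C)) 0.
Definition dy {R : realType} (rho : CC R -> R) (z : CC R) : R :=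
  derive1 (fun t : R => rho (z + (0 +i* t)%C)) 0.

Definition C1_boundary {R : realType} (D : set (CC R)) : Prop :=
  forall zeta, bdry D zeta ->
  exists r : R, 0 < r /\ exists rho : CC R -> R,
    (forall z, disk zeta r z -> (D z <-> rho z < 0)) /\
    (forall z, disk zeta r z ->
       derivable (fun t : R => rho (z + (t +i* 0)%C)) 0 1 /\
       derivable (fun t : R => rho (z + (0 +i* t)%C)) 0 1 /\
       {for z, continuous (dx rho)} /\ {for z, continuous (dy rho)} /\
       (dx rho z != 0 \/ dy rho z != 0)).

(* Main.v *)
(* The metric topology is that of the L^{p_j} norms, and point evaluations are
   bounded for them: Goursat's theorem and Cauchy's formula on rectangles bound
   a value by an integral over a square. The space is therefore closed under
   limits of Cauchy sequences (Weierstrass), and a nested-ball argument shows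
   that countably many open dense conditions hold on a dense G_delta set.

   Total unboundedness is the conjunction, over discs with rational centre in
   Omega and radius 1/(n+1) that leave Omega, of the condition that |g| exceeds
   n on the component of the centre; the non-integrability in (iii) is treated
   likewise with the integral of |g|^q over the disc. Each condition is open,
   and it is dense as soon as functions small in the first J norms but large
   near a point v first met by a ray leaving the component are available:
   1/(z - v) in (i); a 2^k-th root of (z - c)/(z - v) in (ii), single valued
   because c and v lie in one component of the complement; in (iii) a dyadic
   power of (z - a)/(z - b) with a, b on the outer normal at v, b tending to v. *)
Require Import Defs.
From HB Require Import structures.
From mathcomp Require Import all_boot all_order all_algebra.
From mathcomp Require Import all_classical all_reals all_analysis.
From mathcomp Require Import measurable_realfun complex.
From mathcomp Require Import ring lra.
Import Order.TTheory GRing.Theory Num.Theory.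
Import numFieldNormedType.Exports.
Import Normc.
Set Implicit Arguments.
Unset Strict Implicit.
Unset Printing Implicit Defensive.
Local Open Scope classical_set_scope.
Local Open Scope ring_scope.
Local Notation Re := complex.Re.
Local Notation Im := complex.Im.
Arguments cmod : simpl never.

(** * Complex derivatives through the modulus *)

(** Two obstacles shape the constructions. In (ii) the component of the complement need not be path
    connected, so a branch of the root cannot be continued along a path inside it. It is transported
    along the connected set by small moves, each uniform only at positive distance from that set,
    and the branches found at different distances are glued afterwards. Orders [2 ^ k] are used
    because existence then rests on the principal square root and uniqueness on a choice of sign. In
    (iii) no positive power of [1 / |z - v|] belongs to every space when [q = +oo]. For finite [q] a
    dyadic exponent that is at least [2 / q] may be too singular for the [p] close to [q]. The way
    out is that density only asks for smallness in [J] norms, with [J] known beforehand: the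
    exponent is chosen after [J], and the pole is pushed off the closure along the normal, where an
    exterior cone makes the function bounded. Point evaluations need neither the value of the
    winding integral nor Hölder's inequality: lower bounds and an elementary splitting suffice,
    since constants do not matter. *)

Section modulus.
Variable R : realType.
Implicit Types (z w : CC R).

Lemma cmodE z : cmod z = normc z. Proof. by case: z. Qed.

Lemma normE z : `|z| = ((cmod z)%:C)%C :> R[i].
Proof. by rewrite normc_def; case: z. Qed.

Lemma cmod_ge0 z : 0 <= cmod z.
Proof. by case: z => a b; rewrite /cmod sqrtr_ge0. Qed.

Lemma cmodM z w : cmod (z * w) = cmod z * cmod w.
Proof. by rewrite !cmodE normcM. Qed.

Lemma cmodD z w : cmod (z + w) <= cmod z + cmod w.
Proof. by rewrite !cmodE le_normcD. Qed.

Lemma cmodN z : cmod (- z) = cmod z.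
Proof. by rewrite !cmodE normcN. Qed.

Lemma cmodV z : cmod (z^-1) = (cmod z)^-1.
Proof. by rewrite !cmodE normcV. Qed.

Lemma cmod0 : cmod (0 : CC R) = 0.
Proof. by rewrite cmodE normc0. Qed.

Lemma cmod1 : cmod (1 : CC R) = 1.
Proof. by rewrite cmodE normc1. Qed.

Lemma cmod_eq0 z : (cmod z == 0) = (z == 0).
Proof.
apply/eqP/eqP => [|->]; last exact: cmod0.
by rewrite cmodE => /eq0_normc.
Qed.

Lemma cmod_gt0 z : (0 < cmod z) = (z != 0).
Proof. by rewrite lt_neqAle cmod_ge0 andbT eq_sym cmod_eq0. Qed.

Lemma cmodX z n : cmod (z ^+ n) = cmod z ^+ n.
Proof. by elim: n => [|n IH]; rewrite ?expr0 ?cmod1// !exprS cmodM IH. Qed.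

Lemma cmodBC z w : cmod (z - w) = cmod (w - z).
Proof. by rewrite -cmodN opprB. Qed.

Lemma cmod_tri z w v : cmod (z - w) <= cmod (z - v) + cmod (v - w).
Proof. by apply: le_trans (cmodD _ _); rewrite addrA subrK. Qed.

Lemma cmodBl z w : cmod z - cmod w <= cmod (z - w).
Proof. by rewrite lerBlDr; apply: le_trans (cmodD _ _); rewrite subrK. Qed.

Lemma cmod_Re z : `|Re z| <= cmod z.
Proof.
case: z => a b /=; rewrite -sqrtr_sqr ler_sqrt ?addr_ge0 ?sqr_ge0//.
by rewrite lerDl sqr_ge0.
Qed.

Lemma cmod_Im z : `|Im z| <= cmod z.
Proof.
case: z => a b /=; rewrite -sqrtr_sqr ler_sqrt ?addr_ge0 ?sqr_ge0//.
by rewrite lerDr sqr_ge0.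
Qed.

Lemma cmod_real (x : R) : cmod (x%:C)%C = `|x|.
Proof. by rewrite /cmod /= expr0n addr0 sqrtr_sqr. Qed.

Lemma cmod_imag (x : R) : cmod (0 +i* x)%C = `|x|.
Proof. by rewrite /cmod /= expr0n add0r sqrtr_sqr. Qed.

Lemma cmod_ReIm z : cmod z <= `|Re z| + `|Im z|.
Proof.
case: z => a b /=; rewrite -(cmod_imag b) -cmod_real.
have -> : (a +i* b)%C = (a%:C)%C + (0 +i* b)%C :> CC R.
  by apply/eqP; rewrite eq_complex /= addr0 add0r !eqxx.
exact: cmodD.
Qed.

(** The norm on [CC R] takes values in [R[i]], where a positive radius is necessarily real: [ltcE]
    splits it into a vanishing imaginary part and a positive real part. All later topology goes
    through this passage to real radii. *)
Lemma nbhs_cmodP z (A : set (CC R)) :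
  nbhs z A <-> exists2 e : R, 0 < e & forall w, cmod (w - z) < e -> A w.
Proof.
split.
- move=> /(@nbhs_normP R[i] (CC R))[[e1 e2]/=]; rewrite ltcE/= => /andP[/eqP e20 e10] zA.
  exists e1 => // w wz; apply: zA => /=.
  by rewrite distrC normE ltcE /= wz andbT e20.
- move=> [e e0 eA]; apply/(@nbhs_normP R[i] (CC R)); exists (e%:C)%C => //=; first by rewrite ltcR.
  by move=> w /=; rewrite distrC normE ltcR; apply: eA.
Qed.

Lemma open_cmodP (A : set (CC R)) :
  open A <-> forall z, A z -> exists2 e : R, 0 < e & disk z e `<=` A.
Proof.
rewrite openE; split=> [oA z /oA|oA z /oA[e e0 eA]].
  by move=> /nbhs_cmodP[e e0 eA]; exists e.
by apply/nbhs_cmodP; exists e.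
Qed.

Lemma closure_cmodP (A : set (CC R)) z :
  closure A z <-> forall e : R, 0 < e -> exists2 w, A w & cmod (w - z) < e.
Proof.
split=> [cA e e0|cA B /nbhs_cmodP[e e0 eB]].
  have /cA[w [Aw wz]] : nbhs z (disk z e) by apply/nbhs_cmodP; exists e.
  by exists w.
by have [w Aw wz] := cA e e0; exists w; split => //; apply: eB.
Qed.

Lemma disk_open z (r : R) : open (disk z r).
Proof.
apply/open_cmodP => w wz; exists (r - cmod (w - z)); first by rewrite subr_gt0.
move=> v; rewrite /disk/= => vw; apply: le_lt_trans (cmod_tri _ _ w) _.
by rewrite -ltrBrDr.
Qed.

Lemma ccont_cmodP (f : CC R -> CC R) z : {for z, continuous f} <->
  forall e : R, 0 < e -> exists2 d : R, 0 < d &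
    forall w, cmod (w - z) < d -> cmod (f w - f z) < e.
Proof.
split=> [cf e e0|cf A /nbhs_cmodP[e e0 eA]].
  have : nbhs (f z) (disk (f z) e) by apply/nbhs_cmodP; exists e.
  by move=> /cf /nbhs_cmodP.
by have [d d0 df] := cf e e0; apply/nbhs_cmodP; exists d => // w /df/eA.
Qed.

Lemma rcont_cmodP (f : CC R -> R) z : {for z, continuous f} <->
  forall e : R, 0 < e -> exists2 d : R, 0 < d &
    forall w, cmod (w - z) < d -> `|f w - f z| < e.
Proof.
split=> [cf e e0|cf A /(@nbhs_normP R R)[e e0 eA]].
  have : nbhs (f z) (ball (f z) e) by apply: nbhsx_ballx.
  move=> /cf /nbhs_cmodP[d d0 df]; exists d => // w /df.
  by rewrite /ball /= distrC.
by have [d d0 df] := cf e e0; apply/nbhs_cmodP; exists d => // w /df H; apply: eA; rewrite /= distrC.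
Qed.

Lemma line_contP (f : R -> CC R) x : {for x, continuous f} <->
  forall e : R, 0 < e -> exists2 d : R, 0 < d &
    forall y, `|y - x| < d -> cmod (f y - f x) < e.
Proof.
split=> [cf e e0|cf A /nbhs_cmodP[e e0 eA]].
  have : nbhs (f x) (disk (f x) e) by apply/nbhs_cmodP; exists e.
  move=> /cf /(@nbhs_normP R R)[d d0 df]; exists d => // w H; apply: df.
  by rewrite /= distrC.
have [d d0 df] := cf e e0; apply/(@nbhs_normP R R); exists d => // y /=.
by rewrite distrC => /df/eA.
Qed.

Lemma divrBr (h a l : CC R) : h != 0 -> h^-1 * a - l = h^-1 * (a - l * h).
Proof. by move=> h0; rewrite mulrBr mulrCA mulVf// mulr1. Qed.

Lemma diffrBr (h a l : CC R) : h != 0 -> a - l * h = h * (h^-1 * a - l).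
Proof. by move=> h0; rewrite mulrBr mulrA divff// mul1r (mulrC l). Qed.

(** Division-free form of complex differentiability: [w = z] needs no exception, and error terms add
    and compose as plain inequalities. *)
Definition cdiff (f : CC R -> CC R) z l := forall e : R, 0 < e ->
  exists2 d : R, 0 < d & forall w, cmod (w - z) < d ->
    cmod (f w - f z - l * (w - z)) <= e * cmod (w - z).

Lemma cdiff_derive f z l : cdiff f z l -> is_derive z 1 f l.
Proof.
move=> fl.
have H : (fun h : CC R => h^-1 *: ((f \o shift z) (h *: (1 : CC R)) - f z)) @ (0 : CC R)^' --> (l : CC R).
  move=> A /nbhs_cmodP[e e0 eA].
  have [d d0 df] := fl (e / 2) (divr_gt0 e0 (ltr0Sn _ _)).
  apply/(@nbhs_normP R[i] (CC R)); exists (d%:C)%C => //=; first by rewrite ltcR.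
  move=> h /=; rewrite sub0r normrN normE ltcR => hd h0; apply: eA.
  rewrite [_ *: 1]mulr1 [_ *: _]/(_ * _).
  have := df (h + z); rewrite addrK => /(_ hd) H.
  have -> : h^-1 * (f (h + z) - f z) - l = h^-1 * (f (h + z) - f z - l * h).
    exact: (@divrBr (h : CC R)).
  rewrite cmodM cmodV mulrC ltr_pdivrMr ?cmod_gt0//.
  apply: le_lt_trans H _; rewrite ltr_pM2r ?cmod_gt0//.
  by rewrite ltr_pdivrMr// mulr_natr mulr2n ltrDl.
apply: DeriveDef; first by apply/cvg_ex; exists l.
exact: cvg_lim.
Qed.

Lemma derive_cdiff f z : derivable f z 1 -> cdiff f z ('D_1 f z).
Proof.
move=> df e e0.
have : (fun h : CC R => h^-1 *: ((f \o shift z) (h *: (1 : CC R)) - f z)) @ (0 : CC R)^' --> 'D_1 f z.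
  exact: df.
move=> /(_ (disk ('D_1 f z) e)).
have : nbhs ('D_1 f z) (disk ('D_1 f z) e) by apply/nbhs_cmodP; exists e.
move=> /[swap]/[apply] /(@nbhs_normP R[i] (CC R))[[d1 d2]/=]; rewrite ltcE/= => /andP[/eqP d20 d10] dA.
exists d1 => // w wz.
have [->|wz0] := eqVneq w z; first by rewrite !subrr mulr0 subrr cmod0 mulr0.
have := dA (w - z); rewrite /= sub0r normrN normE ltcE/= d20 eqxx wz subr_eq0 => /(_ isT wz0).
rewrite /disk/= [_ *: 1]mulr1 [_ *: _]/(_ * _) subrK => /ltW H.
have -> : f w - f z - 'D_1 f z * (w - z) = (w - z) * ((w - z)^-1 * (f w - f z) - 'D_1 f z).
  by apply: (@diffrBr (w - z)); rewrite subr_eq0.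
by rewrite cmodM mulrC ler_wpM2r// cmod_ge0.
Qed.

Lemma derivable_cdiffP f z : derivable f z 1 <-> exists l, cdiff f z l.
Proof.
split=> [/derive_cdiff|[l /cdiff_derive]]; first by exists ('D_1 f z).
by case.
Qed.

Lemma cdiff_continuous f z l : cdiff f z l -> {for z, continuous f}.
Proof.
move=> fl; apply/ccont_cmodP => e e0.
have [d d0 df] := fl 1 ltr01.
have c0 : 0 < 1 + cmod l by rewrite ltr_wpDr ?cmod_ge0.
exists (Num.min d (e / (1 + cmod l))); first by rewrite lt_min d0 divr_gt0.
move=> w; rewrite lt_min ltr_pdivlMr// => /andP[/df H1 H2].
have -> : f w - f z = (f w - f z - l * (w - z)) + l * (w - z) by rewrite subrK.
apply: le_lt_trans (cmodD _ _) (le_lt_trans _ H2).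
by rewrite [leRHS]mulrDr mulr1 cmodM (mulrC (cmod l)) lerD2r -[leRHS]mul1r.
Qed.

Lemma cdiffD f g z k l : cdiff f z k -> cdiff g z l ->
  cdiff (fun w => f w + g w) z (k + l).
Proof.
move=> fk gl e e0.
have e20 : 0 < e / 2 by rewrite divr_gt0.
have [d d0 df] := fk _ e20; have [d' d'0 dg] := gl _ e20.
exists (Num.min d d'); first by rewrite lt_min d0.
move=> w; rewrite lt_min => /andP[/df H1 /dg H2].
have -> : f w + g w - (f z + g z) - (k + l) * (w - z) =
  (f w - f z - k * (w - z)) + (g w - g z - l * (w - z)) by ring.
apply: le_trans (cmodD _ _) _.
by apply: le_trans (lerD H1 H2) _; rewrite -mulrDl -splitr.
Qed.

Lemma cdiff_cst c z : cdiff (fun=> c) z 0.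
Proof. by move=> e e0; exists 1 => // w _; rewrite subrr mul0r subr0 cmod0 mulr_ge0 ?cmod_ge0// ltW. Qed.

Lemma cdiff_id z : cdiff id z 1.
Proof. by move=> e e0; exists 1 => // w _; rewrite mul1r subrr cmod0 mulr_ge0 ?cmod_ge0// ltW. Qed.

Lemma cdiffM f g z k l : cdiff f z k -> cdiff g z l ->
  cdiff (fun w => f w * g w) z (k * g z + f z * l).
Proof.
move=> /cdiff_derive fk /cdiff_derive gl.
have := @is_deriveM R[i] (CC R) f g z 1 k l fk gl.
move=> [dv dE]; have := derive_cdiff dv; rewrite dE.
have -> : f z *: l + g z *: k = k * g z + f z * l by rewrite /GRing.scale/= addrC (mulrC k).
by [].
Qed.

Lemma cdiffV f z k : f z != 0 -> cdiff f z k ->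
  exists l, cdiff (fun w => (f w)^-1) z l.
Proof.
move=> fz0 /cdiff_derive[fk _].
by apply/derivable_cdiffP; apply: derivableV.
Qed.

Lemma cdiff_comp f g z k l : cdiff f z k -> cdiff g (f z) l ->
  cdiff (g \o f) z (l * k).
Proof.
move=> fk gl e e0.
have ck : 0 < 1 + cmod k by rewrite ltr_wpDr ?cmod_ge0.
have cl : 0 < 1 + cmod l by rewrite ltr_wpDr ?cmod_ge0.
(* The bound by 1 gives the Lipschitz estimate [H3] for [f]; the other bound keeps the inner error,
   once multiplied by [l], within half of the allowed error. *)
pose e1 := Num.min 1 (e / 2 / (1 + cmod l)).
have e10 : 0 < e1 by rewrite lt_min ltr01 !divr_gt0.
have e20 : 0 < e / 2 / (1 + cmod k) by rewrite !divr_gt0.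
have [d d0 df] := fk _ e10; have [d' d'0 dg] := gl _ e20.
have /ccont_cmodP /(_ _ d'0)[d2 d20 dc] := cdiff_continuous fk.
exists (Num.min d d2); first by rewrite lt_min d0.
move=> w; rewrite lt_min => /andP[/df H1 /dc /dg H2] /=.
have -> : g (f w) - g (f z) - l * k * (w - z) =
  (g (f w) - g (f z) - l * (f w - f z)) + l * (f w - f z - k * (w - z)) by ring.
apply: le_trans (cmodD _ _) _; rewrite cmodM.
have H3 : cmod (f w - f z) <= (1 + cmod k) * cmod (w - z).
  have -> : f w - f z = (f w - f z - k * (w - z)) + k * (w - z) by rewrite subrK.
  apply: le_trans (cmodD _ _) _; rewrite mulrDl cmodM lerD//.
  by apply: le_trans H1 _; rewrite ler_wpM2r ?cmod_ge0// ge_min lexx.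
rewrite [leRHS](_ : _ = e / 2 * cmod (w - z) + e / 2 * cmod (w - z)); last by lra.
rewrite lerD//.
  apply: le_trans H2 _; rewrite -[leLHS]mulrA ler_pM2l ?divr_gt0//.
  by rewrite ler_pdivrMl.
have H4 : e1 <= e / 2 / (1 + cmod l) by rewrite ge_min lexx orbT.
apply: (@le_trans _ _ ((1 + cmod l) * (e / 2 / (1 + cmod l) * cmod (w - z)))).
  apply: ler_pM => //; rewrite ?cmod_ge0// ?lerDr//.
  by apply: le_trans H1 _; rewrite ler_wpM2r ?cmod_ge0.
by rewrite mulrA [_ * (e / 2 / _)]mulrC divfK ?gt_eqF.
Qed.

End modulus.

(** * Integrals of continuous real functions over segments *)

Section real_integral.
Variable R : realType.
Local Notation mu := (@lebesgue_measure R).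
Implicit Types (a b c x y : R) (u v : R -> R).

Definition rint a b u : R := (\int[mu]_(x in `[a, b]) u x)%R.

(** Continuity is asked in the ambient line even at the end points: restrictions of functions
    continuous at points of the plane have it, and no subspace topology has to be carried along. *)
Definition cts_seg (T : topologicalType) a b (f : R -> T) :=
  forall x, a <= x <= b -> {for x, continuous f}.

Lemma cts_seg_sub (T : topologicalType) a b c d (f : R -> T) :
  a <= c -> d <= b -> cts_seg a b f -> cts_seg c d f.
Proof.
by move=> ac db H x /andP[cx xd]; apply: H; rewrite (le_trans ac)// (le_trans xd).
Qed.

Local Notation rcts := (@cts_seg R).

Lemma cts_seg_integrable a b u : rcts a b u ->
  mu.-integrable `[a, b] (EFin \o u).
Proof.
move=> cu; apply: continuous_compact_integrable; first exact: segment_compact.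
apply: continuous_in_subspaceT => x; rewrite inE/= in_itv/=; exact: cu.
Qed.

Lemma rintD a b u v : rcts a b u -> rcts a b v ->
  rint a b (fun x => u x + v x) = rint a b u + rint a b v.
Proof. by move=> cu cv; rewrite /rint RintegralD//; exact: cts_seg_integrable. Qed.

Lemma rintZ a b k u : rcts a b u ->
  rint a b (fun x => k * u x) = k * rint a b u.
Proof. by move=> cu; rewrite /rint RintegralZl//; exact: cts_seg_integrable. Qed.

Lemma rint_cst a b k : a <= b -> rint a b (fun=> k) = k * (b - a).
Proof.
move=> ab; rewrite /rint Rintegral_cst//=. rewrite lebesgue_measure_itv/= lte_fin.
case: ltP => //= h; suff -> : a = b by rewrite subrr.
by apply/eqP; rewrite eq_le ab h.
Qed.

Lemma le_rint a b u v : rcts a b u -> rcts a b v ->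
  (forall x, a <= x <= b -> u x <= v x) -> rint a b u <= rint a b v.
Proof.
move=> cu cv uv; apply: le_Rintegral => //; try exact: cts_seg_integrable;
  by move=> x; rewrite /= in_itv/=; exact: uv.
Qed.

Lemma eq_rint a b u v : (forall x, a <= x <= b -> u x = v x) ->
  rint a b u = rint a b v.
Proof.
by move=> uv; apply: eq_Rintegral => x; rewrite inE/= in_itv/=; exact: uv.
Qed.

Lemma rint_cat a b c u : a <= b <= c -> rcts a c u ->
  rint a c u = rint a b u + rint b c u.
Proof.
move=> /andP[ab bc] cu; rewrite /rint.
have H := cts_seg_integrable cu.
rewrite -[in RHS](Rintegral_itv_obnd_cbnd (r := b)).
  rewrite -(Rintegral_itvB H) ?bnd_simp//.
  by rewrite addrC subrK.
apply: integrableS H => //; apply: subset_itvr; by rewrite bnd_simp.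
Qed.

Lemma rint_norm a b u : rcts a b u ->
  `|rint a b u| <= rint a b (fun x => `|u x|).
Proof. by move=> cu; apply: le_normr_Rintegral => //; exact: cts_seg_integrable. Qed.

Lemma cts_norm a b u : rcts a b u -> rcts a b (fun x => `|u x|).
Proof. by move=> cu x /cu cx; exact: (continuous_comp cx (@norm_continuous _ _ _)). Qed.

End real_integral.

(** * Integrals of complex functions over segments *)

Section complex_integral.
Variable R : realType.
Implicit Types (a b c x y k : R) (f g : R -> CC R).
Local Notation rcts := (@cts_seg R R).
Local Notation ccts := (@cts_seg R (CC R)).

Lemma eqC (z w : CC R) : Re z = Re w -> Im z = Im w -> z = w.
Proof. by case: z w => [? ?] [? ?] /= -> ->. Qed.

Lemma ReD (z w : CC R) : Re (z + w) = Re z + Re w. Proof. by case: z w => [? ?] [? ?]. Qed.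
Lemma ImD (z w : CC R) : Im (z + w) = Im z + Im w. Proof. by case: z w => [? ?] [? ?]. Qed.
Lemma ReN (z : CC R) : Re (- z) = - Re z. Proof. by case: z => [? ?]. Qed.
Lemma ImN (z : CC R) : Im (- z) = - Im z. Proof. by case: z => [? ?]. Qed.
Lemma ReM (z w : CC R) : Re (z * w) = Re z * Re w - Im z * Im w.
Proof. by case: z w => [? ?] [? ?]. Qed.
Lemma ImM (z w : CC R) : Im (z * w) = Re z * Im w + Im z * Re w.
Proof. by case: z w => [? ?] [? ?]. Qed.
Definition ReImE := (ReD, ImD, ReN, ImN, ReM, ImM).

Definition cint a b f : CC R :=
  (rint a b (fun x => Re (f x)) +i* rint a b (fun x => Im (f x)))%C.

Lemma cts_Re a b f : ccts a b f -> rcts a b (fun x => Re (f x)).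
Proof.
move=> cf x /cf /line_contP H; apply/cvgrPdist_lt => e /H[d d0 dH].
apply/nbhs_normP; exists d => // y /=; rewrite distrC => /dH.
by apply: le_lt_trans; rewrite distrC -ReN -ReD cmod_Re.
Qed.

Lemma cts_Im a b f : ccts a b f -> rcts a b (fun x => Im (f x)).
Proof.
move=> cf x /cf /line_contP H; apply/cvgrPdist_lt => e /H[d d0 dH].
apply/nbhs_normP; exists d => // y /=; rewrite distrC => /dH.
by apply: le_lt_trans; rewrite distrC -ImN -ImD cmod_Im.
Qed.

Lemma cts_cmod a b f : ccts a b f -> rcts a b (fun x => cmod (f x)).
Proof.
move=> cf x /cf /line_contP H; apply/cvgrPdist_lt => e /H[d d0 dH].
apply/nbhs_normP; exists d => // y /=; rewrite distrC => /dH.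
apply: le_lt_trans; rewrite ler_norml; apply/andP; split; last first.
  by rewrite cmodBC cmodBl.
by rewrite lerNl opprB cmodBl.
Qed.

Lemma ctsZ a b f (k : CC R) : ccts a b f -> ccts a b (fun x => k * f x).
Proof.
move=> cf x /cf /line_contP H; apply/line_contP => e e0.
have l0 : 0 < 1 + cmod k by rewrite ltr_pwDl ?cmod_ge0.
have [d d0 dH] := H _ (divr_gt0 e0 l0).
exists d => // y /dH; rewrite ltr_pdivlMr// => h.
rewrite -mulrBr cmodM; have := cmod_ge0 (f y - f x); nra.
Qed.

Lemma cts_cst (T : topologicalType) a b (k : T) : cts_seg a b (fun=> k).
Proof. by move=> x _; exact: cst_continuous. Qed.

Lemma cintD a b f g : ccts a b f -> ccts a b g ->
  cint a b (fun x => f x + g x) = cint a b f + cint a b g.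
Proof.
move=> cf cg; apply: eqC; rewrite ?ReImE /=.
  rewrite -(rintD (cts_Re cf) (cts_Re cg)).
  by apply: eq_rint => x _; rewrite ReD.
rewrite -(rintD (cts_Im cf) (cts_Im cg)).
by apply: eq_rint => x _; rewrite ImD.
Qed.

Lemma rctsZ a b (k : R) (u : R -> R) : rcts a b u -> rcts a b (fun x => k * u x).
Proof. by move=> cu x xab; apply: continuousM; [exact: cst_continuous|exact: cu]. Qed.

Lemma cintZ a b (k : CC R) f : ccts a b f ->
  cint a b (fun x => k * f x) = k * cint a b f.
Proof.
move=> cf; have cR := cts_Re cf; have cI := cts_Im cf.
apply: eqC; rewrite ?ReImE /=.
  rewrite -mulNr -(rintZ _ cR) -(rintZ _ cI) -(rintD (@rctsZ a b _ _ cR) (@rctsZ a b _ _ cI)).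
  by apply: eq_rint => x _; rewrite ReM mulNr.
rewrite -(rintZ _ cR) -(rintZ _ cI) -(rintD (@rctsZ a b _ _ cI) (@rctsZ a b _ _ cR)).
by apply: eq_rint => x _; rewrite ImM.
Qed.

Lemma cint_cst a b (k : CC R) : a <= b -> cint a b (fun=> k) = k * ((b - a)%:C)%C.
Proof.
by move=> ab; apply: eqC; rewrite ?ReImE /= rint_cst// ?mulr0 ?subr0 ?add0r.
Qed.

Lemma eq_cint a b f g : (forall x, a <= x <= b -> f x = g x) ->
  cint a b f = cint a b g.
Proof.
by move=> fg; apply: eqC => /=; apply: eq_rint => x xab; rewrite fg.
Qed.

Lemma cint_cat a b c f : a <= b <= c -> ccts a c f ->
  cint a c f = cint a b f + cint b c f.
Proof.
move=> abc cf; apply: eqC; rewrite ReImE /=.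
  exact: (rint_cat abc (cts_Re cf)).
exact: (rint_cat abc (cts_Im cf)).
Qed.

(** The factor 2 is the price of treating real and imaginary parts separately. It only affects
    constants in later estimates. *)
Lemma cint_norm a b f : ccts a b f ->
  cmod (cint a b f) <= 2 * rint a b (fun x => cmod (f x)).
Proof.
move=> cf; apply: le_trans (cmod_ReIm _) _ => /=; rewrite mulr2n mulrDl mul1r.
have cc := cts_cmod cf.
apply: lerD.
  apply: le_trans (rint_norm (cts_Re cf)) _.
  apply: (le_rint (cts_norm (cts_Re cf)) cc).
  by move=> x _; exact: cmod_Re.
apply: le_trans (rint_norm (cts_Im cf)) _.
apply: (le_rint (cts_norm (cts_Im cf)) cc).
by move=> x _; exact: cmod_Im.
Qed.

Lemma cint_bound a b f M : a <= b -> ccts a b f ->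
  (forall x, a <= x <= b -> cmod (f x) <= M) ->
  cmod (cint a b f) <= 2 * M * (b - a).
Proof.
move=> ab cf fM; apply: le_trans (cint_norm cf) _; rewrite -mulrA ler_pM2l//.
rewrite -rint_cst//; apply: (le_rint (cts_cmod cf)) => //.
by move=> x _; exact: cst_continuous.
Qed.

End complex_integral.

(** * Goursat and Cauchy on rectangles *)

Section goursat.
Variable R : realType.
Implicit Types (a b c d w h : R) (f g : CC R -> CC R) (z : CC R).

Local Notation iC := ((0 +i* 1)%C : CC R).
Local Notation ccts := (@cts_seg R (CC R)).

Lemma cmod_iC : cmod iC = 1.
Proof. by rewrite cmod_imag normr1. Qed.

Lemma cts_hor f a b c : (forall x, a <= x <= b -> {for toC (x, c), continuous f}) ->
  ccts a b (fun x => f (toC (x, c))).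
Proof.
move=> cf x /cf /ccont_cmodP H; apply/line_contP => e /H[d d0 dH].
exists d => // y yx; apply: dH.
have -> : toC (y, c) - toC (x, c) = ((y - x)%:C)%C :> CC R.
  by apply: eqC; rewrite ?ReImE /= ?subrr.
by rewrite cmod_real.
Qed.

Lemma cts_ver f a c d : (forall y, c <= y <= d -> {for toC (a, y), continuous f}) ->
  ccts c d (fun y => f (toC (a, y))).
Proof.
move=> cf x /cf /ccont_cmodP H; apply/line_contP => e /H[r r0 dH].
exists r => // y yx; apply: dH.
have -> : toC (a, y) - toC (a, x) = (0 +i* (y - x))%C :> CC R.
  by apply: eqC; rewrite ?ReImE /= ?subrr.
by rewrite cmod_imag.
Qed.

(** The counterclockwise contour integral, with opposite sides paired so that each integral runs
    over an increasing segment. *)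
Definition rectI f a b c d : CC R :=
  cint a b (fun x => f (toC (x, c)) - f (toC (x, d))) +
  iC * cint c d (fun y => f (toC (b, y)) - f (toC (a, y))).

(** Continuity along the four sides only, so that integrands with a pole inside the rectangle are
    covered. *)
Definition bdcts f a b c d :=
  [/\ ccts a b (fun x => f (toC (x, c))),
      ccts a b (fun x => f (toC (x, d))),
      ccts c d (fun y => f (toC (a, y))) &
      ccts c d (fun y => f (toC (b, y)))].

Definition rect a b c d : set (CC R) :=
  [set z | a <= Re z <= b /\ c <= Im z <= d].

Lemma bdcts_rect f a b c d : a <= b -> c <= d ->
  (forall z, rect a b c d z -> {for z, continuous f}) -> bdcts f a b c d.
Proof.
move=> ab cd H; split.
- by apply: cts_hor => x xab; apply: H; split => //=; rewrite lexx.
- by apply: cts_hor => x xab; apply: H; split => //=; rewrite lexx cd.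
- by apply: cts_ver => x xab; apply: H; split => //=; rewrite lexx.
- by apply: cts_ver => x xab; apply: H; split => //=; rewrite lexx ab.
Qed.

Lemma ctsB a b (f g : R -> CC R) : ccts a b f -> ccts a b g ->
  ccts a b (fun x => f x - g x).
Proof. by move=> cf cg x xab; apply: (continuousB (cf x xab) (cg x xab)). Qed.

Lemma rectI_bound f a b c d M : a <= b -> c <= d -> bdcts f a b c d ->
  (forall x, a <= x <= b -> cmod (f (toC (x, c))) <= M /\ cmod (f (toC (x, d))) <= M) ->
  (forall y, c <= y <= d -> cmod (f (toC (a, y))) <= M /\ cmod (f (toC (b, y))) <= M) ->
  cmod (rectI f a b c d) <= 4 * M * ((b - a) + (d - c)).
Proof.
move=> ab cd [h1 h2 h3 h4] H1 H2; apply: le_trans (cmodD _ _) _.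
rewrite cmodM cmod_iC mul1r mulrDr; apply: lerD.
  have -> : 4 * M = 2 * (2 * M) by ring.
  apply: (cint_bound ab (ctsB h1 h2)).
  move=> x /H1[? ?]; apply: le_trans (cmodD _ _) _; rewrite cmodN; lra.
have -> : 4 * M = 2 * (2 * M) by ring.
apply: (cint_bound cd (ctsB h4 h3)).
move=> x /H2[? ?]; apply: le_trans (cmodD _ _) _; rewrite cmodN; lra.
Qed.

Lemma rectI_cath f a m b c d : a <= m <= b -> bdcts f a b c d ->
  ccts c d (fun y => f (toC (m, y))) ->
  rectI f a b c d = rectI f a m c d + rectI f m b c d.
Proof.
move=> amb [h1 h2 h3 h4] h5; rewrite /rectI.
rewrite (cint_cat amb); last exact: (ctsB h1 h2).
have -> : cint c d (fun y => f (toC (b, y)) - f (toC (a, y))) =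
  cint c d (fun y => f (toC (m, y)) - f (toC (a, y))) +
  cint c d (fun y => f (toC (b, y)) - f (toC (m, y))).
  rewrite -cintD; [|exact: (ctsB h5 h3)|exact: (ctsB h4 h5)].
  by apply: eq_cint => y _; ring.
ring.
Qed.

Lemma rectI_catv f a b c m d : c <= m <= d -> bdcts f a b c d ->
  ccts a b (fun x => f (toC (x, m))) ->
  rectI f a b c d = rectI f a b c m + rectI f a b m d.
Proof.
move=> amb [h1 h2 h3 h4] h5; rewrite /rectI.
rewrite [cint c d _](cint_cat amb); last exact: (ctsB h4 h3).
have -> : cint a b (fun y => f (toC (y, c)) - f (toC (y, d))) =
  cint a b (fun y => f (toC (y, c)) - f (toC (y, m))) +
  cint a b (fun y => f (toC (y, m)) - f (toC (y, d))).
  rewrite -cintD; [|exact: (ctsB h1 h5)|exact: (ctsB h5 h2)].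
  by apply: eq_cint => y _; ring.
ring.
Qed.

(** The constants cancel between opposite sides, and the linear term contributes
    [l * iC * (d - c) * (b - a)] horizontally and the opposite vertically. This is what allows
    Goursat's argument to subtract a tangent. *)
Lemma rectI_affine f a b c d (k l : CC R) : a <= b -> c <= d -> bdcts f a b c d ->
  rectI (fun z => f z - k - l * z) a b c d = rectI f a b c d.
Proof.
move=> ab cd [h1 h2 h3 h4]; rewrite /rectI.
have -> : cint a b (fun x => f (toC (x, c)) - k - l * toC (x, c) - (f (toC (x, d)) - k - l * toC (x, d))) =
   cint a b (fun x => f (toC (x, c)) - f (toC (x, d))) + cint a b (fun x => l * (iC * ((d - c)%:C)%C)).
  rewrite -cintD; [|exact: (ctsB h1 h2)|exact: cts_cst].
  apply: eq_cint => x _.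
  have -> : iC * ((d - c)%:C)%C = toC (x, d) - toC (x, c) :> CC R.
    by apply: eqC; rewrite ?ReImE /= ?mul0r ?mul1r ?mulr0 ?subrr ?add0r ?addr0.
  ring.
have -> : cint c d (fun x => f (toC (b, x)) - k - l * toC (b, x) - (f (toC (a, x)) - k - l * toC (a, x))) =
   cint c d (fun x => f (toC (b, x)) - f (toC (a, x))) + cint c d (fun x => - l * ((b - a)%:C)%C).
  rewrite -cintD; [|exact: (ctsB h4 h3)|exact: cts_cst].
  apply: eq_cint => x _.
  have -> : ((b - a)%:C)%C = toC (b, x) - toC (a, x) :> CC R.
    by apply: eqC; rewrite ?ReImE /= ?subrr.
  ring.
rewrite !cint_cst//.
ring.
Qed.

Lemma ccont_sub_affine f (k l : CC R) z : {for z, continuous f} ->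
  {for z, continuous (fun z => f z - k - l * z)}.
Proof.
move=> /ccont_cmodP cf; apply/ccont_cmodP => e e0.
have e20 : 0 < e / 2 by rewrite divr_gt0.
have [d d0 df] := cf _ e20.
have l0 : 0 < 1 + cmod l by rewrite ltr_pwDl ?cmod_ge0.
exists (Num.min d (e / 2 / (1 + cmod l))); first by rewrite lt_min d0 divr_gt0.
move=> w; rewrite lt_min ltr_pdivlMr// => /andP[/df H1 H2].
have -> : f w - k - l * w - (f z - k - l * z) = (f w - f z) - l * (w - z) by ring.
apply: le_lt_trans (cmodD _ _) _; rewrite cmodN cmodM.
have := cmod_ge0 (w - z); have := cmod_ge0 l; nra.
Qed.

Lemma rectI_quad f a m b c n d : a <= m <= b -> c <= n <= d ->
  (forall z, rect a b c d z -> {for z, continuous f}) ->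
  rectI f a b c d = (rectI f a m c n + rectI f a m n d) +
                    (rectI f m b c n + rectI f m b n d).
Proof.
move=> /andP[am mb] /andP[cn nd] H.
have ab := le_trans am mb; have cd := le_trans cn nd.
have H1 : forall z, rect a m c d z -> {for z, continuous f}.
  by move=> z [/andP[z1 z2] z3]; apply: H; split => //; rewrite z1 (le_trans z2).
have H2 : forall z, rect m b c d z -> {for z, continuous f}.
  by move=> z [/andP[z1 z2] z3]; apply: H; split => //; rewrite z2 (le_trans _ z1).
have amb : a <= m <= b by rewrite am.
have cnd : c <= n <= d by rewrite cn.
have [_ _ _ v] := bdcts_rect am cd H1.
have v1 : ccts a m (fun x => f (toC (x, n))).
  by apply: cts_hor => x xam; apply: H1; split; rewrite /= ?cn.
have v2 : ccts m b (fun x => f (toC (x, n))).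
  by apply: cts_hor => x xam; apply: H2; split; rewrite /= ?cn.
by rewrite (rectI_cath amb (bdcts_rect ab cd H) v) (rectI_catv cnd (bdcts_rect am cd H1) v1)
  (rectI_catv cnd (bdcts_rect mb cd H2) v2).
Qed.

Lemma nested_intervals (u : nat -> R) (v : nat -> R) :
  (forall n, u n <= u n.+1) -> (forall n, v n.+1 <= v n) ->
  (forall n, u n <= v n) -> exists x, forall n, u n <= x <= v n.
Proof.
move=> iu iv uv.
have um : {homo u : m n / (m <= n)%N >-> m <= n}.
  by apply: homo_leq => // ? ? ?; exact: le_trans.
have vm : {homo v : m n / (m <= n)%N >-> n <= m}.
  by apply: (homo_leq (r := fun x y => y <= x)) => // y x z /[swap]; exact: le_trans.
have uvmn m n : u m <= v n.
  apply: (@le_trans _ _ (u (maxn m n))); first by rewrite um// leq_maxl.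
  by apply: (le_trans (uv _)); rewrite vm// leq_maxr.
exists (sup (range u)) => n; apply/andP; split.
  apply: ub_le_sup; last by exists n.
  by exists (v 0%N) => _ [m _ <-].
by apply: ge_sup; [exists (u 0%N), 0%N|move=> _ [m _ <-]].
Qed.

Lemma four_le (x y z w : CC R) (K : R) : K <= cmod ((x + y) + (z + w)) ->
  [\/ K <= 4 * cmod x, K <= 4 * cmod y, K <= 4 * cmod z | K <= 4 * cmod w].
Proof.
move=> H; have := le_trans H (cmodD _ _).
have := cmodD x y; have := cmodD z w => H1 H2 H3.
have [?|h1] := leP K (4 * cmod x); first by constructor 1.
have [?|h2] := leP K (4 * cmod y); first by constructor 2.
have [?|h3] := leP K (4 * cmod z); first by constructor 3.
by constructor 4; lra.
Qed.

(** One bisection: [p] and [q] are lower left corners, and among the four quarters one carries at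
    least a quarter of the integral. *)
Lemma goursat_step f a c w h n K (p : R * R) : 0 <= w -> 0 <= h ->
  (forall z, rect a (a + w) c (c + h) z -> {for z, continuous f}) ->
  a <= p.1 -> p.1 + w / 2 ^+ n <= a + w ->
  c <= p.2 -> p.2 + h / 2 ^+ n <= c + h ->
  K <= 4 ^+ n * cmod (rectI f p.1 (p.1 + w / 2 ^+ n) p.2 (p.2 + h / 2 ^+ n)) ->
  exists q : R * R, [/\
    K <= 4 ^+ n.+1 * cmod (rectI f q.1 (q.1 + w / 2 ^+ n.+1) q.2 (q.2 + h / 2 ^+ n.+1)),
    p.1 <= q.1, q.1 + w / 2 ^+ n.+1 <= p.1 + w / 2 ^+ n,
    p.2 <= q.2 & q.2 + h / 2 ^+ n.+1 <= p.2 + h / 2 ^+ n].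
Proof.
case: p => x y /= w0 h0 cf ax xw cy yh HK.
pose w1 := w / 2 ^+ n.+1; pose h1 := h / 2 ^+ n.+1.
have w10 : 0 <= w1 by rewrite divr_ge0.
have h10 : 0 <= h1 by rewrite divr_ge0.
have wE : w / 2 ^+ n = w1 + w1.
  by rewrite /w1 exprS; field; rewrite expf_neq0.
have hE : h / 2 ^+ n = h1 + h1.
  by rewrite /h1 exprS; field; rewrite expf_neq0.
rewrite wE in xw HK *; rewrite hE in yh HK *; rewrite -/w1 -/h1.
have p4 : (0 : R) < 4 ^+ n by rewrite exprn_gt0.
rewrite (@rectI_quad f x (x + w1) (x + (w1 + w1)) y (y + h1) (y + (h1 + h1))) in HK; first last.
- by move=> z [/andP[z1 z2] /andP[z3 z4]]; apply: cf; split; lra.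
- by apply/andP; split; lra.
- by apply/andP; split; lra.
rewrite -ler_pdivrMl// in HK.
have four (t : R) : (4 ^+ n)^-1 * K <= 4 * t -> K <= 4 ^+ n.+1 * t.
  by rewrite ler_pdivrMl// exprS mulrA (mulrC (4 ^+ n)).
have [] := four_le HK => /four H.
- exists (x, y) => /=; split => //; rewrite ?lexx//; lra.
- exists (x, y + h1) => /=; split; try lra.
  by move: H; rewrite !addrA.
- exists (x + w1, y) => /=; split; try lra.
  by move: H; rewrite !addrA.
- exists (x + w1, y + h1) => /=; split; try lra.
  by move: H; rewrite !addrA.
Qed.

Lemma goursat f a b c d : a <= b -> c <= d ->
  (forall z, rect a b c d z -> exists l, cdiff f z l) -> rectI f a b c d = 0.
Proof.
move=> ab cd df.
have cf z : rect a b c d z -> {for z, continuous f}.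
  by move=> /df[l]; exact: cdiff_continuous.
pose w := b - a; pose h := d - c.
have w0 : 0 <= w by rewrite subr_ge0.
have h0 : 0 <= h by rewrite subr_ge0.
have bE : b = a + w by rewrite /w addrC subrK.
have dE : d = c + h by rewrite /h addrC subrK.
rewrite {}bE {}dE in df cf *.
set K := cmod (rectI f a (a + w) c (c + h)).
(* The index is stored next to the corner because the relation given to [dependent_choice] sees only
   two consecutive terms. *)
pose P (np : nat * (R * R)) := [/\
  K <= 4 ^+ np.1 * cmod (rectI f np.2.1 (np.2.1 + w / 2 ^+ np.1) np.2.2 (np.2.2 + h / 2 ^+ np.1)),
  a <= np.2.1, np.2.1 + w / 2 ^+ np.1 <= a + w, c <= np.2.2 & np.2.2 + h / 2 ^+ np.1 <= c + h].
pose Q (np mq : {np | P np}) := [/\ (sval mq).1 = (sval np).1.+1,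
  (sval np).2.1 <= (sval mq).2.1,
  (sval mq).2.1 + w / 2 ^+ (sval np).1.+1 <= (sval np).2.1 + w / 2 ^+ (sval np).1,
  (sval np).2.2 <= (sval mq).2.2 &
  (sval mq).2.2 + h / 2 ^+ (sval np).1.+1 <= (sval np).2.2 + h / 2 ^+ (sval np).1].
have PQ (np : {np | P np}) : {mq | Q np mq}.
  apply/cid; case: np => -[n p] [/= p1 p2 p3 p4 p5].
  have [q [q1 q2 q3 q4 q5]] := goursat_step w0 h0 cf p2 p3 p4 p5 p1.
  have Pq : P (n.+1, q).
    split => //=; [exact: le_trans q2|exact: le_trans q3 p3|exact: le_trans q4|exact: le_trans q5 p5].
  by exists (exist _ (n.+1, q) Pq).
have P0 : P (0%N, (a, c)).
  by split; rewrite /= ?expr0 ?divr1 ?mul1r.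
have [s [s0 sQ]] := dependent_choice PQ (exist _ (0%N, (a, c)) P0).
have sn n : (sval (s n)).1 = n.
  by elim: n => [|n IH]; [rewrite s0|have [-> _ _ _ _] := sQ n; rewrite IH].
pose x n := (sval (s n)).2.1; pose y n := (sval (s n)).2.2.
have sP n : [/\ K <= 4 ^+ n * cmod (rectI f (x n) (x n + w / 2 ^+ n) (y n) (y n + h / 2 ^+ n)),
    a <= x n, x n + w / 2 ^+ n <= a + w, c <= y n & y n + h / 2 ^+ n <= c + h].
  by have := svalP (s n); rewrite /P sn.
have [X HX] : exists X, forall n, x n <= X <= x n + w / 2 ^+ n.
  apply: nested_intervals => n; rewrite ?lerDl ?divr_ge0//; have [_ h1 h2 _ _] := sQ n => //.
  by rewrite sn in h2.
have [Y HY] : exists Y, forall n, y n <= Y <= y n + h / 2 ^+ n.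
  apply: nested_intervals => n; rewrite ?lerDl ?divr_ge0//; have [_ _ _ h1 h2] := sQ n => //.
  by rewrite sn in h2.
have [l fl] : exists l, cdiff f (toC (X, Y)) l.
  have := HX 0%N; have := HY 0%N; rewrite /x /y s0/= expr0 !divr1 => h1 h2.
  by apply: df; split.
suff : K <= 0.
  by move=> K0; apply/eqP; rewrite -cmod_eq0 eq_le K0 cmod_ge0.
apply/ler_addgt0Pr => e e0; rewrite add0r.
(* The final estimate is [4 * (w + h) ^+ 2] times [e1]; the added 1 keeps the denominator positive
   for a degenerate rectangle. *)
pose e1 := e / (4 * (w + h) ^+ 2 + 1).
have den0 : 0 < 4 * (w + h) ^+ 2 + 1 by have := sqr_ge0 (w + h); lra.
have e10 : 0 < e1 by rewrite divr_gt0.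
have [r r0 fr] := fl _ e10.
have [n nr] : exists n, (w + h) / 2 ^+ n < r.
  have [N HN] : exists N : nat, (w + h) / r < N%:R.
    exists (Num.bound ((w + h) / r)).
    by apply: archi_boundP; apply: divr_ge0; [exact: addr_ge0|exact: ltW].
  exists N; rewrite ltr_pdivrMr ?exprn_gt0// mulrC -ltr_pdivrMr//.
  apply: lt_trans HN _; rewrite -natrX ltr_nat; exact: ltn_expl.
have [Kn h1 h2 h3 h4] := sP n.
set w1 := w / 2 ^+ n in Kn h2 *; set k1 := h / 2 ^+ n in Kn h4 *.
have w10 : 0 <= w1 by rewrite divr_ge0.
have k10 : 0 <= k1 by rewrite divr_ge0.
have xw : x n <= x n + w1 by rewrite lerDl.
have yk : y n <= y n + k1 by rewrite lerDl.
have cf' z : rect (x n) (x n + w1) (y n) (y n + k1) z -> {for z, continuous f}.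
  move=> [/andP[z1 z2] /andP[z3 z4]]; apply: cf; split; apply/andP; split; clear -z1 z2 z3 z4 h1 h2 h3 h4; lra.
have bd := bdcts_rect xw yk cf'.
have := HX n; have := HY n; rewrite -/w1 -/k1 => /andP[HY1 HY2] /andP[HX1 HX2].
have wh1 : w1 + k1 < r by rewrite /w1 /k1 -mulrDl.
pose z0 := toC (X, Y) : CC R.
(* Subtracting the tangent at the common point [z0] of all rectangles leaves the integral unchanged
   and makes the integrand at most [e1] times the size of the rectangle. *)
pose g z := f z - (f z0 - l * z0) - l * z.
have gM z : rect (x n) (x n + w1) (y n) (y n + k1) z -> cmod (g z) <= e1 * (w1 + k1).
  move=> [/andP[z1 z2] /andP[z3 z4]].
  have zz0 : cmod (z - z0) <= w1 + k1.
    apply: le_trans (cmod_ReIm _) _; rewrite !ReImE /=.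
    clear -z1 z2 z3 z4 HX1 HX2 HY1 HY2.
    by apply: lerD; rewrite ler_norml; apply/andP; split; lra.
  have -> : g z = f z - f z0 - l * (z - z0) by rewrite /g; ring.
  apply: le_trans (fr z (le_lt_trans zz0 wh1)) _.
  by rewrite ler_wpM2l// ltW.
have gc z : rect (x n) (x n + w1) (y n) (y n + k1) z -> {for z, continuous g}.
  by move=> /cf'; exact: ccont_sub_affine.
have bdg := bdcts_rect xw yk gc.
have E : rectI g (x n) (x n + w1) (y n) (y n + k1) = rectI f (x n) (x n + w1) (y n) (y n + k1).
  exact: (rectI_affine _ _ xw yk bd).
have In : cmod (rectI g (x n) (x n + w1) (y n) (y n + k1)) <= 4 * (e1 * (w1 + k1)) * (w1 + k1).
  have -> : w1 + k1 = (x n + w1 - x n) + (y n + k1 - y n) by ring.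
  have H := gM; rewrite (_ : w1 + k1 = (x n + w1 - x n) + (y n + k1 - y n)) in H; last by ring.
  apply: (rectI_bound xw yk bdg) => t t1; split; apply: H; split; rewrite /= ?lexx ?xw ?yk //.
rewrite E in In.
apply: le_trans Kn _.
apply: (@le_trans _ _ (4 ^+ n * (4 * (e1 * (w1 + k1)) * (w1 + k1)))).
  by rewrite ler_wpM2l// exprn_ge0.
have -> : 4 ^+ n * (4 * (e1 * (w1 + k1)) * (w1 + k1)) = e1 * (4 * (w + h) ^+ 2).
  rewrite /w1 /k1 -mulrDl.
  have -> : (4 : R) ^+ n = 2 ^+ n * 2 ^+ n.
    by rewrite -exprMn -natrM.
  by field; rewrite expf_neq0.
by rewrite /e1 -mulrA ler_piMr ?(ltW e0)// ler_pdivrMl// mulr1 lerDl.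
Qed.

End goursat.

(** * Removable points and Cauchy's formula on rectangles *)

Section cauchy.
Variable R : realType.
Implicit Types (a b c d x y : R) (f g : CC R -> CC R) (z w : CC R).

Local Notation iC := ((0 +i* 1)%C : CC R).
Local Notation ccts := (@cts_seg R (CC R)).

Lemma rectI_norm f a b c d : bdcts f a b c d ->
  cmod (rectI f a b c d) <=
  2 * (rint a b (fun x => cmod (f (toC (x, c)))) + rint a b (fun x => cmod (f (toC (x, d)))) +
       rint c d (fun y => cmod (f (toC (a, y)))) + rint c d (fun y => cmod (f (toC (b, y))))).
Proof.
move=> [h1 h2 h3 h4].
have H u v a' b' : ccts a' b' u -> ccts a' b' v ->
    cmod (cint a' b' (fun x => u x - v x : CC R)) <=
    2 * (rint a' b' (fun x => cmod (u x)) + rint a' b' (fun x => cmod (v x))).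
  move=> cu cv; apply: le_trans (cint_norm (ctsB cu cv)) _; rewrite ler_pM2l//.
  have cu' := cts_cmod cu; have cv' := cts_cmod cv.
  rewrite -rintD//; apply: le_rint; first exact: cts_cmod (ctsB cu cv).
    by move=> x xab; apply: continuousD; [exact: cu'|exact: cv'].
  by move=> x _; rewrite -(cmodN (v x)); exact: cmodD.
apply: le_trans (cmodD _ _) _; rewrite cmodM cmod_iC mul1r.
have := H _ _ _ _ h1 h2; have := H _ _ _ _ h4 h3; lra.
Qed.

Lemma bdcts_lin f g a b c d (k : CC R) : bdcts f a b c d -> bdcts g a b c d ->
  bdcts (fun z => f z - k * g z) a b c d.
Proof.
move=> [h1 h2 h3 h4] [k1 k2 k3 k4]; split.
- exact: ctsB h1 (ctsZ (k:=k) k1).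
- exact: ctsB h2 (ctsZ (k:=k) k2).
- exact: ctsB h3 (ctsZ (k:=k) k3).
- exact: ctsB h4 (ctsZ (k:=k) k4).
Qed.

Lemma rectI_lin f g a b c d (k : CC R) : bdcts f a b c d -> bdcts g a b c d ->
  rectI (fun z => f z - k * g z) a b c d = rectI f a b c d - k * rectI g a b c d.
Proof.
move=> [h1 h2 h3 h4] [k1 k2 k3 k4].
have H u v u' v' a' b' : ccts a' b' u -> ccts a' b' v ->
     ccts a' b' u' -> ccts a' b' v' ->
    cint a' b' (fun x => (u x - k * u' x) - (v x - k * v' x) : CC R) =
    cint a' b' (fun x => u x - v x) - k * cint a' b' (fun x => u' x - v' x).
  move=> cu cv cu' cv'; rewrite -mulNr -cintZ; last exact: ctsB cu' cv'.
  rewrite -cintD; [|exact: ctsB cu cv|]; last first.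
    exact: ctsZ (ctsB cu' cv').
  by apply: eq_cint => x _; ring.
rewrite /rectI (H _ _ _ _ _ _ h1 h2 k1 k2) (H _ _ _ _ _ _ h4 h3 k4 k3).
ring.
Qed.

Definition inrect w a b c d := a < Re w < b /\ c < Im w < d.

Lemma toC_neq w x y : (x != Re w) || (y != Im w) -> toC (x, y) != w.
Proof. by move=> H; apply/eqP => E; move: H; rewrite -E /= !eqxx. Qed.

Lemma bdcts_off f w a b c d : a <= b -> c <= d ->
  a != Re w -> b != Re w -> c != Im w -> d != Im w ->
  (forall z, rect a b c d z -> z != w -> {for z, continuous f}) -> bdcts f a b c d.
Proof.
move=> ab cd aw bw cw dw H; split.
- by apply: cts_hor => x xab; apply: H; [split; rewrite /= ?lexx ?cd|apply: toC_neq; rewrite cw orbT].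
- by apply: cts_hor => x xab; apply: H; [split; rewrite /= ?lexx ?cd|apply: toC_neq; rewrite dw orbT].
- by apply: cts_ver => x xab; apply: H; [split; rewrite /= ?lexx ?ab|apply: toC_neq; rewrite aw].
- by apply: cts_ver => x xab; apply: H; [split; rewrite /= ?lexx ?ab|apply: toC_neq; rewrite bw].
Qed.

(* Off an isolated point near which it is bounded, a differentiable function
   still has zero contour integral: cut out a small square about the point. *)
Lemma goursat_bounded f w a b c d (B e0 : R) : inrect w a b c d -> 0 < e0 ->
  (forall z, rect a b c d z -> z != w -> exists l, cdiff f z l) ->
  (forall z, z != w -> cmod (z - w) < e0 -> cmod (f z) <= B) ->
  rectI f a b c d = 0.
Proof.
move=> [/andP[aw wb] /andP[cw wd]] e00 df fB.
have cf z : rect a b c d z -> z != w -> {for z, continuous f}.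
  by move=> rz zw; have [l] := df z rz zw; exact: cdiff_continuous.
have B0 : 0 <= B.
  pose z := w + ((e0 / 2)%:C)%C.
  have zw : cmod (z - w) = e0 / 2 by rewrite /z addrC addKr cmod_real ger0_norm//; lra.
  apply: le_trans (cmod_ge0 (f z)) (fB z _ _); last by rewrite zw; lra.
  by rewrite -subr_eq0 -cmod_gt0 zw; lra.
apply/eqP; rewrite -cmod_eq0 eq_le cmod_ge0 andbT.
apply/ler_addgt0Pr => e e_gt0; rewrite add0r.
(* The square of half-side [s] has contour integral at most [16 * B * s], which explains the first
   term; [e0 / 4] keeps the square where [f] is bounded by [B], and the halved margins keep it
   strictly inside the rectangle. *)
pose s := Num.min (e / (16 * (B + 1))) (Num.min (e0 / 4)
  (Num.min (Num.min ((Re w - a) / 2) ((b - Re w) / 2)) (Num.min ((Im w - c) / 2) ((d - Im w) / 2)))).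
have s0 : 0 < s.
  rewrite !lt_min !divr_gt0//; lra.
have : s <= s by [].
rewrite {2}/s !le_min => /and3P[s1 s2 /andP[/andP[s3 s4] /andP[s5 s6]]].
clearbody s.
have L1 : rectI f a b c d = rectI f (Re w - s) b c d.
  rewrite (@rectI_cath _ f a (Re w - s) b c d); first last.
  - by apply: cts_ver => y yx; apply: cf; [split => //=; lra|apply: toC_neq; apply/orP; left; lra].
  - by apply: (@bdcts_off f w) => //; lra.
  - by lra.
  rewrite goursat ?add0r//; try lra.
  move=> z [z1 z2]; apply: df; first by split => //; lra.
  by apply/eqP => zE; move: z1; rewrite zE; lra.
rewrite {}L1.
have L2 : rectI f (Re w - s) b c d = rectI f (Re w - s) (Re w + s) c d.
  rewrite (@rectI_cath _ f (Re w - s) (Re w + s) b c d); first last.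
  - by apply: cts_ver => y yx; apply: cf; [split => //=; lra|apply: toC_neq; apply/orP; left; lra].
  - apply: (@bdcts_off f w) => //; try lra.
    by move=> z [z1 z2]; apply: cf; split => //; lra.
  - by lra.
  rewrite [X in _ + X]goursat ?addr0//; try lra.
  move=> z [z1 z2]; apply: df; first by split => //; lra.
  by apply/eqP => zE; move: z1; rewrite zE; lra.
rewrite {}L2.
have L3 : rectI f (Re w - s) (Re w + s) c d = rectI f (Re w - s) (Re w + s) (Im w - s) d.
  rewrite (@rectI_catv _ f (Re w - s) (Re w + s) c (Im w - s) d); first last.
  - by apply: cts_hor => y yx; apply: cf; [split => //=; lra|apply: toC_neq; apply/orP; right; lra].
  - apply: (@bdcts_off f w) => //; try lra.
    by move=> z [z1 z2]; apply: cf; split => //; lra.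
  - by lra.
  rewrite goursat ?add0r//; try lra.
  move=> z [z1 z2]; apply: df; first by split => //; lra.
  by apply/eqP => zE; move: z2; rewrite zE; lra.
have cfs z : rect (Re w - s) (Re w + s) (Im w - s) (Im w + s) z -> z != w -> {for z, continuous f}.
  by move=> [z1 z2]; apply: cf; split; lra.
rewrite {}L3.
have L4 : rectI f (Re w - s) (Re w + s) (Im w - s) d = rectI f (Re w - s) (Re w + s) (Im w - s) (Im w + s).
  rewrite (@rectI_catv _ f (Re w - s) (Re w + s) (Im w - s) (Im w + s) d); first last.
  - by apply: cts_hor => y yx; apply: cf; [split => //=; lra|apply: toC_neq; apply/orP; right; lra].
  - apply: (@bdcts_off f w) => //; try lra.
    by move=> z [z1 z2]; apply: cf; split => //; lra.
  - by lra.
  rewrite [X in _ + X]goursat ?addr0//; try lra.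
  move=> z [z1 z2]; apply: df; first by split => //; lra.
  by apply/eqP => zE; move: z2; rewrite zE; lra.
rewrite {}L4.
have bd : bdcts f (Re w - s) (Re w + s) (Im w - s) (Im w + s).
  by apply: (@bdcts_off f w) => //; lra.
have near x y : (x != Re w) || (y != Im w) ->
   Re w - s <= x <= Re w + s -> Im w - s <= y <= Im w + s -> cmod (f (toC (x, y))) <= B.
  move=> xyw x1 y1; apply: fB; first exact: toC_neq.
  apply: le_lt_trans (cmod_ReIm _) _; rewrite !ReImE /=.
  have : `|x - Re w| <= s by rewrite ler_norml; lra.
  have : `|y - Im w| <= s by rewrite ler_norml; lra.
  lra.
apply: (@le_trans _ _ (4 * B * ((Re w + s - (Re w - s)) + (Im w + s - (Im w - s))))).
  have s00 : s != 0 by rewrite gt_eqF.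
  have h1 (x : R) : x + s != x by rewrite -subr_eq0 addrAC subrr add0r.
  have h2 (x : R) : x - s != x by rewrite -subr_eq0 addrAC subrr add0r oppr_eq0.
  have h3 (x : R) : x - s <= x - s <= x + s by lra.
  have h4 (x : R) : x - s <= x + s <= x + s by lra.
  apply: (rectI_bound _ _ bd); [lra|lra| |] => t t1; split; apply: near => //;
    by rewrite ?h1 ?h2 ?orbT.
have -> : 4 * B * ((Re w + s - (Re w - s)) + (Im w + s - (Im w - s))) = s * (16 * B) by ring.
have B1 : 0 < 16 * (B + 1) by clear -B0; lra.
clear bd near cfs cf df fB; move: s1; rewrite ler_pdivlMr//.
have : s * (16 * (B + 1)) = s * (16 * B) + 16 * s by ring.
lra.
Qed.

Lemma cdiff_inv_sub w z : z != w -> exists l, cdiff (fun z => (z - w)^-1) z l.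
Proof.
move=> zw; apply: (@cdiffV _ (fun z => z - w) z (1 + 0)); first by rewrite subr_eq0.
exact: cdiffD (@cdiff_id _ z) (@cdiff_cst _ (- w) z).
Qed.

Lemma cdiff_div_sub f w z : z != w -> (exists l, cdiff f z l) ->
  exists l, cdiff (fun z => f z * (z - w)^-1) z l.
Proof. by move=> /cdiff_inv_sub[k kE] [l lE]; eexists; exact: cdiffM lE kE. Qed.

(** Classically [2 * pi * i]. The value is never computed; a lower bound on the modulus and a bound
    on the variation with [w] are enough. *)
Definition winding w a b c d : CC R := rectI (fun z => (z - w)^-1) a b c d.

(** The difference quotient [k] of [f] at [w] is bounded near [w] by [1 + cmod lw], so
    [goursat_bounded] makes its contour integral vanish although nothing is known about its
    differentiability at [w]. *)
Lemma cauchy f w a b c d : inrect w a b c d ->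
  (forall z, rect a b c d z -> exists l, cdiff f z l) ->
  f w * winding w a b c d = rectI (fun z => f z * (z - w)^-1) a b c d.
Proof.
move=> iw df; have [/andP[aw wb] /andP[cw wd]] := iw.
have rw : rect a b c d w by split; lra.
have [lw flw] := df _ rw.
have := flw 1 ltr01 => -[e0 e00 Hf].
pose k z := f z * (z - w)^-1 - f w * (z - w)^-1.
have H0 : rectI k a b c d = 0.
  apply: (@goursat_bounded k w a b c d (1 + cmod lw) e0) => //.
    move=> z rz zw; have [l fl] := cdiff_div_sub zw (df z rz).
    have [m Hm] := cdiff_inv_sub zw.
    have := cdiffD fl (cdiffM (@cdiff_cst _ (- f w) z) Hm).
    set l' := (X in cdiff _ _ X) => H; exists l'.
    have -> // : k = (fun z => f z / (z - w) + - f w / (z - w)).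
    by apply/funext => v; rewrite /k mulNr.
  move=> z zw /Hf; rewrite mul1r => H.
  rewrite /k -mulrBl cmodM cmodV ler_pdivrMr ?cmod_gt0 ?subr_eq0//.
  have -> : f z - f w = (f z - f w - lw * (z - w)) + lw * (z - w) by rewrite subrK.
  by apply: le_trans (cmodD _ _) _; rewrite cmodM mulrDl mul1r lerD2r.
apply/eqP; rewrite -subr_eq0 -oppr_eq0 opprB /winding -rectI_lin.
- by apply/eqP; rewrite -H0.
- apply: (@bdcts_off _ w); try lra.
  move=> z rz zw; have [l] := cdiff_div_sub zw (df z rz); exact: cdiff_continuous.
- apply: (@bdcts_off _ w); try lra.
  move=> z rz zw; have [l] := cdiff_inv_sub zw; exact: cdiff_continuous.
Qed.

End cauchy.

(** * Cauchy estimates from a lower bound on the winding integral *)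

Section cauchy_estimates.
Variable R : realType.
Implicit Types (a b c d r x y : R) (f g : CC R -> CC R) (z w : CC R).

Lemma rint_inv_ge (u v : R -> R) a b r : 0 < r -> 2 * r <= b - a ->
  @cts_seg R R a b u -> @cts_seg R R a b v ->
  (forall x, a <= x <= b -> (8 * r)^-1 <= u x /\ v x <= - (8 * r)^-1) ->
  1 / 2 <= rint a b (fun x => u x - v x).
Proof.
move=> r0 ab cu cv H.
have ab' : a <= b by lra.
apply: (@le_trans _ _ (rint a b (fun=> (4 * r)^-1))).
  rewrite rint_cst//; apply: (@le_trans _ _ ((4 * r)^-1 * (2 * r))).
    have -> : (4 * r)^-1 * (2 * r) = 1 / 2 by field; lra.
    by [].
  by rewrite ler_pM2l// invr_gt0; lra.
apply: le_rint; first exact: cts_cst.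
  by move=> x xab; apply: continuousB; [exact: cu|exact: cv].
move=> x /H[h1 h2].
have -> : (4 * r)^-1 = (8 * r)^-1 + (8 * r)^-1 by field; lra.
lra.
Qed.

(** The numerator is at least [r] and the denominator at most [8 * r ^+ 2]. *)
Lemma frac_ge (s t r : R) : 0 < r -> r <= s <= 2 * r -> - (2 * r) <= t <= 2 * r ->
  (8 * r)^-1 <= s / (s ^+ 2 + t ^+ 2).
Proof.
move=> r0 /andP[s1 s2] /andP[t1 t2].
have st : 0 < s ^+ 2 + t ^+ 2 by have := sqr_ge0 t; nra.
rewrite ler_pdivlMr// mulrC ler_pdivrMr; last by lra.
nra.
Qed.

Lemma Re_inv z : Re (z^-1) = Re z / (Re z ^+ 2 + Im z ^+ 2). Proof. by case: z. Qed.
Lemma Im_inv z : Im (z^-1) = - Im z / (Re z ^+ 2 + Im z ^+ 2).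
Proof. by case: z => x y /=; rewrite mulNr. Qed.

(** Each of the four sides adds at least 1/4 to the imaginary part: it has length at least [2 * r],
    and the relevant component of the kernel, taken with the right sign, is at least [(8 * r)^-1] on
    it. *)
Lemma winding_ge1 w a b c d r : 0 < r ->
  r <= Re w - a <= 2 * r -> r <= b - Re w <= 2 * r ->
  r <= Im w - c <= 2 * r -> r <= d - Im w <= 2 * r ->
  1 <= cmod (winding w a b c d).
Proof.
move=> r0 ha hb hc hd.
apply: le_trans (cmod_Im _); apply: le_trans (ler_norm _).
rewrite /winding /rectI ReImE ImM /= mul0r mul1r add0r.
have cg z : rect a b c d z -> z != w -> {for z, continuous (fun z => (z - w)^-1)}.
  by move=> _ /cdiff_inv_sub[l]; exact: cdiff_continuous.
have [] : bdcts (fun z => (z - w)^-1) a b c d by apply: (@bdcts_off _ _ w); [lra..|].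
move=> h1 h2 h3 h4.
have e1 : 1 / 2 <= rint a b (fun x => Im ((toC (x, c) - w)^-1 - (toC (x, d) - w)^-1)).
  apply: le_trans (@rint_inv_ge (fun x => Im ((toC (x, c) - w)^-1))
    (fun x => Im ((toC (x, d) - w)^-1)) a b r r0 _ (cts_Im h1) (cts_Im h2) _) _.
  - lra.
  - move=> x xab; rewrite !Im_inv !ReImE /=; split.
      have := @frac_ge (Im w - c) (Re w - x) r r0 hc.
      have -> : (Im w - c) ^+ 2 + (Re w - x) ^+ 2 = (x - Re w) ^+ 2 + (c - Im w) ^+ 2 by ring.
      by rewrite opprB; apply; lra.
    have := @frac_ge (d - Im w) (Re w - x) r r0 hd.
    have -> : (d - Im w) ^+ 2 + (Re w - x) ^+ 2 = (x - Re w) ^+ 2 + (d - Im w) ^+ 2 by ring.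
    by rewrite mulNr lerN2; apply; lra.
  - by rewrite le_eqVlt; apply/orP; left; apply/eqP; apply: eq_rint => x _; rewrite !ReImE.
have e2 : 1 / 2 <= rint c d (fun x => Re ((toC (b, x) - w)^-1 - (toC (a, x) - w)^-1)).
  apply: le_trans (@rint_inv_ge (fun x => Re ((toC (b, x) - w)^-1))
    (fun x => Re ((toC (a, x) - w)^-1)) c d r r0 _ (cts_Re h4) (cts_Re h3) _) _.
  - lra.
  - move=> x xab; rewrite !Re_inv !ReImE /=; split.
      have := @frac_ge (b - Re w) (Im w - x) r r0 hb.
      have -> : (b - Re w) ^+ 2 + (Im w - x) ^+ 2 = (b - Re w) ^+ 2 + (x - Im w) ^+ 2 by ring.
      by apply; lra.
    have := @frac_ge (Re w - a) (Im w - x) r r0 ha.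
    have -> : (Re w - a) ^+ 2 + (Im w - x) ^+ 2 = (a - Re w) ^+ 2 + (x - Im w) ^+ 2 by ring.
    by move=> H; rewrite -lerN2 opprK -mulNr opprB; apply: H; lra.
  - by rewrite le_eqVlt; apply/orP; left; apply/eqP; apply: eq_rint => x _; rewrite !ReImE.
lra.
Qed.

Lemma bd_far w x y r : (r <= `|x - Re w|) || (r <= `|y - Im w|) ->
  r <= cmod (toC (x, y) - w).
Proof.
case/orP => H; apply: le_trans H _.
  by apply: le_trans (cmod_Re _); rewrite !ReImE.
by apply: le_trans (cmod_Im _); rewrite !ReImE.
Qed.

(** The margins range over [[r, 2 * r]] instead of being fixed, so that [mean_value_bound] can pick
    four favourable sides. The constant is the 2 of [rectI_norm] times the bound [r^-1] on the
    kernel. *)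
Lemma cauchy_rint_bound f w a b c d r : 0 < r ->
  r <= Re w - a <= 2 * r -> r <= b - Re w <= 2 * r ->
  r <= Im w - c <= 2 * r -> r <= d - Im w <= 2 * r ->
  (forall z, rect a b c d z -> exists l, cdiff f z l) ->
  cmod (f w) <= 2 / r *
  (rint a b (fun x => cmod (f (toC (x, c)))) + rint a b (fun x => cmod (f (toC (x, d)))) +
       rint c d (fun y => cmod (f (toC (a, y)))) + rint c d (fun y => cmod (f (toC (b, y))))).
Proof.
move=> r0 ha hb hc hd df.
have iw : inrect w a b c d by split; lra.
have W := winding_ge1 r0 ha hb hc hd.
have bd : bdcts (fun z => f z * (z - w)^-1) a b c d.
  apply: (@bdcts_off _ _ w); [lra..|].
  by move=> z rz zw; have [l] := cdiff_div_sub zw (df z rz); exact: cdiff_continuous.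
have [c1 c2 c3 c4] : bdcts f a b c d.
  apply: bdcts_rect; [lra..|].
  by move=> z rz; have [l] := df z rz; exact: cdiff_continuous.
have E := cauchy iw df.
apply: (@le_trans _ _ (cmod (f w * winding w a b c d))).
  by rewrite cmodM ler_peMr ?cmod_ge0.
rewrite E; apply: le_trans (rectI_norm bd) _.
have [b1 b2 b3 b4] := bd.
rewrite -mulrA ler_pM2l// !mulrDr.
have K x y : (r <= `|x - Re w|) || (r <= `|y - Im w|) ->
    cmod (f (toC (x, y)) / (toC (x, y) - w)) <= r^-1 * cmod (f (toC (x, y))).
  move=> /bd_far H; rewrite cmodM cmodV mulrC ler_wpM2r ?cmod_ge0//.
  by rewrite lef_pV2// posrE; lra.
rewrite -(rintZ _ (cts_cmod c1)) -(rintZ _ (cts_cmod c2)) -(rintZ _ (cts_cmod c3)) -(rintZ _ (cts_cmod c4)).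
have cZ u a' b' : @cts_seg R (CC R) a' b' u -> @cts_seg R R a' b' (fun x : R => r^-1 * cmod (u x : CC R)).
  by move=> cu x xab; apply: continuousM; [exact: cst_continuous|exact: (cts_cmod cu)].
have hb' : r <= `|b - Re w| by apply: le_trans (ler_norm _); lra.
have hd' : r <= `|d - Im w| by apply: le_trans (ler_norm _); lra.
have ha' : r <= `|a - Re w| by rewrite distrC; apply: le_trans (ler_norm _); lra.
have hc' : r <= `|c - Im w| by rewrite distrC; apply: le_trans (ler_norm _); lra.
have F1 : rint a b (fun x => cmod (f (toC (x, c)) / (toC (x, c) - w))) <=
    rint a b (fun x => r^-1 * cmod (f (toC (x, c)))).
  apply: (le_rint (cts_cmod b1) (cZ _ _ _ c1)).
  by move=> x _; apply: K; rewrite hc' orbT.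
have F2 : rint a b (fun x => cmod (f (toC (x, d)) / (toC (x, d) - w))) <=
    rint a b (fun x => r^-1 * cmod (f (toC (x, d)))).
  apply: (le_rint (cts_cmod b2) (cZ _ _ _ c2)).
  by move=> x _; apply: K; rewrite hd' orbT.
have F3 : rint c d (fun x => cmod (f (toC (a, x)) / (toC (a, x) - w))) <=
    rint c d (fun x => r^-1 * cmod (f (toC (a, x)))).
  apply: (le_rint (cts_cmod b3) (cZ _ _ _ c3)).
  by move=> x _; apply: K; rewrite ha'.
have F4 : rint c d (fun x => cmod (f (toC (b, x)) / (toC (b, x) - w))) <=
    rint c d (fun x => r^-1 * cmod (f (toC (b, x)))).
  apply: (le_rint (cts_cmod b4) (cZ _ _ _ c4)).
  by move=> x _; apply: K; rewrite hb'.
lra.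
Qed.

Definition square z r := rect (Re z - r) (Re z + r) (Im z - r) (Im z + r).

Lemma squareP z r w : square z r w <-> `|Re w - Re z| <= r /\ `|Im w - Im z| <= r.
Proof.
rewrite /square /rect /= !ler_norml; split=> -[h1 h2]; split; lra.
Qed.

(** The kernels differ by [(w - z) / ((v - w) * (v - z))], and a boundary point [v] is at distance
    at least [2 * r] from [z] and [r] from [w]. *)
Lemma rectI_kernel_diff f z w r M : 0 < r -> cmod (w - z) < r ->
  (forall v, square z (2 * r) v -> exists l, cdiff f v l) ->
  (forall v, square z (2 * r) v -> cmod (f v) <= M) ->
  cmod (rectI (fun v => f v * (v - w)^-1) (Re z - 2 * r) (Re z + 2 * r) (Im z - 2 * r) (Im z + 2 * r) -
        rectI (fun v => f v * (v - z)^-1) (Re z - 2 * r) (Re z + 2 * r) (Im z - 2 * r) (Im z + 2 * r))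
  <= 16 * M / r * cmod (w - z).
Proof.
move=> r0 wz df fM.
have M0 : 0 <= M.
  by apply: le_trans (cmod_ge0 _) (fM z _); apply/squareP; rewrite !subrr normr0; lra.
have : `|Re (w - z)| < r by apply: le_lt_trans wz; exact: cmod_Re.
have : `|Im (w - z)| < r by apply: le_lt_trans wz; exact: cmod_Im.
rewrite !ReImE !ltr_norml => hw1 hw2.
have bdw : bdcts (fun v => f v * (v - w)^-1) (Re z - 2 * r) (Re z + 2 * r) (Im z - 2 * r) (Im z + 2 * r).
  apply: (@bdcts_off _ _ w); [lra..|].
  by move=> v rv vw; have [l] := cdiff_div_sub vw (df v rv); exact: cdiff_continuous.
have bdz : bdcts (fun v => f v * (v - z)^-1) (Re z - 2 * r) (Re z + 2 * r) (Im z - 2 * r) (Im z + 2 * r).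
  apply: (@bdcts_off _ _ z); [lra..|].
  by move=> v rv vw; have [l] := cdiff_div_sub vw (df v rv); exact: cdiff_continuous.
rewrite -[X in _ - X]mul1r -rectI_lin//.
have bdd : bdcts (fun v => f v / (v - w) - 1 * (f v / (v - z)))
    (Re z - 2 * r) (Re z + 2 * r) (Im z - 2 * r) (Im z + 2 * r).
  exact: bdcts_lin bdw bdz.
apply: (@le_trans _ _ (4 * (M * (cmod (w - z) / (2 * r ^+ 2))) *
  ((Re z + 2 * r - (Re z - 2 * r)) + (Im z + 2 * r - (Im z - 2 * r))))); last first.
  rewrite le_eqVlt; apply/orP; left; apply/eqP; field; lra.
have K x y : square z (2 * r) (toC (x, y)) ->
    (2 * r <= `|x - Re z|) || (2 * r <= `|y - Im z|) ->
    cmod (f (toC (x, y)) / (toC (x, y) - w) - 1 * (f (toC (x, y)) / (toC (x, y) - z))) <=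
    M * (cmod (w - z) / (2 * r ^+ 2)).
  move=> sxy /bd_far Hz.
  have Hw : r <= cmod (toC (x, y) - w).
    by have := cmod_tri (toC (x, y)) z w; lra.
  set v := toC (x, y) in sxy Hz Hw *.
  have vz : v - z != 0 by rewrite -cmod_gt0; lra.
  have vw : v - w != 0 by rewrite -cmod_gt0; lra.
  have -> : f v / (v - w) - 1 * (f v / (v - z)) = f v * ((w - z) * ((v - w) * (v - z))^-1).
    by field; rewrite vz vw.
  rewrite !cmodM cmodV cmodM; apply: ler_pM; rewrite ?cmod_ge0 ?fM//.
    by rewrite mulr_ge0 ?cmod_ge0// invr_ge0 mulr_ge0 ?cmod_ge0.
  rewrite ler_wpM2l ?cmod_ge0// lef_pV2 ?posrE; [|nra|nra].
  have -> : 2 * r ^+ 2 = r * (2 * r) by ring.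
  by apply: ler_pM => //; lra.
have n1 : `|Re z - 2 * r - Re z| = 2 * r by rewrite addrAC subrr sub0r normrN ger0_norm//; lra.
have n2 : `|Re z + 2 * r - Re z| = 2 * r by rewrite addrAC subrr add0r ger0_norm//; lra.
have n3 : `|Im z - 2 * r - Im z| = 2 * r by rewrite addrAC subrr sub0r normrN ger0_norm//; lra.
have n4 : `|Im z + 2 * r - Im z| = 2 * r by rewrite addrAC subrr add0r ger0_norm//; lra.
apply: (rectI_bound _ _ bdd); [lra|lra| |] => t ht; split; apply: K;
  rewrite ?n1 ?n2 ?n3 ?n4 ?lexx ?orbT//; split => /=; lra.
Qed.

(** The windings about [w] and [z] are not known to be equal. Their difference is bounded by the
    case [f = 1] of [rectI_kernel_diff], and this correction doubles the constant 16. *)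
Lemma cauchy_lipschitz f z w r M : 0 < r -> cmod (w - z) < r ->
  (forall v, square z (2 * r) v -> exists l, cdiff f v l) ->
  (forall v, square z (2 * r) v -> cmod (f v) <= M) ->
  cmod (f w - f z) <= 32 * M / r * cmod (w - z).
Proof.
move=> r0 wz df fM.
have : `|Re (w - z)| < r by apply: le_lt_trans wz; exact: cmod_Re.
have : `|Im (w - z)| < r by apply: le_lt_trans wz; exact: cmod_Im.
rewrite !ReImE !ltr_norml => hw1 hw2.
pose a := Re z - 2 * r; pose b := Re z + 2 * r; pose c := Im z - 2 * r; pose d := Im z + 2 * r.
have iz : inrect z a b c d by rewrite /a /b /c /d; split; lra.
have iw : inrect w a b c d by rewrite /a /b /c /d; split; lra.
have Ez := cauchy iz df; have Ew := cauchy iw df.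
have W : 1 <= cmod (winding z a b c d).
  by apply: (@winding_ge1 z a b c d r) => //; rewrite /a /b /c /d; lra.
have H1 := rectI_kernel_diff r0 wz df fM.
have H2 : cmod (winding w a b c d - winding z a b c d) <= 16 / r * cmod (w - z).
  have E u : (fun v : CC R => 1 * (v - u)^-1) = (fun v => (v - u)^-1).
    by apply/funext => v; rewrite mul1r.
  have := @rectI_kernel_diff (fun=> 1) z w r 1 r0 wz.
  rewrite mulr1 -/a -/b -/c -/d !E; apply.
    by move=> v _; exists 0; exact: cdiff_cst.
  by move=> v _; rewrite cmod1.
rewrite -/a -/b -/c -/d -Ew -Ez in H1.
apply: (@le_trans _ _ (cmod ((f w - f z) * winding z a b c d))).
  by rewrite cmodM ler_peMr ?cmod_ge0.
have -> : (f w - f z) * winding z a b c d =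
  (f w * winding w a b c d - f z * winding z a b c d) - f w * (winding w a b c d - winding z a b c d).
  by ring.
apply: le_trans (cmodD _ _) _; rewrite cmodN cmodM.
have fw : cmod (f w) <= M by apply: fM; apply/squareP; rewrite !ler_norml; lra.
have H3 : cmod (f w) * cmod (winding w a b c d - winding z a b c d) <= M * (16 / r * cmod (w - z)).
  by apply: ler_pM; rewrite ?cmod_ge0.
lra.
Qed.

End cauchy_estimates.

(** * Area integrals and limits of holomorphic functions *)

Section plane_measure.
Variable R : realType.
Implicit Types (z w : CC R) (r : R).
Local Notation mu := (@lebesgue_measure R).

Lemma ball_rat (x e : R) : 0 < e -> exists q : rat, `|ratr q - x| < e.
Proof.
move=> e0; have /rat_in_itvoo[q] : x - e < x + e by lra.
rewrite in_itv/= => hq; exists q; rewrite ltr_norml; lra.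
Qed.

Definition obox (p q : rat) (n : nat) : set (R * R) :=
  `](ratr p - n.+1%:R^-1), (ratr p + n.+1%:R^-1)[ `*` `](ratr q - n.+1%:R^-1), (ratr q + n.+1%:R^-1)[.

(** Measurability refers to the product sigma-algebra of [R * R], openness to the norm of [CC R].
    They meet in a countable union of open boxes with rational centres and half-sides [1 / (n + 1)];
    boxes not contained in [G] are replaced by the empty set. *)
Lemma plane_open_measurable (G : set (CC R)) : open G -> measurable (toC @^-1` G).
Proof.
move=> /open_cmodP oG.
have -> : toC @^-1` G =
    \bigcup_(i : (rat * rat * nat)%type)
      (if pselect (obox i.1.1 i.1.2 i.2 `<=` toC @^-1` G) then obox i.1.1 i.1.2 i.2 else set0).
  apply/seteqP; split => [[x y] /= Gxy|[x y] [[[p q] n] _ /=]]; last first.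
    by case: pselect => //= h /h.
  have [e e0 eG] := oG _ Gxy.
  have [n ne] : exists n : nat, n.+1%:R^-1 < e / 4.
    exists (Num.bound ((e / 4)^-1)).
    have h : (e / 4)^-1 < (Num.bound (e / 4)^-1).+1%:R.
      by apply: (lt_trans (archi_boundP _)); rewrite ?ltr_nat// invr_ge0; lra.
    by rewrite -[ltRHS]invrK ltf_pV2// posrE ?invr_gt0//; lra.
  have n0 : 0 < n.+1%:R^-1 :> R by rewrite invr_gt0.
  have [p hp] := ball_rat x n0; have [q hq] := ball_rat y n0.
  exists ((p, q), n) => //=; case: pselect => /= [_|[]].
    move: hp hq; rewrite !ltr_norml /obox/= !in_itv/=.
    by move: (n.+1%:R^-1) (ratr p) (ratr q) => s P Q ? ?; split; lra.
  move=> [u v] [/=]; rewrite !in_itv/= => hu hv; apply: eG.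
  apply: le_lt_trans (cmod_ReIm _) _; rewrite !ReImE /=.
  move: hp hq ne hu hv; rewrite !ltr_norml.
  move: (n.+1%:R^-1) (ratr p) (ratr q) => s P Q ? ? ? ? ?.
  have : `|u - x| <= 2 * s by rewrite ler_norml; lra.
  have : `|v - y| <= 2 * s by rewrite ler_norml; lra.
  lra.
apply: countable_bigcupT_measurable; first exact: countableP.
move=> -[[p q] n] /=.
by case: pselect => //= _; apply: measurableX.
Qed.

Lemma plane_cont_measurable (G : set (CC R)) (f : CC R -> R) : open G ->
  (forall z, G z -> {for z, continuous f}) -> measurable_fun (toC @^-1` G) (f \o toC).
Proof.
move=> oG cf; apply: (measurability _ (measurable_realfun.RGenOInfty.measurableE R)).
move=> /= _ [_ [a ->]] <-.
have -> : toC @^-1` G `&` (f \o toC) @^-1` `]a, +oo[ = toC @^-1` (G `&` [set z | a < f z]).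
  by apply/seteqP; split => -[x y] [/= h1 h2]; split => //=; move: h2; rewrite in_itv/= andbT.
apply: plane_open_measurable; apply/open_cmodP => z [Gz /= az].
have [e e0 eG] := (open_cmodP G).1 oG z Gz.
have e' : 0 < f z - a by rewrite subr_gt0.
have [d d0 dH] := (rcont_cmodP f z).1 (cf z Gz) _ e'.
exists (Num.min e d); first by rewrite lt_min e0.
move=> w; rewrite /disk/= lt_min => /andP[we wd]; split; first exact: eG.
by move: (dH w wd); rewrite ltr_norml /=; lra.
Qed.

Lemma lebesgue_segment (a b : R) : a <= b -> mu `[a, b] = (b - a)%:E.
Proof.
rewrite le_eqVlt lebesgue_measure_itv/= lte_fin => /predU1P[->|ab].
  by rewrite ltxx subrr.
by rewrite ab EFinB.
Qed.

Lemma leb2_box (a b c d : R) : a <= b -> c <= d ->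
  leb2 (`[a, b] `*` `[c, d]) = ((b - a) * (d - c))%:E.
Proof.
move=> ab cd; rewrite /leb2 product_measure1E//=.
by rewrite [X in (X * _)%E]lebesgue_segment// [X in (_ * X)%E]lebesgue_segment// EFinM.
Qed.

Lemma square_boxE z r : toC @^-1` square z r =
  `[Re z - r, Re z + r] `*` `[Im z - r, Im z + r].
Proof.
by apply/seteqP; split => -[x y] [/= h1 h2]; move: h1 h2; rewrite ?in_itv/= => ? ?; split;
  rewrite /= ?in_itv.
Qed.

Lemma leb2_square z r : 0 <= r -> leb2 (toC @^-1` square z r) = (4 * r ^+ 2)%:E.
Proof. by move=> r0; rewrite square_boxE leb2_box; [congr EFin; ring|lra|lra]. Qed.

Lemma measurable_square z r : measurable (toC @^-1` square z r).
Proof. by rewrite square_boxE; apply: measurableX. Qed.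

(** If [G] exceeded [B / r] on the whole segment of length [r], its integral there would already
    reach [B]. *)
Lemma low_point (G : R -> \bar R) (s r B : R) : 0 < r ->
  measurable_fun [set: measurableTypeR R] G -> (forall x, (0 <= G x)%E) ->
  (\int[mu]_x G x < B%:E)%E -> exists2 c, s <= c <= s + r & (G c <= ((B / r)%R)%:E)%E.
Proof.
move=> r0 mG G0 GB; apply: contrapT => H.
have H' c : s <= c <= s + r -> ((B / r)%:E <= G c)%E.
  by move=> sc; rewrite leNgt; apply/negP => /ltW h; apply: H; exists c.
move: GB; rewrite ltNge => /negP; apply.
have [B0|B0] := leP B 0.
  by apply: (@le_trans _ _ 0%E); [rewrite lee_fin|exact: integral_ge0].
have H1 : (\int[mu]_(x in `[s, (s + r)%R]) G x <= \int[mu]_x G x)%E.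
  by apply: ge0_subset_integral.
apply: le_trans H1.
have -> : B%:E = (\int[mu]_(x in `[s, (s + r)%R]) ((B / r)%R)%:E)%E.
  rewrite integral_cst//= lebesgue_segment; last by rewrite lerDl ltW.
  by rewrite addrAC subrr add0r -EFinM divfK ?gt_eqF.
apply: ge0_le_integral => //=.
- by move=> x _; rewrite lee_fin divr_ge0// ltW.
- exact: measurable_funTS.
Qed.

End plane_measure.

(** * Bounding a value by an area integral *)

Section mean_value.
Variable R : realType.
Implicit Types (z w : CC R) (r : R).
Local Notation mu := (@lebesgue_measure R).

Lemma cont_cmod (f : CC R -> CC R) z : {for z, continuous f} -> {for z, continuous (fun z => cmod (f z))}.
Proof.
move=> /ccont_cmodP H; apply/rcont_cmodP => e /H[d d0 dH]; exists d => // w /dH.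
apply: le_lt_trans; rewrite ler_norml; apply/andP; split; last exact: cmodBl.
by rewrite lerNl opprB cmodBC cmodBl.
Qed.

Lemma measurable_cmod (G : set (CC R)) (f : CC R -> CC R) : open G -> holomorphic_on G f ->
  measurable_fun (toC @^-1` G) (fun xy => cmod (f (toC xy))).
Proof.
move=> oG hf; apply: (@plane_cont_measurable _ G (fun z => cmod (f z))) => // z /hf.
by move=> /derivable_cdiffP[l /cdiff_continuous]; exact: cont_cmod.
Qed.

Lemma rint_fin a b (u : R -> R) : @cts_seg R R a b u ->
  (\int[mu]_(x in `[a, b]) (u x)%:E)%E = (rint a b u)%:E.
Proof.
move=> cu; rewrite /rint /Rintegral fineK//.
by apply: integrable_fin_num => //; exact: cts_seg_integrable cu.
Qed.

(** By Tonelli, [low_point] finds in each of the four bands at distance between [r] and [2 * r] from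
    [z] a line on which the integral of [|f|] is at most [B / r]. The rectangle cut out by these
    lines gives [2 / r] times four such bounds. *)
Lemma mean_value_bound (G : set (CC R)) (f : CC R -> CC R) z r (B : R) :
  open G -> holomorphic_on G f -> 0 < r -> square z (2 * r) `<=` G ->
  (\int[@leb2 R]_(xy in toC @^-1` square z (2 * r)) (cmod (f (toC xy)))%:E < B%:E)%E ->
  cmod (f z) <= 8 * B / r ^+ 2.
Proof.
move=> oG hf r0 sG HB.
have df v : square z (2 * r) v -> exists l, cdiff f v l.
  by move=> /sG /hf /derivable_cdiffP.
set S := toC @^-1` square z (2 * r) in HB *.
have mS : measurable S by exact: measurable_square.
pose F := ((fun xy : R * R => (cmod (f (toC xy)))%:E) \_ S : R * R -> \bar R).
have mF : measurable_fun setT F.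
  apply/(measurable_restrictT _ mS)/measurable_EFinP.
  apply: measurable_funS (measurable_cmod oG hf); first exact: plane_open_measurable.
  by move=> xy; exact: sG.
have F0 xy : (0 <= F xy)%E.
  by rewrite /F /patch; case: ifP => // _; rewrite lee_fin cmod_ge0.
have cf v : square z (2 * r) v -> {for v, continuous f}.
  by move=> /df[l]; exact: cdiff_continuous.
have chor c : Im z - 2 * r <= c <= Im z + 2 * r ->
    @cts_seg R (CC R) (Re z - 2 * r) (Re z + 2 * r) (fun x => f (toC (x, c))).
  by move=> hc; apply: cts_hor => x hx; apply: cf; split.
have cver c : Re z - 2 * r <= c <= Re z + 2 * r ->
    @cts_seg R (CC R) (Im z - 2 * r) (Im z + 2 * r) (fun y => f (toC (c, y))).
  by move=> hc; apply: cts_ver => x hx; apply: cf; split.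
have SE x y : (x, y) \in S = (Re z - 2 * r <= x <= Re z + 2 * r) && (Im z - 2 * r <= y <= Im z + 2 * r).
  by apply/idP/andP; rewrite inE // => -[? ?]; split.
have Ehor c : Im z - 2 * r <= c <= Im z + 2 * r ->
    (\int[mu]_x F (x, c) = (rint (Re z - 2 * r) (Re z + 2 * r) (fun x => cmod (f (toC (x, c)))))%:E)%E.
  move=> hc; rewrite -(rint_fin (cts_cmod (chor c hc))) [RHS]integral_mkcond.
  apply: eq_integral => x _; rewrite /F /patch SE hc andbT.
  by congr (if _ then _ else _); apply/idP/idP; rewrite inE/= in_itv/=.
have Ever c : Re z - 2 * r <= c <= Re z + 2 * r ->
    (\int[mu]_y F (c, y) = (rint (Im z - 2 * r) (Im z + 2 * r) (fun y => cmod (f (toC (c, y)))))%:E)%E.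
  move=> hc; rewrite -(rint_fin (cts_cmod (cver c hc))) [RHS]integral_mkcond.
  apply: eq_integral => x _; rewrite /F /patch SE hc /=.
  by congr (if _ then _ else _); apply/idP/idP; rewrite inE/= in_itv/=.
rewrite integral_mkcond -/F in HB.
have HB1 := HB; rewrite /leb2 fubini_tonelli1// in HB1.
have HB2 := HB; rewrite /leb2 fubini_tonelli2// in HB2.
have mF1 : measurable_fun setT (fubini_F mu F) by exact: measurable_fun_fubini_tonelli_F.
have mF2 : measurable_fun setT (fubini_G mu F) by exact: measurable_fun_fubini_tonelli_G.
have F10 x : (0 <= fubini_F mu F x)%E by apply: integral_ge0.
have F20 x : (0 <= fubini_G mu F x)%E by apply: integral_ge0.
have [a ha Ha] := @low_point R _ (Re z - 2 * r) r B r0 mF1 F10 HB1.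
have [b hb Hb] := @low_point R _ (Re z + r) r B r0 mF1 F10 HB1.
have [c hc Hc] := @low_point R _ (Im z - 2 * r) r B r0 mF2 F20 HB2.
have [d hd Hd] := @low_point R _ (Im z + r) r B r0 mF2 F20 HB2.
have ca : Re z - 2 * r <= a <= Re z + 2 * r by lra.
have cb : Re z - 2 * r <= b <= Re z + 2 * r by lra.
have cc : Im z - 2 * r <= c <= Im z + 2 * r by lra.
have cd : Im z - 2 * r <= d <= Im z + 2 * r by lra.
rewrite /fubini_F Ever// lee_fin in Ha; rewrite /fubini_F Ever// lee_fin in Hb.
rewrite /fubini_G Ehor// lee_fin in Hc; rewrite /fubini_G Ehor// lee_fin in Hd.
have sub (u : R -> R) a0 b0 a1 b1 : a0 <= a1 <= b1 -> b1 <= b0 -> @cts_seg R R a0 b0 u ->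
    (forall x, 0 <= u x) -> rint a1 b1 u <= rint a0 b0 u.
  move=> /andP[h1 h2] h3 cu u0.
  have h4 : a0 <= a1 <= b0 by rewrite h1 (le_trans h2).
  have cu1 : @cts_seg R R a1 b0 u by exact: cts_seg_sub h1 (lexx _) cu.
  rewrite (rint_cat h4 cu) (@rint_cat _ a1 b1 b0) ?h2 ?h3//.
  have g0 p q : 0 <= rint p q u by apply: Rintegral_ge0 => x _; exact: u0.
  by rewrite addrA; have := g0 a0 a1; have := g0 b1 b0; lra.
have cg (u : R -> CC R) x : 0 <= cmod (u x) by exact: cmod_ge0.
have Ia := sub _ _ _ c d _ _ (cts_cmod (cver a ca)) (cg _).
have Ib := sub _ _ _ c d _ _ (cts_cmod (cver b cb)) (cg _).
have Ic := sub _ _ _ a b _ _ (cts_cmod (chor c cc)) (cg _).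
have Id := sub _ _ _ a b _ _ (cts_cmod (chor d cd)) (cg _).
have hcd : Im z - 2 * r <= c <= d by clear -r0 ha hb hc hd; lra.
have hab : Re z - 2 * r <= a <= b by clear -r0 ha hb hc hd; lra.
have d2 : d <= Im z + 2 * r by clear -r0 ha hb hc hd; lra.
have b2 : b <= Re z + 2 * r by clear -r0 ha hb hc hd; lra.
have {}Ia := le_trans (Ia hcd d2) Ha; have {}Ib := le_trans (Ib hcd d2) Hb.
have {}Ic := le_trans (Ic hab b2) Hc; have {}Id := le_trans (Id hab b2) Hd.
have ra : r <= Re z - a <= 2 * r by clear -r0 ha hb hc hd; lra.
have rb : r <= b - Re z <= 2 * r by clear -r0 ha hb hc hd; lra.
have rc : r <= Im z - c <= 2 * r by clear -r0 ha hb hc hd; lra.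
have rd : r <= d - Im z <= 2 * r by clear -r0 ha hb hc hd; lra.
apply: le_trans (cauchy_rint_bound r0 ra rb rc rd _) _.
  move=> v [/andP[v1 v2] /andP[v3 v4]]; apply: df; split; apply/andP; split;
    by clear -v1 v2 v3 v4 hcd hab d2 b2; lra.
have -> : 8 * B / r ^+ 2 = 2 / r * (B / r + B / r + B / r + B / r) by field; clear -r0; lra.
rewrite ler_pM2l ?divr_gt0//; clear -r0 Ia Ib Ic Id; lra.
Qed.

End mean_value.

(** * Geometrically convergent sequences of holomorphic functions *)

Section weierstrass.
Variable R : realType.
Implicit Types (f g : CC R -> CC R) (z w l : CC R) (C r : R).

Lemma exp4_small (C e : R) : 0 <= C -> 0 < e -> exists n : nat, C / 4 ^+ n < e.
Proof.
move=> C0 e0; exists (Num.bound (C / e)).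
rewrite ltr_pdivrMr ?exprn_gt0// mulrC -ltr_pdivrMr//.
apply: lt_trans (archi_boundP _) _; first by rewrite divr_ge0// ltW.
by rewrite -natrX ltr_nat; apply: ltn_expl.
Qed.

Lemma exp4_half (C : R) n : C / 4 ^+ n.+1 = C / 4 ^+ n / 4.
Proof. by rewrite exprS; field; rewrite expf_neq0. Qed.

(** Real and imaginary parts are each trapped in nested intervals of half-length [2 * C / 4 ^+ n],
    and the two bounds add up to the factor 4. *)
Lemma geometric_limit (u : nat -> CC R) C :
  (forall n, cmod (u n.+1 - u n) <= C / 4 ^+ n) ->
  exists l, forall n, cmod (l - u n) <= 4 * C / 4 ^+ n.
Proof.
move=> H.
have real (v : nat -> R) : (forall n, `|v n.+1 - v n| <= C / 4 ^+ n) ->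
    exists x, forall n, `|x - v n| <= 2 * C / 4 ^+ n.
  move=> Hv.
  have [x Hx] : exists x, forall n, v n - 2 * (C / 4 ^+ n) <= x <= v n + 2 * (C / 4 ^+ n).
    apply: nested_intervals => n; have := Hv n; rewrite ?exp4_half ler_norml; move: (C / 4 ^+ n) => t; lra.
  exists x => n; have := Hx n; rewrite -mulrA ler_norml; move: (C / 4 ^+ n) => t; lra.
have [x Hx] : exists x, forall n, `|x - Re (u n)| <= 2 * C / 4 ^+ n.
  by apply: real => n; apply: le_trans (H n); rewrite -ReN -ReD cmod_Re.
have [y Hy] : exists x, forall n, `|x - Im (u n)| <= 2 * C / 4 ^+ n.
  by apply: real => n; apply: le_trans (H n); rewrite -ImN -ImD cmod_Im.
exists (toC (x, y)) => n; apply: le_trans (cmod_ReIm _) _; rewrite !ReImE /=.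
have -> : 4 * C / 4 ^+ n = 2 * C / 4 ^+ n + 2 * C / 4 ^+ n by ring.
exact: lerD.
Qed.

Lemma geometric_unique (u : nat -> CC R) (C D : R) l k : 0 <= C -> 0 <= D ->
  (forall n, cmod (l - u n) <= C / 4 ^+ n) -> (forall n, cmod (k - u n) <= D / 4 ^+ n) -> l = k.
Proof.
move=> C0 D0 Hl Hk; apply/eqP; rewrite -subr_eq0 -cmod_eq0 eq_le cmod_ge0 andbT.
apply/ler_addgt0Pr => e e0; rewrite add0r.
have [n Hn] := exp4_small (addr_ge0 C0 D0) e0.
apply: le_trans (cmod_tri _ _ (u n)) _; rewrite (cmodBC (u n)).
by apply: le_trans (lerD (Hl n) (Hk n)) _; rewrite -mulrDl ltW.
Qed.

Lemma cdiff_bound f z l (L d : R) : 0 < d -> cdiff f z l ->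
  (forall w, cmod (w - z) < d -> cmod (f w - f z) <= L * cmod (w - z)) -> cmod l <= L.
Proof.
move=> d0 fl H; apply/ler_addgt0Pr => e e0.
have [d' d'0 Hd] := fl e e0.
pose t := Num.min d d' / 2.
have m0 : 0 < Num.min d d' by rewrite lt_min d0.
have t0 : 0 < t by rewrite divr_gt0.
have td : t < Num.min d d' by rewrite /t; lra.
pose w := z + (t%:C)%C.
have wz : cmod (w - z) = t by rewrite /w addrC addKr cmod_real gtr0_norm.
move: td; rewrite lt_min -wz => /andP[/H h1 /Hd h2].
have : cmod (l * (w - z)) <= (L + e) * cmod (w - z).
  have -> : l * (w - z) = (f w - f z) - (f w - f z - l * (w - z)) by rewrite subKr.
  by apply: le_trans (cmodD _ _) _; rewrite cmodN mulrDl lerD.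
by rewrite cmodM ler_pM2r// wz.
Qed.

(** By [cauchy_lipschitz] the increments [f n.+1 - f n] are Lipschitz at [z] with geometrically
    decreasing constants. Hence the derivatives at [z] converge, and the differentiability estimate
    passes from [f n] to [g]. *)
Lemma weierstrass (f : nat -> CC R -> CC R) g z r C : 0 < r -> 0 <= C ->
  (forall n v, square z (2 * r) v -> exists l, cdiff (f n) v l) ->
  (forall n v, square z (2 * r) v -> cmod (f n.+1 v - f n v) <= C / 4 ^+ n) ->
  (forall n v, square z (2 * r) v -> cmod (g v - f n v) <= 4 * C / 4 ^+ n) ->
  exists l, cdiff g z l.
Proof.
move=> r0 C0 df fC gC.
have sz v : cmod (v - z) < r -> square z (2 * r) v.
  move=> vz; apply/squareP; rewrite -!ReN -!ImN -ReD -ImD.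
  by split; [apply: le_trans (cmod_Re _) _|apply: le_trans (cmod_Im _) _]; lra.
have szz : square z (2 * r) z by apply: sz; rewrite subrr cmod0.
have lip n w : cmod (w - z) < r ->
    cmod ((f n.+1 w - f n w) - (f n.+1 z - f n z)) <= (32 * C / r) / 4 ^+ n * cmod (w - z).
  move=> wz.
  have := @cauchy_lipschitz R (fun v => f n.+1 v - f n v) z w r (C / 4 ^+ n) r0 wz _ (fC n).
  have -> : 32 * (C / 4 ^+ n) / r = 32 * C / r / 4 ^+ n by ring.
  apply.
  move=> v vz; have [l1 h1] := df n.+1 v vz; have [l2 h2] := df n v vz.
  exists (l1 + (0 * f n v + (-1) * l2)).
  have := cdiffD h1 (cdiffM (@cdiff_cst _ (-1) v) h2).
  have -> // : (fun w0 => f n.+1 w0 + -1 * f n w0) = (fun v0 => f n.+1 v0 - f n v0).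
  by apply/funext => x; rewrite mulN1r.
set L := 32 * C / r in lip.
have L0 : 0 <= L by rewrite /L divr_ge0 ?mulr_ge0// ltW.
have /choice[k Hk] n : exists l, cdiff (f n) z l by exact: df.
have kL n : cmod (k n.+1 - k n) <= L / 4 ^+ n.
  apply: (@cdiff_bound (fun v => f n.+1 v - f n v) z _ _ r r0) => [|w wz]; last exact: lip.
  have := cdiffD (Hk n.+1) (cdiffM (@cdiff_cst _ (-1) z) (Hk n)).
  rewrite mul0r add0r mulN1r.
  have -> // : (fun w0 => f n.+1 w0 + -1 * f n w0) = (fun v0 => f n.+1 v0 - f n v0).
  by apply/funext => x; rewrite mulN1r.
have [l Hl] := geometric_limit kL.
exists l => e e0.
have e30 : 0 < e / 3 by lra.
have [n Hn] := exp4_small (mulr_ge0 (ler0n R 4) L0) e30.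
have [d d0 Hd] := Hk n _ e30.
exists (Num.min d r); first by rewrite lt_min d0.
move=> w; rewrite lt_min => /andP[/Hd h1 wr].
have h2 : cmod ((g w - g z) - (f n w - f n z)) <= 4 * L / 4 ^+ n * cmod (w - z).
  (* The hypothesis on [g] carries no factor [cmod (w - z)]. The factor is recovered by identifying
     [g w - g z] with the limit of [u], whose increments do carry it. *)
  pose u m := f m w - f m z.
  have Hu m : cmod (u m.+1 - u m) <= (L * cmod (w - z)) / 4 ^+ m.
    have -> : u m.+1 - u m = (f m.+1 w - f m w) - (f m.+1 z - f m z) by rewrite /u; ring.
    by apply: le_trans (lip m w wr) _; rewrite mulrAC.
  have [x Hx] := geometric_limit Hu.
  suff E : g w - g z = x.
    by rewrite E; apply: le_trans (Hx n) _; rewrite mulrA (mulrAC (4 * L)).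
  have H0 := mulr_ge0 L0 (cmod_ge0 (w - z)).
  apply: (@geometric_unique u (8 * C) (4 * (L * cmod (w - z)))) => //; [lra|lra|].
  move=> m; have -> : g w - g z - u m = (g w - f m w) - (g z - f m z) by rewrite /u; ring.
  apply: le_trans (cmodD _ _) _; rewrite cmodN.
  apply: le_trans (lerD (gC m w (sz w wr)) (gC m z szz)) _.
  by rewrite -mulrDl ler_wpM2r ?invr_ge0 ?exprn_ge0//; lra.
have -> : g w - g z - l * (w - z) = ((g w - g z) - (f n w - f n z)) +
   ((f n w - f n z - k n * (w - z)) - (l - k n) * (w - z)) by ring.
apply: le_trans (cmodD _ _) _; apply: le_trans (lerD h2 (cmodD _ _)) _.
rewrite cmodN cmodM.
have h3 : cmod (l - k n) * cmod (w - z) <= e / 3 * cmod (w - z).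
  by rewrite ler_wpM2r ?cmod_ge0//; apply: le_trans (Hl n) _; rewrite ltW.
have h4 : 4 * L / 4 ^+ n * cmod (w - z) <= e / 3 * cmod (w - z).
  by rewrite ler_wpM2r ?cmod_ge0// ltW.
lra.
Qed.

End weierstrass.

(** * Integrals of powers of the modulus *)

Section lp_integrals.
Variable R : realType.
Implicit Types (D G : set (CC R)) (f g h : CC R -> CC R) (z w : CC R) (p r : R).

Definition toP (D : set (CC R)) : set (R * R) := toC @^-1` D.

Lemma powD_le (a b p : R) : 0 <= a -> 0 <= b -> 0 <= p ->
  (a + b) `^ p <= 2 `^ p * (a `^ p + b `^ p).
Proof.
move=> a0 b0 p0.
wlog ab : a b a0 b0 / a <= b => [H|].
  have [/H|/ltW /H] := leP a b; first exact.
  by rewrite addrC [X in _ -> _ <= _ * X]addrC; apply.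
apply: (@le_trans _ _ ((2 * b) `^ p)).
  by apply: ge0_ler_powR => //; rewrite ?nnegrE; lra.
by rewrite powRM// ler_wpM2l ?powR_ge0// lerDr powR_ge0.
Qed.

(** Stands in for Hölder's inequality: when [t] exceeds [n] it is the product of its powers of
    exponents [1 - p] and [p], and the first is a decreasing function of [t]. *)
Lemma pow_interp (t n p : R) : 0 <= t -> 0 < n -> 1 <= p ->
  t <= n + n `^ (1 - p) * t `^ p.
Proof.
move=> t0 n0 p1.
have [tn|nt] := leP t n; first by apply: (le_trans tn); rewrite lerDl mulr_ge0 ?powR_ge0.
apply: (@le_trans _ _ (n `^ (1 - p) * t `^ p)); last by rewrite lerDr ltW.
have t0' : 0 < t by apply: lt_trans nt.
rewrite -[leLHS]powRr1// -{1}(subrK p 1) powRD; last by rewrite (gt_eqF t0') implybT.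
rewrite ler_wpM2r ?powR_ge0//.
rewrite -(opprB p 1) !powRN lef_pV2 ?posrE ?powR_gt0//.
by apply: ge0_ler_powR; rewrite ?nnegrE; lra.
Qed.

Lemma measurable_pow D f p : open D -> holomorphic_on D f ->
  measurable_fun (toP D) (fun xy => ((cmod (f (toC xy))) `^ p)%:E).
Proof.
move=> oD hf; apply/measurable_EFinP.
exact: (measurableT_comp (measurable_powR p) (measurable_cmod oD hf)).
Qed.

Lemma measurable_toP D : open D -> measurable (toP D).
Proof. exact: plane_open_measurable. Qed.

Lemma pint_ge0 D p f : (0 <= pint D p f)%E.
Proof. by apply: integral_ge0 => x _; rewrite lee_fin powR_ge0. Qed.

Lemma pintZ D p f (t : CC R) : open D -> holomorphic_on D f ->
  pint D p (fun z => t * f z) = ((cmod t `^ p)%:E * pint D p f)%E.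
Proof.
move=> oD hf; rewrite /pint -/(toP D) -ge0_integralZl_EFin ?powR_ge0//.
- by apply: eq_integral => x _; rewrite cmodM powRM ?cmod_ge0// EFinM.
- exact: measurable_toP.
- by move=> x _; rewrite lee_fin powR_ge0.
- exact: measurable_pow.
Qed.

Lemma pintD D p f g : open D -> 0 <= p -> holomorphic_on D f -> holomorphic_on D g ->
  (pint D p (fun z => f z + g z)%R <= (2 `^ p)%:E * (pint D p f + pint D p g))%E.
Proof.
move=> oD p0 hf hg; have mD := measurable_toP oD.
rewrite /pint -/(toP D) -ge0_integralD//; first last.
- exact: measurable_pow.
- by move=> x _; rewrite lee_fin powR_ge0.
- exact: measurable_pow.
- by move=> x _; rewrite lee_fin powR_ge0.
rewrite -ge0_integralZl_EFin ?powR_ge0//; last 2 first.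
- by move=> x _; rewrite adde_ge0// lee_fin powR_ge0.
- by apply: emeasurable_funD; exact: measurable_pow.
have hfg : holomorphic_on D (fun z => f z + g z).
  by move=> z Dz; apply: derivableD; [exact: hf|exact: hg].
apply: ge0_le_integral => //.
- by move=> x _; rewrite lee_fin powR_ge0.
- exact: (measurable_pow p oD hfg).
- by apply: measurable_funeM; apply: emeasurable_funD; exact: measurable_pow.
move=> x Dx; rewrite -EFinD -EFinM lee_fin.
apply: le_trans (powD_le _ _ p0); rewrite ?cmod_ge0//.
by apply: ge0_ler_powR; rewrite ?nnegrE ?addr_ge0 ?cmod_ge0//; exact: cmodD.
Qed.

Lemma pint_subset D G p f : open D -> open G -> D `<=` G -> holomorphic_on G f ->
  (pint D p f <= pint G p f)%E.
Proof.
move=> oD oG DG hf; apply: ge0_subset_integral; [exact: measurable_toP..| | |].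
- exact: measurable_pow.
- by move=> x _; rewrite lee_fin powR_ge0.
- by move=> x; exact: DG.
Qed.

(** By [pow_interp] the integral of [|f|] over the square is at most [n] times its area
    [16 * r ^+ 2], plus [n]. The resulting factor depends neither on [f] nor on [p]; it is linear in
    [n], so small norms give small values. *)
Lemma point_bound D f z r p (n : R) : open D -> holomorphic_on D f -> 0 < r ->
  square z (2 * r) `<=` D -> 1 <= p -> 0 < n ->
  (pint D p f <= (n `^ p)%:E)%E -> cmod (f z) <= n * (16 * (16 * r ^+ 2 + 1) / r ^+ 2).
Proof.
move=> oD hf r0 sD p1 n0 H.
have S0 : 0 <= 2 * r by lra.
have mS := measurable_square z (2 * r).
have mD := measurable_toP oD.
have mfS : measurable_fun (toP (square z (2 * r))) (fun xy => ((cmod (f (toC xy))) `^ p)%:E).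
  by apply: measurable_funS (measurable_pow p oD hf) => // x; exact: sD.
have pS : (\int[@leb2 R]_(xy in toP (square z (2 * r))) ((cmod (f (toC xy))) `^ p)%:E <= (n `^ p)%:E)%E.
  apply: le_trans H; apply: ge0_subset_integral => //.
  - exact: measurable_pow.
  - by move=> x _; rewrite lee_fin powR_ge0.
  - by move=> x; exact: sD.
(* The factor 2 only provides the strict inequality required by [mean_value_bound]. *)
pose B := 2 * n * (16 * r ^+ 2 + 1).
have -> : n * (16 * (16 * r ^+ 2 + 1) / r ^+ 2) = 8 * B / r ^+ 2 by rewrite /B; ring.
apply: (mean_value_bound oD hf r0 sD); rewrite -/(toP _).
have B2 : n * (4 * (2 * r) ^+ 2) + n < B.
  by have : 0 <= n * r ^+ 2 by [apply: mulr_ge0; rewrite ?sqr_ge0 ?ltW]; rewrite /B; lra.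
apply: (@le_lt_trans _ _ (n * (4 * (2 * r) ^+ 2) + n)%:E); last by rewrite lte_fin.
apply: (@le_trans _ _ (\int[@leb2 R]_(xy in toP (square z (2 * r)))
  (n%:E + (n `^ (1 - p))%:E * ((cmod (f (toC xy))) `^ p)%:E))%E).
  apply: ge0_le_integral => //.
  - by move=> x _; rewrite lee_fin cmod_ge0.
  - by apply/measurable_EFinP; apply: (measurable_funS mD _ (measurable_cmod oD hf)) => x; exact: sD.
  - by apply: emeasurable_funD => //; exact: measurable_funeM.
  - by move=> x _; rewrite -EFinM -EFinD lee_fin; apply: pow_interp => //; exact: cmod_ge0.
rewrite ge0_integralD//; first last.
- exact: measurable_funeM.
- by move=> x _; rewrite mule_ge0 ?lee_fin ?powR_ge0.
- by move=> x _; rewrite lee_fin ltW.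
rewrite integral_cst// [X in (n%:E * X + _)%E](leb2_square z S0) ge0_integralZl_EFin ?powR_ge0//; last first.
  by move=> x _; rewrite lee_fin powR_ge0.
rewrite EFinD EFinM leeD2l//.
apply: (@le_trans _ _ ((n `^ (1 - p))%:E * (n `^ p)%:E)%E); first by rewrite lee_wpmul2l// lee_fin powR_ge0.
by rewrite -EFinM lee_fin -powRD ?subrK ?powRr1 ?(ltW n0)// (gt_eqF n0) implybT.
Qed.

Lemma holoD D f g : holomorphic_on D f -> holomorphic_on D g -> holomorphic_on D (fun z => f z + g z).
Proof. by move=> hf hg z Dz; apply: derivableD; [exact: hf|exact: hg]. Qed.

Lemma holoM D f g : holomorphic_on D f -> holomorphic_on D g -> holomorphic_on D (fun z => f z * g z).
Proof.
move=> hf hg z Dz; apply/derivable_cdiffP.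
have /derivable_cdiffP[k Hk] := hf z Dz; have /derivable_cdiffP[l Hl] := hg z Dz.
by eexists; exact: cdiffM Hk Hl.
Qed.

Lemma holo_cst D (c : CC R) : holomorphic_on D (fun=> c).
Proof. by move=> z _; exact: derivable_cst. Qed.

Lemma holoZ D (c : CC R) f : holomorphic_on D f -> holomorphic_on D (fun z => c * f z).
Proof. by move=> hf; exact: (@holoM D (fun=> c) f (@holo_cst D c) hf). Qed.

Lemma holoB D f g : holomorphic_on D f -> holomorphic_on D g -> holomorphic_on D (fun z => f z - g z).
Proof.
move=> hf hg; have -> : (fun z => f z - g z) = (fun z => f z + (-1) * g z).
  by apply/funext => z; rewrite mulN1r.
exact: (holoD hf (holoZ (c := -1) hg)).
Qed.

Lemma OLltD D q f g : open D -> OLlt D q f -> OLlt D q g -> OLlt D q (fun z => f z + g z).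
Proof.
move=> oD [hf Hf] [hg Hg]; split; first exact: holoD.
move=> p p1 pq; apply: le_lt_trans (pintD oD _ hf hg) _; first by lra.
by rewrite lte_mul_pinfty ?lee_fin ?powR_ge0// lte_add_pinfty// ?Hf ?Hg.
Qed.

Lemma OLltZ D q f (t : CC R) : open D -> OLlt D q f -> OLlt D q (fun z => t * f z).
Proof.
move=> oD [hf Hf]; split; first exact: holoZ.
move=> p p1 pq; rewrite pintZ//.
by rewrite lte_mul_pinfty ?lee_fin ?powR_ge0// Hf.
Qed.

Lemma OLltB D q f g : open D -> OLlt D q f -> OLlt D q g -> OLlt D q (f \- g).
Proof.
move=> oD Hf Hg.
have -> : f \- g = (fun z => f z + (-1) * g z) by apply/funext => z; rewrite /= mulN1r.
exact: (OLltD oD Hf (OLltZ (-1) oD Hg)).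
Qed.

End lp_integrals.

(** * The Baire argument *)

Section baire.
Variable R : realType.
Implicit Types (D : set (CC R)) (f g h : CC R -> CC R) (z w : CC R) (p r e : R).

(** Basic neighbourhoods written with integrals rather than with [Lpnorm]: [fine] sends an infinite
    integral to 0, so a bound on [Lpnorm] alone would not imply integrability. *)
Definition nsmall D (ps : nat -> R) (J : nat) (e : R) h := forall j, (j < J)%N ->
  (pint D (ps j) h <= (e `^ (ps j))%:E)%E.

Lemma sum_half (n : nat) : \sum_(0 <= k < n) (2 ^+ k.+1)^-1 = 1 - (2 ^+ n)^-1 :> R.
Proof.
elim: n => [|n IH]; first by rewrite big_nil expr0 invr1 subrr.
by rewrite big_nat_recr//= IH exprS; field; rewrite expf_neq0.
Qed.

Lemma sum_half_le (n : nat) (M : R) : 0 <= M -> \sum_(0 <= k < n) M / 2 ^+ k.+1 <= M.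
Proof.
move=> M0; rewrite -big_distrr/= sum_half ler_piMr// lerBlDr lerDl invr_ge0 exprn_ge0//.
Qed.

Lemma cmod_sum (n : nat) (u : nat -> CC R) :
  cmod (\sum_(0 <= k < n) u k) <= \sum_(0 <= k < n) cmod (u k).
Proof.
elim: n => [|n IH]; first by rewrite !big_nil cmod0.
by rewrite !big_nat_recr//=; apply: le_trans (cmodD _ _) _; rewrite lerD2r.
Qed.

Lemma le_limit_geometric (x M C : R) : 0 <= C -> (forall n : nat, x <= M + C / 4 ^+ n) -> x <= M.
Proof.
move=> C0 H; apply/ler_addgt0Pr => e e0.
have [n /ltW Hn] := exp4_small C0 e0.
by apply: le_trans (H n) _; rewrite lerD2l.
Qed.

(* If the sum of the [p]-th powers of [2 ^ k.+1 * |u k|] is [t], every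
   [|u k|] is at most [t ^ (1/p) / 2 ^ k.+1]; this replaces Minkowski. *)
Lemma powR_series_le (u : nat -> CC R) (s : CC R) p C : 0 < p -> 0 <= C ->
  (forall n : nat, cmod (s - \sum_(0 <= k < n) u k) <= C / 4 ^+ n) ->
  ((cmod s `^ p)%:E <= \sum_(k <oo) ((2 ^+ k.+1 * cmod (u k)) `^ p)%:E)%E.
Proof.
move=> p0 C0 Hs.
have t0 k : (0 <= ((2 ^+ k.+1 * cmod (u k)) `^ p)%:E)%E by rewrite lee_fin powR_ge0.
case E : (\sum_(k <oo) _)%E => [t| |]; last 2 first.
- by rewrite leey.
- have := @nneseries_ge0 R (fun k => ((2 ^+ k.+1 * cmod (u k)) `^ p)%:E) xpredT 0%N.
  by rewrite E => /(_ (fun k _ _ => t0 k)).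
have tk k : (2 ^+ k.+1 * cmod (u k)) `^ p <= t.
  rewrite -lee_fin -E.
  apply: le_trans (nneseries_lim_ge k.+1 _) => //.
  by rewrite big_nat_recr//= leeDr// sume_ge0.
have tt : 0 <= t by apply: le_trans (tk 0%N); rewrite powR_ge0.
pose M := t `^ p^-1.
have uM k : cmod (u k) <= M / 2 ^+ k.+1.
  rewrite ler_pdivlMr ?exprn_gt0// mulrC.
  have x0 : 0 <= 2 ^+ k.+1 * cmod (u k) by rewrite mulr_ge0 ?exprn_ge0 ?cmod_ge0.
  rewrite [leLHS](_ : _ = ((2 ^+ k.+1 * cmod (u k)) `^ p) `^ p^-1); last first.
    by rewrite -powRrM divff ?gt_eqF// powRr1.
  apply: ge0_ler_powR; rewrite ?nnegrE ?powR_ge0 ?tk//.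
  by rewrite invr_ge0 ltW.
have sM : cmod s <= M.
  apply: (le_limit_geometric C0) => n.
  rewrite -(subrK (\sum_(0 <= k < n) u k) s) addrC.
  apply: le_trans (cmodD _ _) _; apply: lerD => //.
  apply: le_trans (cmod_sum _ _) _.
  apply: le_trans (ler_sum _ (fun k _ => uM k)) _.
  exact: sum_half_le (powR_ge0 _ _).
rewrite lee_fin; apply: (@le_trans _ _ (M `^ p)).
  by apply: ge0_ler_powR; rewrite ?nnegrE ?powR_ge0 ?cmod_ge0// ltW.
by rewrite /M -powRrM mulVf ?gt_eqF// powRr1.
Qed.

(** The rate 4 leaves room for the weights 2 of [powR_series_le]: after weighting, the k-th norm is
    at most [d / 2 ^+ k.+1]. As [p >= 1], its p-th power is at most the p-th power of [d] times
    [(2 ^+ k.+1)^-1], and these numbers are summable. *)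
Lemma pint_series D p (h : nat -> CC R -> CC R) (S : CC R -> CC R) (d : R) :
  open D -> 1 <= p -> 0 < d -> (forall k, holomorphic_on D (h k)) -> holomorphic_on D S ->
  (forall k, pint D p (h k) <= ((d / 4 ^+ k.+1) `^ p)%:E)%E ->
  (forall z, D z -> exists2 C, 0 <= C & forall n : nat, cmod (S z - \sum_(0 <= k < n) h k z) <= C / 4 ^+ n) ->
  (pint D p S <= (d `^ p)%:E)%E.
Proof.
move=> oD p1 d0 hh hS Hk HS.
have p0 : 0 < p by lra.
have mD := measurable_toP oD.
pose F k (xy : R * R) := ((2 ^+ k.+1 * cmod (h k (toC xy))) `^ p)%:E.
have FE k xy : F k xy = (((2 ^+ k.+1) `^ p)%:E * ((cmod (h k (toC xy))) `^ p)%:E)%E.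
  by rewrite /F powRM ?cmod_ge0 ?exprn_ge0.
have mF k : measurable_fun (toP D) (F k).
  rewrite (_ : F k = fun xy => (((2 ^+ k.+1) `^ p)%:E * ((cmod (h k (toC xy))) `^ p)%:E)%E); last exact/funext/FE.
  exact: (measurable_funeM _ (measurable_pow p oD (hh k))).
have F0 k xy : (0 <= F k xy)%E by rewrite lee_fin powR_ge0.
apply: (@le_trans _ _ (\int[@leb2 R]_(xy in toP D) (\sum_(k <oo) F k xy))%E).
  apply: ge0_le_integral => //.
  - by move=> x _; rewrite lee_fin powR_ge0.
  - exact: (measurable_pow p oD hS).
  - by apply: (@ge0_emeasurable_sum _ _ _ _ F xpredT) => // k xy _ _; exact: F0.
  - by move=> xy Dxy; have [C C0 HC] := HS _ Dxy; exact: powR_series_le p0 C0 HC.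
rewrite integral_nneseries//.
apply: lime_le; first by apply: is_cvg_nneseries => k _ _; exact: integral_ge0.
near=> n.
apply: (@le_trans _ _ (\sum_(0 <= k < n) (d `^ p / 2 ^+ k.+1)%:E)%E); last first.
  by rewrite sumEFin lee_fin sum_half_le// powR_ge0.
apply: lee_sum => k _.
under eq_integral do rewrite FE.
rewrite ge0_integralZl_EFin ?powR_ge0//; last 2 first.
- by move=> x _; rewrite lee_fin powR_ge0.
- exact: (measurable_pow p oD (hh k)).
apply: (@le_trans _ _ (((2 ^+ k.+1) `^ p)%:E * ((d / 4 ^+ k.+1) `^ p)%:E)%E).
  by apply: lee_wpmul2l; [rewrite lee_fin powR_ge0|exact: Hk].
rewrite -EFinM lee_fin -powRM ?exprn_ge0 ?divr_ge0 ?exprn_ge0 ?(ltW d0)//.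
have -> : 2 ^+ k.+1 * (d / 4 ^+ k.+1) = (2 ^+ k.+1)^-1 * d :> R.
  have -> : (4 : R) ^+ k.+1 = 2 ^+ k.+1 * 2 ^+ k.+1 by rewrite -exprMn -natrM.
  by field; rewrite expf_neq0.
rewrite powRM ?invr_ge0 ?exprn_ge0 ?(ltW d0)// mulrC ler_wpM2l ?powR_ge0//.
apply: ge1r_powR => //; rewrite invr_gt0 exprn_gt0//= invf_le1 ?exprn_gt0//.
by rewrite exprn_ege1// ler1n.
Unshelve. all: by end_near. Qed.

Lemma square_nbhd D z : open D -> D z -> exists2 r, 0 < r & square z r `<=` D.
Proof.
move=> /open_cmodP oD /oD[e e0 eD]; exists (e / 3); first by rewrite divr_gt0.
move=> w /squareP[h1 h2]; apply: eD; apply: le_lt_trans (cmod_ReIm _) _.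
rewrite !ReImE; lra.
Qed.

Lemma leb2_bounded D : open D -> bounded_C D -> (@leb2 R (toP D) < +oo)%E.
Proof.
move=> oD [M HM]; pose N := Num.max M 0.
have N0 : 0 <= N by rewrite le_max lexx orbT.
apply: (@le_lt_trans _ _ (@leb2 R (toC @^-1` square 0 N))); last first.
  by rewrite leb2_square// ltry.
apply: le_measure; rewrite ?inE; [exact: measurable_toP|exact: measurable_square|].
move=> xy /HM H; apply/squareP; rewrite !subr0; split.
  by apply: le_trans (cmod_Re _) _; apply: (le_trans H); rewrite le_max lexx.
by apply: le_trans (cmod_Im _) _; apply: (le_trans H); rewrite le_max lexx.
Qed.

(** Pointwise [|f|^p] is at most [1 + |f|^p'], and [D] has finite area. *)
Lemma pint_lower D p p' f : open D -> bounded_C D -> holomorphic_on D f -> 0 <= p <= p' ->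
  (pint D p' f < +oo)%E -> (pint D p f < +oo)%E.
Proof.
move=> oD bD hf /andP[p0 pp'] H; have mD := measurable_toP oD.
apply: (@le_lt_trans _ _ (\int[@leb2 R]_(xy in toP D) (1%:E + ((cmod (f (toC xy))) `^ p')%:E))%E).
  apply: ge0_le_integral => //.
  - by move=> x _; rewrite lee_fin powR_ge0.
  - exact: measurable_pow.
  - by apply: emeasurable_funD => //; exact: measurable_pow.
  move=> xy _; rewrite -EFinD lee_fin.
  have c0 := cmod_ge0 (f (toC xy)).
  have [c1|c1] := leP 1 (cmod (f (toC xy))).
    by apply: (@le_trans _ _ (cmod (f (toC xy)) `^ p')); rewrite ?lerDr// ler_powR.
  apply: (@le_trans _ _ 1); last by rewrite lerDl powR_ge0.
  rewrite [leRHS](_ : 1 = 1 `^ p); last by rewrite powR1.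
  by apply: ge0_ler_powR; rewrite ?nnegrE// ltW.
rewrite ge0_integralD//; last 2 first.
- by move=> x _; rewrite lee_fin powR_ge0.
- exact: measurable_pow.
rewrite integral_cst// mul1e lte_add_pinfty//; exact: leb2_bounded.
Qed.

End baire.

(** * Nested balls and their common point *)

Section baire_category.
Variable R : realType.
Variables (D : set (CC R)) (q : \bar R) (ps : nat -> R).
Hypotheses (oD : open D) (bD : bounded_C D) (ps1 : forall j, 1 <= ps j)
  (psq : forall j, ((ps j)%:E < q)%E)
  (psc : forall p : R, (p%:E < q)%E -> exists j, p <= ps j).
Implicit Types (f g h : CC R -> CC R) (z w : CC R) (p r e : R).

Definition seminorm_open (U : set (CC R -> CC R)) := forall f, U f ->
  exists J e, 0 < e /\ forall g, OLlt D q g -> nsmall D ps J e (g \- f) -> U g.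

Definition seminorm_dense (U : set (CC R -> CC R)) := forall f, OLlt D q f ->
  forall J e, 0 < e -> exists h, [/\ OLlt D q h, nsmall D ps J e h & U (fun z => f z + h z)].

Lemma nsmall_le J J' e e' h : (J' <= J)%N -> 0 <= e <= e' -> nsmall D ps J e h -> nsmall D ps J' e' h.
Proof.
move=> JJ /andP[e0 ee] H j jJ; apply: le_trans (H j (leq_trans jJ JJ)) _.
rewrite lee_fin; apply: ge0_ler_powR; rewrite ?nnegrE//.
- exact: le_trans (ps1 j).
- exact: le_trans ee.
Qed.

(** A ball of the nested-ball argument: centre, radius, and the number of norms it controls. *)
Record stage := Stage { sfun : CC R -> CC R; seps : R; snum : nat }.

(** Division by 4 is the rate expected by [pint_series] and [geometric_limit]; the growing number of
    norms makes every exponent eventually controlled. *)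
Definition stage_step (U : set (CC R -> CC R)) (s t : stage) := [/\
  nsmall D ps (snum s) (seps s / 4) (sfun t \- sfun s),
  seps t <= seps s / 4, (snum s < snum t)%N &
  forall g, OLlt D q g -> nsmall D ps (snum t) (seps t) (g \- sfun t) -> U g].

Lemma stage_next U s : seminorm_open U -> seminorm_dense U ->
  OLlt D q (sfun s) -> 0 < seps s ->
  exists t, [/\ stage_step U s t, OLlt D q (sfun t) & 0 < seps t].
Proof.
case: s => f e N /= oU dU Hf e0.
have e40 : 0 < e / 4 by rewrite divr_gt0.
have [h [Hh hN Uh]] := dU f Hf N _ e40.
have [J [d [d0 HJ]]] := oU _ Uh.
exists (Stage (fun z => f z + h z) (Num.min (e / 4) d) (maxn N.+1 J)); split => /=.
- split; rewrite /=.
  + have -> : (fun z => f z + h z) \- f = h; last exact: hN.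
    by apply/funext => z /=; rewrite addrAC subrr add0r.
  + by rewrite ge_min lexx.
  + by rewrite leq_max leqnn.
  + move=> g Hg gs; apply: (HJ _ Hg); apply: nsmall_le gs; first by rewrite leq_maxr.
    by rewrite le_min (ltW e40) (ltW d0) ge_min lexx orbT.
- exact: (OLltD oD Hf Hh).
- by rewrite lt_min e40.
Qed.

(** The initial stage controls [J.+1] norms rather than [J], because pointwise convergence of the
    centres needs at least the norm of exponent [ps 0]. *)
Lemma stage_sequence (U : nat -> set (CC R -> CC R)) f J e :
  (forall n, seminorm_open (U n)) -> (forall n, seminorm_dense (U n)) ->
  OLlt D q f -> 0 < e ->
  exists s : nat -> stage, [/\ s 0%N = Stage f e J.+1, forall n, OLlt D q (sfun (s n)),
    forall n, 0 < seps (s n) & forall n, stage_step (U n) (s n) (s n.+1)].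
Proof.
move=> oU dU Hf e0.
pose ok (s : stage) := OLlt D q (sfun s) /\ 0 < seps s.
pose X := {ns : nat * stage | ok ns.2}.
pose Q (x y : X) := (sval y).1 = (sval x).1.+1 /\ stage_step (U (sval x).1) (sval x).2 (sval y).2.
have XQ (x : X) : {y | Q x y}.
  apply/cid; case: x => -[n s] [/= H1 H2].
  have [t [H3 H4 H5]] := stage_next (oU n) (dU n) H1 H2.
  have okt : ok (n.+1, t).2 by [].
  by exists (exist _ (n.+1, t) okt).
have ok0 : ok (0%N, Stage f e J.+1).2 by [].
have [s [s0 sQ]] := dependent_choice XQ (exist _ (0%N, Stage f e J.+1) ok0).
have sn n : (sval (s n)).1 = n.
  by elim: n => [|n IH]; [rewrite s0|have [-> _] := sQ n; rewrite IH].
exists (fun n => (sval (s n)).2); split.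
- by rewrite s0.
- by move=> n; have [] := svalP (s n).
- by move=> n; have [] := svalP (s n).
- by move=> n; have [_] := sQ n; rewrite sn.
Qed.

(** The first norm controls values through [point_bound], so the centres converge pointwise at rate
    [4 ^+ n]. [weierstrass] makes the limit holomorphic, and [pint_series] applied to the
    telescoping tails puts it in every ball. *)
Lemma stage_limit (U : nat -> set (CC R -> CC R)) (s : nat -> stage) :
  (0 < snum (s 0%N))%N ->
  (forall n, OLlt D q (sfun (s n))) -> (forall n, 0 < seps (s n)) ->
  (forall n, stage_step (U n) (s n) (s n.+1)) ->
  exists2 g, OLlt D q g & forall i, nsmall D ps (snum (s i)) (seps (s i)) (g \- sfun (s i)).
Proof.
move=> s0 sO se sS.
pose F n := sfun (s n); pose E n := seps (s n); pose N n := snum (s n).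
have EE i k : E (i + k)%N <= E i / 4 ^+ k.
  elim: k => [|k IH]; first by rewrite addn0 expr0 divr1.
  rewrite addnS exp4_half; have [_ h _ _] := sS (i + k)%N.
  by apply: le_trans h _; rewrite ler_pM2r.
have NN i k : (N i + k <= N (i + k))%N.
  elim: k => [|k IH]; first by rewrite !addn0.
  by rewrite !addnS; have [_ _ h _] := sS (i + k)%N; apply: leq_ltn_trans h.
have hF n : holomorphic_on D (F n) by have [] := sO n.
have hH n : holomorphic_on D (F n.+1 \- F n) by exact: (holoB (hF n.+1) (hF n)).
have Hs i k : nsmall D ps (N i) (E i / 4 ^+ k.+1) (F (i + k).+1 \- F (i + k)%N).
  have [h _ _ _] := sS (i + k)%N.
  apply: nsmall_le h; first by apply: leq_trans (NN i k); rewrite leq_addr.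
  by rewrite divr_ge0 ?(ltW (se _))//= exp4_half ler_pM2r// EE.
have loc z r : 0 < r -> square z (2 * r) `<=` D -> forall n,
    cmod (F n.+1 z - F n z) <= (E 0%N * (16 * (16 * r ^+ 2 + 1) / r ^+ 2)) / 4 ^+ n.
  move=> r0 sD n.
  have En0 : 0 < E 0%N / 4 ^+ n.+1 by rewrite divr_gt0 ?exprn_gt0//; exact: se.
  have := @point_bound R D (F n.+1 \- F n) z r (ps 0%N) (E 0%N / 4 ^+ n.+1)
    oD (hH n) r0 sD (ps1 _) En0 (Hs 0%N n 0%N s0).
  move=> /le_trans; apply; rewrite exp4_half [leRHS]mulrAC.
  have K0 : 0 <= 16 * (16 * r ^+ 2 + 1) / r ^+ 2.
    by rewrite divr_ge0 ?exprn_ge0 ?(ltW r0)//; have := sqr_ge0 r; lra.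
  have a0 : 0 <= E 0%N / 4 ^+ n by rewrite divr_ge0 ?exprn_ge0//; exact: ltW (se _).
  by rewrite ler_wpM2r//; move: a0; move: (E 0%N / 4 ^+ n) => a; lra.
have pt z : D z -> exists l, exists2 C, 0 <= C & forall n, cmod (l - F n z) <= C / 4 ^+ n.
  move=> Dz; have [r r0 sD] := square_nbhd oD Dz.
  have r20 : 0 < r / 2 by lra.
  have r2E : 2 * (r / 2) = r by lra.
  have := loc z _ r20; rewrite r2E => /(_ sD) H.
  have [l Hl] := geometric_limit H; exists l.
  exists (4 * (E 0%N * (16 * (16 * (r / 2) ^+ 2 + 1) / (r / 2) ^+ 2))) => //.
  have := le_trans (cmod_ge0 _) (H 0%N); rewrite expr0 divr1 => ?; lra.
have /choice[g Hg] z : exists l, D z -> exists2 C, 0 <= C & forall n, cmod (l - F n z) <= C / 4 ^+ n.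
  by have [/pt[l Hl]|nD] := pselect (D z); [exists l|exists 0].
have hg : holomorphic_on D g.
  move=> z Dz; apply/derivable_cdiffP.
  have [r r0 sD] := square_nbhd oD Dz.
  (* A square of half-side [2 * t = r / 2] about a point of the square of the same size about [z]
     stays inside the square of half-side [r]. *)
  pose t := r / 4; have t0 : 0 < t by rewrite /t; lra.
  have sub v : square z (2 * t) v -> square v (2 * t) `<=` D.
    move=> /squareP[h1 h2] w /squareP[h3 h4]; apply: sD; apply/squareP.
    split; [apply: le_trans (ler_distD (Re v) _ _) _|apply: le_trans (ler_distD (Im v) _ _) _];
      rewrite /t in h1 h2 h3 h4; lra.
  have self v : square v (2 * t) v by apply/squareP; rewrite !subrr normr0; split; lra.
  set C := E 0%N * (16 * (16 * t ^+ 2 + 1) / t ^+ 2).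
  have HC v : square z (2 * t) v -> forall n, cmod (F n.+1 v - F n v) <= C / 4 ^+ n.
    by move=> /sub; exact: loc.
  have C0 : 0 <= C.
    by have := le_trans (cmod_ge0 _) (HC z (self z) 0%N); rewrite expr0 divr1.
  apply: (@weierstrass R F g z t C t0 C0).
  - by move=> n v /sub /(_ v (self v)) /hF /derivable_cdiffP.
  - by move=> n v /HC; exact.
  - move=> n v sv; have [l Hl] := geometric_limit (HC v sv).
    have Dv : D v by exact: sub (self v).
    have [C' C'0 HC'] := Hg v Dv.
    have C40 : 0 <= 4 * C by lra.
    by rewrite (geometric_unique C'0 C40 HC' Hl).
have tail i : nsmall D ps (N i) (E i) (g \- F i).
  move=> j jN.
  have hk k : holomorphic_on D (F (i + k).+1 \- F (i + k)%N) by exact: (holoB (hF _) (hF _)).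
  apply: (pint_series oD (ps1 j) (se i) hk (holoB hg (hF i)) (fun k => Hs i k j jN)).
  move=> z Dz; have [C C0 HC] := Hg z Dz; exists (C / 4 ^+ i).
    by rewrite divr_ge0 ?exprn_ge0.
  move=> n.
  have -> : \sum_(0 <= k < n) (F (i + k).+1 \- F (i + k)%N) z = F (i + n)%N z - F i z.
    elim: n => [|n IH]; first by rewrite big_nil addn0 subrr.
    by rewrite big_nat_recr//= IH addnS; ring.
  have -> : (g \- F i) z - (F (i + n)%N z - F i z) = g z - F (i + n)%N z by rewrite /=; ring.
  by apply: le_trans (HC _) _; rewrite exprD invfM mulrA.
exists g => //; split => // p p1 pq.
(* Any [p < q] lies below some [ps j], whose norm is controlled from stage [j.+1] on; [pint_lower]
   then descends to [p]. *)
have [j pj] := psc pq.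
have jN : (j < N j.+1)%N.
  by apply: leq_trans (NN 0%N j.+1); rewrite leq_addl.
have H1 : (pint D (ps j) (g \- F j.+1)%R < +oo)%E.
  by apply: le_lt_trans (tail j.+1 j jN) _; rewrite ltry.
have p0 : 0 <= p by lra.
have H2 : (pint D p (g \- F j.+1)%R < +oo)%E.
  have pp : 0 <= p <= ps j by rewrite p0.
  exact: (pint_lower oD bD (holoB hg (hF _)) pp H1).
have H3 : (pint D p (F j.+1) < +oo)%E by have [_ H] := sO j.+1; exact: H.
have -> : g = (fun z => (g \- F j.+1) z + F j.+1 z) by apply/funext => z /=; rewrite subrK.
apply: le_lt_trans (pintD oD p0 (holoB hg (hF j.+1)) (hF j.+1)) _.
rewrite lte_mul_pinfty ?lee_fin ?powR_ge0//; exact: lte_add_pinfty H2 H3.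
Qed.

Theorem baire_dense (U : nat -> set (CC R -> CC R)) f J e :
  (forall n, seminorm_open (U n)) -> (forall n, seminorm_dense (U n)) ->
  OLlt D q f -> 0 < e ->
  exists g, [/\ OLlt D q g, forall n, U n g & nsmall D ps J e (g \- f)].
Proof.
move=> oU dU Hf e0.
have [s [s0 s1 s2 s3]] := @stage_sequence U f J e oU dU Hf e0.
have [|g Hg gs] := stage_limit _ s1 s2 s3; first by rewrite s0.
exists g; split => //.
  by move=> n; have [_ _ _ H] := s3 n; exact: H.
have := gs 0%N; rewrite s0 /=; apply: nsmall_le; first exact: leqnSn.
by rewrite (ltW e0) lexx.
Qed.

End baire_category.

(** * Comparison of the metric with finitely many norms *)

Section metric.
Variable R : realType.
Variables (D : set (CC R)) (q : \bar R) (ps : nat -> R).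
Hypotheses (oD : open D) (ps1 : forall j, 1 <= ps j) (psq : forall j, ((ps j)%:E < q)%E).
Implicit Types (f g h : CC R -> CC R) (z w : CC R) (p r e : R).

Let term f g j := (2 ^- j.+1) * (Lpnorm D (ps j) (f \- g) / (1 + Lpnorm D (ps j) (f \- g))).

Lemma Lpnorm_ge0 p f : 0 <= Lpnorm D p f. Proof. exact: powR_ge0. Qed.

Lemma frac_lt1 (x : R) : 0 <= x -> 0 <= x / (1 + x) <= 1.
Proof.
by move=> x0; rewrite divr_ge0 ?addr_ge0//= ler_pdivrMr ?mul1r ?lerDr// ltr_pwDl.
Qed.

Lemma term_ge0 f g j : 0 <= term f g j.
Proof.
have /andP[h _] := frac_lt1 (Lpnorm_ge0 (ps j) (f \- g)).
by rewrite mulr_ge0 ?invr_ge0 ?exprn_ge0.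
Qed.

Lemma term_le f g j : term f g j <= (2 ^+ j.+1)^-1.
Proof.
have /andP[_ h] := frac_lt1 (Lpnorm_ge0 (ps j) (f \- g)).
by rewrite /term ler_piMr ?invr_ge0 ?exprn_ge0.
Qed.

Lemma term_le_norm f g j e : Lpnorm D (ps j) (f \- g) <= e -> term f g j <= e / 2 ^+ j.+1.
Proof.
move=> Ne; rewrite /term mulrC ler_wpM2r ?invr_ge0 ?exprn_ge0//.
have N0 := Lpnorm_ge0 (ps j) (f \- g).
apply: le_trans Ne; rewrite ler_pdivrMr ?ltr_pwDl//.
by rewrite ler_peMr// lerDl.
Qed.

Let psum f g n := \sum_(0 <= j < n) term f g j.

Lemma psum_nd f g : nondecreasing_seq (psum f g).
Proof.
by apply/nondecreasing_seqP => n; rewrite /psum big_nat_recr//= lerDl term_ge0.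
Qed.

Lemma psum_le1 f g n : psum f g n <= 1.
Proof.
apply: le_trans (ler_sum _ (fun j _ => term_le f g j)) _.
by rewrite sum_half gerBl invr_ge0 exprn_ge0.
Qed.

Lemma psum_cvg f g : cvgn (psum f g).
Proof.
apply: nondecreasing_is_cvgn; first exact: psum_nd.
by exists 1 => _ [n _ <-]; exact: psum_le1.
Qed.

Lemma term_dist f g j : term f g j <= dist_OL D ps f g.
Proof.
have H : psum f g j.+1 <= dist_OL D ps f g.
  by apply: (@nondecreasing_cvgn_le _ (psum f g)); [exact: psum_nd|exact: psum_cvg].
apply: le_trans H; rewrite /psum big_nat_recr//= lerDr.
by apply: sumr_ge0 => k _; exact: term_ge0.
Qed.

(** The first [J] terms sum to at most [e], and the remaining ones are dominated by the geometric
    tail. The induction keeps the exact tail [(2 ^+ J)^-1 - (2 ^+ m)^-1]. *)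
Lemma dist_le f g J e : 0 <= e -> (forall j, (j < J)%N -> Lpnorm D (ps j) (f \- g) <= e) ->
  dist_OL D ps f g <= e + (2 ^+ J)^-1.
Proof.
move=> e0 H; apply: limr_le; first exact: psum_cvg.
near=> n; rewrite -/(psum f g n).
have : forall m, psum f g m <= \sum_(0 <= j < m) e / 2 ^+ j.+1 +
    (if (m <= J)%N then 0 else (2 ^+ J)^-1 - (2 ^+ m)^-1).
  elim=> [|m IH]; first by rewrite /psum !big_nil addr0.
  rewrite /psum !big_nat_recr//= -/(psum f g m).
  have [mJ|Jm] := ltnP m J.
    move: IH; rewrite (ltnW mJ) => IH.
    by rewrite addr0 lerD ?term_le_norm ?H//; rewrite addr0 in IH.
  have h := term_le f g m.
  have ee : 0 <= e / 2 ^+ m.+1 by rewrite divr_ge0 ?exprn_ge0.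
  have E : (2 ^+ m.+1)^-1 = (2 ^+ m)^-1 / 2 :> R by rewrite exprS; field; rewrite expf_neq0.
  move: IH; case: leqP => [mJ|_] IH.
    have -> : J = m by apply/eqP; rewrite eqn_leq Jm mJ.
    rewrite E in h ee *; lra.
  rewrite E in h ee *; lra.
move=> /(_ n) Hn; apply: le_trans Hn _; apply: lerD; first exact: sum_half_le.
by case: ifP => _; rewrite ?invr_ge0 ?exprn_ge0// gerBl invr_ge0 exprn_ge0.
Unshelve. all: by end_near. Qed.

Lemma pint_subC p f g : pint D p (f \- g) = pint D p (g \- f).
Proof.
by apply: eq_integral => xy _; rewrite /= cmodBC.
Qed.

Lemma Lpnorm_pow p f : 0 < p -> (pint D p f < +oo)%E -> pint D p f = (Lpnorm D p f `^ p)%:E.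
Proof.
move=> p0 H; rewrite /Lpnorm -powRrM mulVf ?gt_eqF// powRr1; last by rewrite fine_ge0// pint_ge0.
by rewrite fineK// ge0_fin_numE// pint_ge0.
Qed.

Lemma Lpnorm_le p f e : 0 < p -> 0 <= e -> (pint D p f <= (e `^ p)%:E)%E -> Lpnorm D p f <= e.
Proof.
move=> p0 e0 H.
have F : pint D p f \is a fin_num.
  by rewrite ge0_fin_numE ?pint_ge0//; apply: le_lt_trans H _; rewrite ltry.
rewrite /Lpnorm [leRHS](_ : _ = (e `^ p) `^ p^-1); last by rewrite -powRrM mulfV ?gt_eqF// powRr1.
apply: ge0_ler_powR; rewrite ?nnegrE ?powR_ge0 ?fine_ge0 ?pint_ge0//.
  by rewrite invr_ge0 ltW.
by rewrite -lee_fin fineK.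
Qed.

(** Every weight with [j < J] is at least [(2 ^+ J)^-1], and [x / (1 + x)] is increasing, so the
    radius [(2 ^+ J)^-1 * (e / (1 + e))] forces the first [J] norms below [e]. Membership in [OLlt]
    makes those norms genuine. *)
Lemma seminorm_open_OL (U : set (CC R -> CC R)) : U `<=` OLlt D q ->
  seminorm_open D q ps U -> OL_open D q ps U.
Proof.
move=> UO oU; split => // f Uf; have [J [e [e0 HJ]]] := oU f Uf.
exists ((2 ^+ J)^-1 * (e / (1 + e))); split.
  by rewrite mulr_gt0 ?invr_gt0 ?exprn_gt0// divr_gt0// ltr_pwDl// ltW.
move=> g Og dfg; apply: HJ => // j jJ.
have pj0 : 0 < ps j by exact: lt_le_trans (ps1 j).
have Ofg : (pint D (ps j) (f \- g)%R < +oo)%E.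
  by have [_ H] := OLltB oD (UO _ Uf) Og; exact: H.
rewrite pint_subC (Lpnorm_pow pj0 Ofg) lee_fin.
apply: ge0_ler_powR; rewrite ?nnegrE ?Lpnorm_ge0 ?(ltW e0) ?(ltW pj0)//.
have N0 := Lpnorm_ge0 (ps j) (f \- g).
have := le_lt_trans (term_dist f g j) dfg; rewrite /term.
set N := Lpnorm _ _ _ in N0 *.
have h : (2 ^+ J)^-1 <= (2 ^+ j.+1)^-1 :> R.
  by rewrite lef_pV2 ?posrE ?exprn_gt0// ler_eXn2l// ltr1n.
move=> H.
have : N / (1 + N) < e / (1 + e).
  have e1 : 0 < e / (1 + e) by rewrite divr_gt0// ltr_pwDl// ltW.
  have := lt_le_trans H (ler_wpM2r (ltW e1) h).
  by rewrite ltr_pM2l ?invr_gt0 ?exprn_gt0.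
rewrite ltr_pdivrMr ?ltr_pwDl// mulrAC ltr_pdivlMr ?ltr_pwDl ?(ltW e0)//.
lra.
Qed.

Lemma nsmall_dist r : 0 < r -> exists J e, 0 < e /\
  forall f g, nsmall D ps J e (g \- f) -> dist_OL D ps f g < r.
Proof.
move=> r0; have r20 : 0 < r / 4 by lra.
have [J HJ] := exp4_small (@ler01 R) r20.
(* The index is doubled because [exp4_small] speaks of powers of 4, while the tail is a power of
   2. *)
exists (2 * J)%N, (r / 4); split => // f g H.
have HJ' : (2 ^+ (2 * J))^-1 < r / 4 by rewrite exprM -natrX -[_^-1]mul1r.
apply: le_lt_trans (@dist_le f g (2 * J) (r / 4) (ltW r20) _) _; last by lra.
move=> j jJ; have pj0 : 0 < ps j by exact: lt_le_trans (ps1 j).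
by apply: (Lpnorm_le pj0 (ltW r20)); rewrite pint_subC; exact: H.
Qed.

End metric.

(** * Components and countable conditions *)

Section components.
Variable R : realType.
Implicit Types (D O : set (CC R)) (f : CC R -> CC R) (x y z w zeta : CC R) (r t : R).

Definition ray x y t : CC R := x + (t%:C)%C * (y - x).

Lemma realC_D (s t : R) : ((s + t)%:C)%C = (s%:C)%C + (t%:C)%C :> CC R.
Proof. exact: rmorphD. Qed.
Lemma realC_B (s t : R) : ((s - t)%:C)%C = (s%:C)%C - (t%:C)%C :> CC R.
Proof. exact: rmorphB. Qed.
Lemma realC_M (s t : R) : ((s * t)%:C)%C = (s%:C)%C * (t%:C)%C :> CC R.
Proof. exact: rmorphM. Qed.

Lemma ray_sub x y s t : ray x y s - ray x y t = ((s - t)%:C)%C * (y - x).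
Proof. by rewrite /ray realC_B; ring. Qed.

Lemma ray_dist x y s t : cmod (ray x y s - ray x y t) = `|s - t| * cmod (y - x).
Proof. by rewrite ray_sub cmodM cmod_real. Qed.

Lemma ray0 x y : ray x y 0 = x.
Proof. by rewrite /ray mul0r addr0. Qed.

Lemma ray1 x y : ray x y 1 = y.
Proof. by rewrite /ray mul1r addrC subrK. Qed.

Lemma ray_continuous x y t : {for t, continuous (ray x y)}.
Proof.
apply/line_contP => e e0.
have c0 : 0 < 1 + cmod (y - x) by rewrite ltr_pwDl ?cmod_ge0.
exists (e / (1 + cmod (y - x))); first by rewrite divr_gt0.
move=> s; rewrite ray_dist ltr_pdivlMr// mulrDr mulr1; have := normr_ge0 (s - t); lra.
Qed.

Lemma ray_connected x y (s t : R) : connected (ray x y @` `[s, t]).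
Proof.
apply: connected_continuous_connected; first exact: segment_connected.
by apply: continuous_subspaceT => u; exact: ray_continuous.
Qed.

Lemma ray_disk x y zeta r t : disk zeta r x -> disk zeta r y -> 0 <= t <= 1 ->
  disk zeta r (ray x y t).
Proof.
rewrite /disk /= => hx hy /andP[t0 t1].
have -> : ray x y t - zeta = ((1 - t)%:C)%C * (x - zeta) + (t%:C)%C * (y - zeta).
  by rewrite /ray realC_B; ring.
apply: le_lt_trans (cmodD _ _) _; rewrite !cmodM !cmod_real !ger0_norm ?subr_ge0//.
move: hx hy; move: (cmod (x - zeta)) (cmod (y - zeta)) => a b ar br.
have t10 : 0 <= 1 - t by rewrite subr_ge0.
have [ab|/ltW ab] := leP a b.
  have : (1 - t) * a <= (1 - t) * b by rewrite ler_wpM2l.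
  lra.
have : t * b <= t * a by rewrite ler_wpM2l.
lra.
Qed.

Lemma component_ray D x y : (forall t, 0 <= t <= 1 -> D (ray x y t)) ->
  connected_component D x y.
Proof.
move=> H; apply: (@connected_component_max _ _ (ray x y @` `[0, 1]) x).
- by exists 0; rewrite /= ?in_itv/= ?lexx ?ler01// ray0.
- by move=> _ [t + <-]; rewrite /= in_itv; exact: H.
- exact: ray_connected.
- by exists 1; rewrite /= ?in_itv/= ?lexx ?ler01// ray1.
Qed.

Lemma component_subset D O x : D `<=` O -> connected_component D x `<=` connected_component O x.
Proof.
move=> DO y Hy.
have Dx : D x by apply: contrapT => nD; move: Hy; rewrite (connected_component_out nD).
apply: (@connected_component_max _ O (connected_component D x) x) => //.
- exact: connected_component_refl.
- exact: subset_trans (@connected_component_sub _ _ _) DO.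
- exact: component_connected.
Qed.

Lemma disk_center z r : 0 < r -> disk z r z.
Proof. by move=> r0; rewrite /disk /= subrr cmod0. Qed.

Lemma component_disk D x y r : disk y r `<=` D -> connected_component D x y ->
  disk y r `<=` connected_component D x.
Proof.
move=> sD Hy z yz; apply: connected_component_trans Hy _.
apply: component_ray => t t01; apply: sD; apply: ray_disk => //.
by apply: disk_center; apply: le_lt_trans (cmod_ge0 _) yz.
Qed.

(* First exit of the segment [x, y] from [D]. *)
Lemma component_touch D zeta r x y : open D -> disk zeta r x -> D x -> disk zeta r y -> ~ D y ->
  exists2 v, disk zeta r v /\ ~ D v & forall e : R, 0 < e ->
    exists2 w, cmod (w - v) < e & connected_component (disk zeta r `&` D) x w.
Proof.
move=> oD xr Dx yr nDy.
pose T := [set t : R | 0 <= t <= 1 /\ ~ D (ray x y t)].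
have T1 : T 1 by split; rewrite ?ray1// lexx ler01.
have T0 : has_inf T by split; [exists 1|exists 0 => t [/andP[]]].
pose s := inf T.
have s01 : 0 <= s <= 1.
  apply/andP; split; first by apply: lb_le_inf; [by exists 1|by move=> t [/andP[]]].
  by apply: ge_inf => //; case: T0.
have below t : 0 <= t < s -> D (ray x y t).
  move=> /andP[t0 ts]; apply: contrapT => nD.
  have : s <= t.
    apply: ge_inf; [by case: T0|split => //].
    by rewrite t0 (le_trans (ltW ts))//; case/andP: s01.
  by rewrite leNgt ts.
have nDs : ~ D (ray x y s).
  move=> Ds; have [d d0 dD] := (open_cmodP D).1 oD _ Ds.
  have c0 : 0 < 1 + cmod (y - x) by rewrite ltr_pwDl ?cmod_ge0.
  have e0 : 0 < d / (1 + cmod (y - x)) by rewrite divr_gt0.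
  have [t Tt ts] := inf_adherent e0 T0.
  have st : s <= t by apply: ge_inf => //; case: T0.
  case: Tt => _; apply; apply: dD; rewrite /disk /= ray_dist ger0_norm ?subr_ge0//.
  have : t - s < d / (1 + cmod (y - x)) by rewrite ltrBlDl.
  rewrite ltr_pdivlMr// mulrDr mulr1; lra.
exists (ray x y s); first by split => //; exact: ray_disk.
have s0 : 0 < s.
  case/andP: s01 => s0 _; rewrite lt_neqAle s0 andbT; apply/eqP => E.
  by apply: nDs; rewrite -E ray0.
move=> e e0.
have c0 : 0 < 1 + cmod (y - x) by rewrite ltr_pwDl ?cmod_ge0.
pose t := Num.max 0 (s - e / (1 + cmod (y - x)) / 2).
have t0 : 0 <= t by rewrite le_max lexx.
have q0 : 0 < e / (1 + cmod (y - x)) by rewrite divr_gt0.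
have ts : t < s by rewrite gt_max s0/= ltrBlDr ltrDl divr_gt0.
exists (ray x y t).
  rewrite ray_dist distrC ger0_norm ?subr_ge0 ?(ltW ts)//.
  have : s - t < e / (1 + cmod (y - x)).
    have : s - e / (1 + cmod (y - x)) / 2 <= t by rewrite le_max lexx orbT.
    move: q0; lra.
  rewrite ltr_pdivlMr// mulrDr mulr1; lra.
apply: (@connected_component_max _ _ (ray x y @` `[0, t]) x).
- by exists 0; rewrite /= ?in_itv/= ?lexx ?t0// ray0.
- move=> _ [u + <-]; rewrite /= in_itv/= => /andP[u0 ut]; split.
    apply: ray_disk => //; rewrite u0 (le_trans ut)// (le_trans (ltW ts))//.
    by case/andP: s01.
  by apply: below; rewrite u0 (le_lt_trans ut).
- exact: ray_connected.
- by exists t; rewrite /= ?in_itv/= ?lexx ?t0.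
Qed.

Lemma bdry_open D z : open D -> bdry D z <-> closure D z /\ ~ D z.
Proof. by move=> oD; rewrite /bdry ((interior_id D).1 oD). Qed.

Definition rpt (p q : rat) : CC R := toC (ratr p, ratr q).
Definition irad (n : nat) : R := n.+1%:R^-1.

Lemma irad_gt0 n : 0 < irad n. Proof. by rewrite /irad invr_gt0. Qed.

Lemma irad_small (e : R) (m : nat) : 0 < e -> exists2 n, (m <= n)%N & irad n < e.
Proof.
move=> e0; exists (maxn m (Num.bound e^-1)); first exact: leq_maxl.
rewrite /irad -[ltRHS]invrK ltf_pV2 ?posrE ?invr_gt0//.
apply: lt_le_trans (archi_boundP _) _; first by rewrite invr_ge0 ltW.
by rewrite ler_nat (leq_trans _ (leqnSn _))// leq_maxr.
Qed.

Lemma rpt_dense z (e : R) : 0 < e -> exists p q, cmod (rpt p q - z) < e.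
Proof.
move=> e0; have e20 : 0 < e / 2 by lra.
have [p hp] := ball_rat (Re z) e20; have [q hq] := ball_rat (Im z) e20.
exists p, q; apply: le_lt_trans (cmod_ReIm _) _; rewrite !ReImE /=; lra.
Qed.

(* Total unboundedness of [f] amounts to [tu_at f D p q n] at every crossing,
   a countable set of conditions. *)
Definition crossing D p q n := D (rpt p q) /\ ~ (disk (rpt p q) (irad n) `<=` D).

Lemma crossing_touch D p q n : open D -> crossing D p q n ->
  exists2 v, disk (rpt p q) (irad n) v /\ bdry D v & forall e : R, 0 < e ->
    exists2 w, cmod (w - v) < e & connected_component (disk (rpt p q) (irad n) `&` D) (rpt p q) w.
Proof.
move=> oD [Dx /existsNP[y /not_implyP[yr nDy]]].
have xr := disk_center (rpt p q) (irad_gt0 n).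
have [v [vr nDv] H] := component_touch oD xr Dx yr nDy.
exists v => //; split => //; apply/bdry_open => //; split => //.
apply/closure_cmodP => e /H[w wv Hw]; exists w => //.
by have [_] := connected_component_sub Hw.
Qed.

(** The single index [n] gives both the radius and the height to exceed: small discs demand large
    values, which is enough since arbitrarily small discs are tested. *)
Definition tu_at f D p q n :=
  exists2 z, connected_component (disk (rpt p q) (irad n) `&` D) (rpt p q) z & n%:R < cmod (f z).

Lemma tu_crossing D f p q n : open D -> totally_unbounded D f -> crossing D p q n -> tu_at f D p q n.
Proof.
move=> oD tu cr; have [v [vr vb] H] := crossing_touch oD cr.
have [d d0 dr] := (open_cmodP _).1 (@disk_open R (rpt p q) (irad n)) v vr.
have [w wv Hw] := H d d0.
have [_ Dw] := connected_component_sub Hw.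
have [|z [Ez nz]] := tu v vb d d0 (connected_component (disk v d `&` D) w) _ n%:R.
  by exists w.
exists z => //; apply: connected_component_trans Hw _.
by apply: component_subset Ez => u [/dr ? ?]; split.
Qed.

(** The boundary point [w] need not be adherent to [E], but the segment from a point of [E] to [w]
    first leaves [D] at some [v] that is. A rational point of [E] close to [v] is the centre of a
    crossing whose disc lies in [disk w d], with [n] as large as desired. *)
Lemma crossing_tu D f : open D ->
  (forall p q n, crossing D p q n -> tu_at f D p q n) -> totally_unbounded D f.
Proof.
move=> oD H w wb d d0 E [x0 [[x0d Dx0] ->]] M.
have [_ nDw] := (bdry_open _ oD).1 wb.
have [v [vd nDv] Hv] := component_touch oD x0d Dx0 (disk_center w d0) nDw.
have [e e0 ed] := (open_cmodP _).1 (@disk_open R w d) v vd.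
have e20 : 0 < e / 2 by lra.
have [n nM ne] := irad_small (Num.bound (Num.max M 0)) e20.
have i0 : 0 < irad n / 2 by have := irad_gt0 n; lra.
have [x' x'v Hx'] := Hv _ i0.
have [x'd Dx'] := connected_component_sub Hx'.
have [s s0 sD] := (open_cmodP _).1 (openI (@disk_open R w d) oD) x' (conj x'd Dx').
have m0 : 0 < Num.min s (irad n / 2) by rewrite lt_min s0.
have [p [q pq]] := rpt_dense x' m0.
move: pq; rewrite lt_min => /andP[ps pi].
have Hpq : connected_component (disk w d `&` D) x0 (rpt p q) by exact: (component_disk sD Hx').
have pv : cmod (rpt p q - v) < irad n.
  by apply: le_lt_trans (cmod_tri _ _ x') _; lra.
have [_ Dpq] := sD _ ps.
have [z Hz nz] : tu_at f D p q n.
  by apply: H; split => // K; apply: nDv; apply: K; rewrite /disk /= cmodBC.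
exists z; split.
  apply: connected_component_trans Hpq _; apply: component_subset Hz => u [ur Du]; split => //.
  apply: ed; rewrite /disk/=; apply: le_lt_trans (cmod_tri _ _ (rpt p q)) _.
  rewrite /disk/= in ur; lra.
apply: le_lt_trans nz; apply: (@le_trans _ _ (Num.max M 0)); first by rewrite le_max lexx.
apply: le_trans (ltW (archi_boundP _)) _; first by rewrite le_max lexx orbT.
by rewrite ler_nat.
Qed.

End components.

(** * Singular functions and roots *)

Section singular_integral.
Variable R : realType.
Implicit Types (D : set (CC R)) (f : CC R -> CC R) (z b : CC R).

Lemma dyadic_shell (M s : R) : 0 < s <= M -> exists k, M / 2 ^+ k.+1 < s <= M / 2 ^+ k.
Proof.
move=> /andP[s0 sM].
have ex : exists n, M / 2 ^+ n < s.
  have M0 : 0 <= M by lra.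
  have [n Hn] := exp4_small M0 s0; exists (2 * n)%N.
  by rewrite exprM (_ : 2 ^+ 2 = 4 :> R) // -natrX.
have [m Hm minm] := ex_minnP ex.
case: m Hm minm => [|k] Hk mk; first by move: Hk; rewrite expr0 divr1 ltNge sM.
exists k; rewrite Hk /= leNgt; apply/negP => /mk.
by rewrite ltnn.
Qed.

Lemma geometric_sum_le (a : R) n : 0 <= a < 1 -> \sum_(0 <= k < n) a ^+ k <= (1 - a)^-1.
Proof.
move=> /andP[a0 a1]; have d0 : 0 < 1 - a by rewrite subr_gt0.
suff -> : \sum_(0 <= k < n) a ^+ k = (1 - a ^+ n) / (1 - a).
  rewrite -[leRHS]mul1r ler_wpM2r ?invr_ge0 ?(ltW d0)// gerBl exprn_ge0//.
elim: n => [|n IH]; first by rewrite big_nil expr0 subrr mul0r.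
by rewrite big_nat_recr//= IH exprS; field; rewrite gt_eqF.
Qed.

(* Dyadic square shells about [b]: area [4 (M / 2^k)^2] against the value
   [(M / 2^(k+1))^(- beta)], a geometric series of ratio [2^(beta - 2)]. *)
Lemma singular_bound (beta M : R) : 0 <= beta < 2 -> 0 < M ->
  exists2 C : R, 0 <= C & forall D b, open D -> D `<=` square b M ->
    (pint D (- beta)%R (fun z => (z - b)%R) <= C%:E)%E.
Proof.
move=> /andP[b0 b2] M0.
pose a : R := 2 `^ (beta - 2).
have a0 : 0 < a by rewrite powR_gt0.
have a1 : a < 1.
  rewrite /a -opprB powRN invf_lt1 ?powR_gt0//.
  have y0 : 0 < 2 - beta by lra.
  rewrite lt_neqAle eq_sym powR_eq1 (gt_eqF y0) orbF.
  rewrite -[leLHS](powRr0 2) ler_powR ?ler1n ?(ltW y0)// andbT negb_or -leNgt ler0n andbT.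
  by rewrite pnatr_eq1.
pose c k : R := (M / 2 ^+ k.+1) `^ (- beta).
pose K : R := 4 * M ^+ 2 * (M `^ (- beta) * 2 `^ beta).
have K0 : 0 <= K by rewrite !mulr_ge0 ?powR_ge0 ?exprn_ge0// ltW.
have cE k : c k * (4 * (M / 2 ^+ k) ^+ 2) = K * a ^+ k.
  rewrite /c powRM ?invr_ge0 ?exprn_ge0 ?(ltW M0)//.
  have -> : (2 ^+ k.+1)^-1 `^ (- beta) = 2 `^ beta * (2 `^ beta) ^+ k :> R.
    rewrite -exprS -powR_invn// -powRrM -powR_mulrn ?powR_ge0// -powRrM.
    by congr (_ `^ _); ring.
  have -> : a ^+ k = (2 `^ beta) ^+ k / (2 ^+ k) ^+ 2.
    rewrite /a powRB ?pnatr_eq0 ?implybT// powR_mulrn// expr_div_n exprAC//.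
  by rewrite /K; field; rewrite expf_neq0.
exists (K * (1 - a)^-1); first by rewrite mulr_ge0 ?invr_ge0 ?subr_ge0 ?(ltW a1).
move=> D b oD Db.
have mD := measurable_toP oD.
have hb : holomorphic_on D (fun z => z - b).
  by apply: holoB; [move=> z _; exact: derivable_id|exact: holo_cst].
pose S k := toP (square b (M / 2 ^+ k)).
have mS k : measurable (S k) by exact: measurable_square.
pose F k (xy : R * R) : \bar R := ((c k)%:E * (\1_(S k) xy)%:E)%E.
have c0 k : 0 <= c k by exact: powR_ge0.
have F0 k xy : (0 <= F k xy)%E by rewrite mule_ge0 ?lee_fin.
have mI k : measurable_fun (toP D) (fun xy : R * R => (\1_(S k) xy)%:E : \bar R).
  by apply/measurable_EFinP; apply: measurable_indic.
have mF k : measurable_fun (toP D) (F k) by exact: (measurable_funeM _ (mI k)).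
apply: (@le_trans _ _ (\int[@leb2 R]_(xy in toP D) (\sum_(k <oo) F k xy))%E).
  apply: ge0_le_integral => //.
  - by move=> xy _; rewrite lee_fin powR_ge0.
  - exact: (measurable_pow _ oD hb).
  - by apply: (@ge0_emeasurable_sum _ _ _ _ F xpredT) => // k xy _ _; exact: F0.
  move=> xy Dxy.
  suff [k Hk] : exists k, (((cmod (toC xy - b)) `^ (- beta))%:E <= F k xy)%E.
    apply: le_trans Hk _; apply: le_trans (nneseries_lim_ge k.+1 _) => //.
    by rewrite big_nat_recr//= leeDr// sume_ge0.
  (* At the centre the power is 0 by the convention for a negative exponent at 0, or 1 when
     [beta = 0]; the shell of index 0 dominates both. *)
  have [E|ne] := eqVneq (toC xy) b.
    exists 0%N; rewrite /F indicE mem_set; last first.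
      by rewrite /S /toP /= E; apply/squareP; rewrite !subrr normr0 expr0 divr1 ltW.
    rewrite mule1 lee_fin E subrr cmod0.
    have [be|bn0] := eqVneq beta 0; first by rewrite /c be oppr0 !powRr0.
    by rewrite powR0 ?oppr_eq0 ?c0.
  pose s := Num.max `|Re (toC xy) - Re b| `|Im (toC xy) - Im b|.
  have s0 : 0 < s.
    rewrite lt_neqAle le_max normr_ge0 andbT; apply/eqP => s0.
    have : toC xy = b.
      apply: eqC; apply/eqP; rewrite -subr_eq0 -normr_eq0 eq_le normr_ge0 andbT s0.
        by rewrite le_max lexx.
      by rewrite le_max lexx orbT.
    by move/eqP; rewrite (negbTE ne).
  have sM : 0 < s <= M.
    by rewrite s0/= ge_max; have /squareP[-> ->] := Db _ Dxy.
  have [k /andP[k1 k2]] := dyadic_shell sM.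
  exists k; rewrite /F indicE mem_set; last first.
    by apply/squareP; move: k2; rewrite ge_max => /andP.
  rewrite mule1 lee_fin /c !powRN lef_pV2 ?posrE ?powR_gt0 ?divr_gt0 ?exprn_gt0//; last first.
    by rewrite cmod_gt0 subr_eq0.
  apply: ge0_ler_powR; rewrite ?nnegrE ?cmod_ge0 ?divr_ge0 ?exprn_ge0 ?(ltW M0)//.
  apply: (le_trans (ltW k1)); rewrite ge_max; apply/andP; split.
    by rewrite -ReN -ReD cmod_Re.
  by rewrite -ImN -ImD cmod_Im.
rewrite integral_nneseries//.
apply: lime_le; first by apply: is_cvg_nneseries => k _ _; exact: integral_ge0.
near=> n.
apply: (@le_trans _ _ (\sum_(0 <= k < n) (K * a ^+ k)%:E)%E); last first.
  rewrite sumEFin lee_fin -big_distrr/= ler_wpM2l// geometric_sum_le//.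
  by rewrite (ltW a0).
apply: lee_sum => k _.
rewrite ge0_integralZl_EFin; [|exact: mD|by move=> x _; rewrite lee_fin|exact: mI|exact: c0].
rewrite integral_indic//; last exact: mS.
rewrite -cE EFinM; apply: lee_wpmul2l; first by rewrite lee_fin.
have Mk : 0 <= M / 2 ^+ k by rewrite divr_ge0 ?exprn_ge0 ?(ltW M0).
rewrite -(leb2_square b Mk); apply: le_measure; rewrite ?inE.
- exact: measurableI (mS k) mD.
- exact: mS.
- by move=> xy [].
Unshelve. all: by end_near. Qed.

End singular_integral.

(** * Holomorphic roots of quotients off a connected set *)

Section roots.
Variable R : realType.
Implicit Types (A C D : set (CC R)) (f g : CC R -> CC R) (a b c x z w : CC R).

(** The truth set of [P] is relatively open and closed. No path in [A] is used, which matters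
    because [A] will be a component of the complement of an open set. *)
Lemma connected_propagate A (P : CC R -> Prop) x : connected A -> A x -> P x ->
  (forall z, A z -> P z -> exists2 e : R, 0 < e & forall w, A w -> cmod (w - z) < e -> P w) ->
  (forall z, A z -> ~ P z -> exists2 e : R, 0 < e & forall w, A w -> cmod (w - z) < e -> ~ P w) ->
  forall z, A z -> P z.
Proof.
move=> cA Ax Px HP HnP.
have nbh (Q : CC R -> Prop) :
    (forall z, A z -> Q z -> exists2 e : R, 0 < e & forall w, A w -> cmod (w - z) < e -> Q w) ->
    exists2 U, open U & forall z, A z -> (Q z <-> U z).
  move=> HQ; exists (\bigcup_(ze in [set ze : CC R * R | [/\ A ze.1, Q ze.1 &
      forall w, A w -> cmod (w - ze.1) < ze.2 -> Q w]]) disk ze.1 ze.2).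
    by apply: bigcup_open => ze _; exact: disk_open.
  move=> z Az; split=> [Qz|[ze [_ _ H] zz]]; last exact: H.
  by have [e e0 He] := HQ z Az Qz; exists (z, e) => //=; exact: disk_center.
have [U oU UE] := nbh P HP; have [V oV VE] := nbh (fun z => ~ P z) HnP.
have E : [set z | A z /\ P z] = A.
  apply: cA; first by exists x.
    by exists U => //; apply/seteqP; split => z [Az Hz]; split => //; apply/UE.
  exists (~` V); first exact: open_closedC.
  apply/seteqP; split => z [Az Hz]; split => //; first by move=> /(VE z Az).
  by apply: contrapT => nP; apply: Hz; apply/VE.
move=> z Az; have : [set z | A z /\ P z] z by rewrite E.
by case.
Qed.

Lemma cmod_double z : cmod (z + z) = 2 * cmod z.
Proof.
have -> : z + z = ((2 : R)%:C)%C * z by apply: eqC; rewrite !ReImE /=; ring.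
by rewrite cmodM cmod_real ger0_norm.
Qed.

(** The sign in [f = g] or [f = - g] is locally constant: a change of sign would force a jump of
    size [2 * cmod (g z)]. *)
Lemma square_root_unique C x f g : connected C -> C x ->
  (forall z, C z -> exists l, cdiff f z l) -> (forall z, C z -> exists l, cdiff g z l) ->
  (forall z, C z -> g z != 0) -> (forall z, C z -> f z ^+ 2 = g z ^+ 2) -> f x = g x ->
  forall z, C z -> f z = g z.
Proof.
move=> cC Cx df dg g0 E Ex.
have pm z : C z -> f z = g z \/ f z = - g z.
  by move=> /E /eqP; rewrite eqf_sqr => /orP[/eqP ->|/eqP ->]; [left|right].
have near z : C z -> exists2 e : R, 0 < e & forall w, C w -> cmod (w - z) < e ->
    cmod (f w - f z) < cmod (g z) /\ cmod (g w - g z) < cmod (g z).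
  move=> Cz; have gz0 : 0 < cmod (g z) by rewrite cmod_gt0 g0.
  have [l /cdiff_continuous /ccont_cmodP /(_ _ gz0)[e e0 He]] := df z Cz.
  have [k /cdiff_continuous /ccont_cmodP /(_ _ gz0)[d d0 Hd]] := dg z Cz.
  exists (Num.min e d); first by rewrite lt_min e0.
  by move=> w _; rewrite lt_min => /andP[/He ? /Hd ?].
have far z w : C z -> cmod (f w - f z) < cmod (g z) -> cmod (g w - g z) < cmod (g z) ->
    (f z = g z -> f w != - g w) /\ (f z = - g z -> f w != g w).
  move=> Cz h1 h2; have gz0 : 0 < cmod (g z) by rewrite cmod_gt0 g0.
  have two := cmod_double (g z).
  split=> Ez; apply/eqP => Ew.
    have : cmod (g z + g z) <= cmod (f w - f z) + cmod (g w - g z).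
      rewrite -cmodN; apply: le_trans (cmodD _ _); rewrite Ew Ez.
      by rewrite le_eqVlt; apply/orP; left; apply/eqP; congr cmod; ring.
    lra.
  have : cmod (g z + g z) <= cmod (f w - f z) + cmod (g w - g z).
    rewrite -(cmodN (g w - g z)); apply: le_trans (cmodD _ _); rewrite Ew Ez.
    rewrite le_eqVlt; apply/orP; left; apply/eqP; congr cmod; ring.
  lra.
apply: (@connected_propagate C (fun z => f z = g z) x) => //.
- move=> z Cz Ez; have [e e0 He] := near z Cz; exists e => // w Cw /(He w Cw)[h1 h2].
  have [h _] := far z w Cz h1 h2; have [//|Em] := pm w Cw.
  by move: (h Ez); rewrite Em eqxx.
- move=> z Cz nEz; have [e e0 He] := near z Cz; exists e => // w Cw /(He w Cw)[h1 h2].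
  have [_ h] := far z w Cz h1 h2; have [//|Em] := pm z Cz.
  by apply/eqP; exact: h.
Qed.

Lemma cdiffX f z n : (exists l, cdiff f z l) -> exists l, cdiff (fun w => f w ^+ n) z l.
Proof.
move=> [l fl]; elim: n => [|n [k IH]].
  by exists 0; under eq_fun do rewrite expr0; exact: cdiff_cst.
by eexists; under eq_fun do rewrite exprS; exact: cdiffM fl IH.
Qed.

(** A dyadic order allows descending one squaring at a time, so that only the ambiguity of a sign
    has to be resolved. *)
Lemma root_unique k C x f g : connected C -> C x ->
  (forall z, C z -> exists l, cdiff f z l) -> (forall z, C z -> exists l, cdiff g z l) ->
  (forall z, C z -> g z != 0) -> (forall z, C z -> f z ^+ (2 ^ k) = g z ^+ (2 ^ k)) -> f x = g x ->
  forall z, C z -> f z = g z.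
Proof.
move=> cC Cx df dg g0 E Ex; elim: k E => [|k IH] E; first by move=> z /E; rewrite !expn0 !expr1.
apply: IH; apply: (@square_root_unique C x (fun z => f z ^+ (2 ^ k)) (fun z => g z ^+ (2 ^ k)) cC Cx).
- by move=> z /df; exact: cdiffX.
- by move=> z /dg; exact: cdiffX.
- by move=> z /g0; exact: expf_neq0.
- by move=> z /E; rewrite expnSr !exprM.
- by rewrite Ex.
Qed.

Lemma Re_sqrtc w : 0 < Re w -> 0 < Re (sqrtc w).
Proof.
case: w => u v /= u0.
rewrite sqrtr_gt0 divr_gt0// ltr_pwDr// ?sqrtr_ge0//.
Qed.

(** With [s], [t] the roots of [w], [v], the first-order error is [- (t - s) ^+ 2 / (2 * s)], and
    [cmod (t - s)] is at most [cmod (v - w) / Re s] because [t + s] has real part at least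
    [Re s]. *)
Lemma cdiff_sqrtc w : 0 < Re w -> exists l, cdiff (@sqrtc R : CC R -> CC R) w l.
Proof.
move=> w0; set s : CC R := sqrtc w.
have s0 : 0 < Re s by exact: Re_sqrtc.
have ss : s != 0 by apply/eqP => E; move: s0; rewrite E ltxx.
have cs : 0 < cmod s by rewrite cmod_gt0.
exists ((s + s)^-1) => e e0.
exists (Num.min (Re w) (e * (Re s) ^+ 2 * (2 * cmod s))).
  by rewrite lt_min w0 !mulr_gt0// exprn_gt0.
move=> v; rewrite lt_min => /andP[v1 v2].
have v0 : 0 < Re v.
  have : `|Re (v - w)| < Re w by apply: le_lt_trans v1; exact: cmod_Re.
  by rewrite !ReImE ltr_norml; lra.
set t : CC R := sqrtc v.
have t0 : 0 < Re t by exact: Re_sqrtc.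
have Et : t ^+ 2 = v by exact: sqr_sqrtc.
have Es : s ^+ 2 = w by exact: sqr_sqrtc.
have two := cmod_double s.
have ss2 : s + s != 0 by rewrite -cmod_gt0 two; lra.
have -> : t - s - (s + s)^-1 * (v - w) = - ((t - s) ^+ 2 / (s + s)).
  by rewrite -Et -Es; field.
rewrite cmodN cmodM cmodV two cmodX.
have ts : Re s * cmod (t - s) <= cmod (v - w).
  have -> : v - w = (t + s) * (t - s) by rewrite -Et -Es; ring.
  rewrite cmodM ler_wpM2r ?cmod_ge0//.
  by apply: le_trans (cmod_Re _); apply: le_trans (ler_norm _); rewrite ReD lerDr ltW.
rewrite ler_pdivrMr ?mulr_gt0//.
have r2 : 0 < Re s ^+ 2 by rewrite exprn_gt0.
rewrite -(ler_pM2l r2) -exprMn.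
apply: (@le_trans _ _ (cmod (v - w) ^+ 2)).
  by rewrite lerXn2r ?nnegrE ?mulr_ge0 ?cmod_ge0// ltW.
have -> : Re s ^+ 2 * (e * cmod (v - w) * (2 * cmod s)) = (e * Re s ^+ 2 * (2 * cmod s)) * cmod (v - w) by ring.
by rewrite expr2 ler_wpM2r ?cmod_ge0// ltW.
Qed.

Lemma iter_sqrtcX k w : (iter k (@sqrtc R) w) ^+ (2 ^ k) = w.
Proof.
elim: k w => [|k IH] w; first by rewrite expn0 expr1.
by rewrite iterSr expnS mulnC exprM IH sqr_sqrtc.
Qed.

(** The principal root preserves the right half-plane, so the iteration never meets the branch
    cut. *)
Lemma iter_sqrtc k w : 0 < Re w -> exists l, cdiff (iter k (@sqrtc R) : CC R -> CC R) w l.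
Proof.
elim: k w => [|k IH] w w0; first by exists 1; exact: cdiff_id.
have [l Hl] := cdiff_sqrtc w0; have [m Hm] := IH _ (Re_sqrtc w0).
exists (m * l).
have -> : (iter k.+1 (@sqrtc R) : CC R -> CC R) = (iter k (@sqrtc R) : CC R -> CC R) \o (@sqrtc R : CC R -> CC R).
  by apply/funext => z; rewrite iterSr.
exact: cdiff_comp Hl Hm.
Qed.

(** The intermediate [d] expresses that the distance to [A] is strictly larger than [e], without an
    infimum; it is what makes the set open. *)
Definition far A (e : R) : set (CC R) := [set z | exists2 d, e < d & forall c, A c -> d <= cmod (z - c)].

Lemma far_open A e : open (far A e).
Proof.
apply/open_cmodP => z [d ed Hd]; exists ((d - e) / 2); first by lra.
move=> w wz; exists ((d + e) / 2); first lra.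
by move=> c /Hd h; have := cmod_tri z c w; rewrite (cmodBC z w); move: wz; rewrite /disk/=; lra.
Qed.

Lemma far_subset A e e' : e <= e' -> far A e' `<=` far A e.
Proof. by move=> ee z [d ed Hd]; exists d => //; exact: le_lt_trans ed. Qed.

Lemma cdiff_sub a z : cdiff (fun z => z - a) z 1.
Proof. by have := cdiffD (@cdiff_id R z) (@cdiff_cst R (- a) z); rewrite addr0. Qed.

Lemma far_neq A e z c : 0 <= e -> far A e z -> A c -> z - c != 0.
Proof. by move=> e0 [d ed Hd] /Hd h; rewrite -cmod_gt0; lra. Qed.

Definition quot a b z : CC R := (z - a) * (z - b)^-1.

Lemma cdiff_quot a b z : z != b -> exists l, cdiff (quot a b) z l.
Proof.
by move=> zb; apply: cdiff_div_sub => //; exists 1; exact: cdiff_sub.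
Qed.

(* Moving [c] inside [A] by less than [e] multiplies [(z - c) / (z - b)] by a
   factor of positive real part, which has a principal root. *)
Lemma root_far A (e : R) a b k : 0 < e -> connected A -> A a -> A b ->
  exists g, forall z, far A e z -> (exists l, cdiff g z l) /\ g z ^+ (2 ^ k) = quot a b z.
Proof.
move=> e0 cA Aa Ab.
pose P c := exists g, forall z, far A e z -> (exists l, cdiff g z l) /\ g z ^+ (2 ^ k) = quot c b z.
have step c c' : A c -> A c' -> cmod (c' - c) < e -> P c -> P c'.
  move=> Ac Ac' cc [g Hg].
  exists (fun z => g z * (iter k (@sqrtc R) (quot c' c z) : CC R)) => z fz.
  have zc := far_neq (ltW e0) fz Ac.
  have zb := far_neq (ltW e0) fz Ab.
  have pos : 0 < Re (quot c' c z).
    have : cmod (quot c' c z - 1) < 1.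
      have -> : quot c' c z - 1 = (c - c') * (z - c)^-1 by rewrite /quot; field.
      rewrite cmodM cmodV ltr_pdivrMr ?cmod_gt0// mul1r cmodBC.
      by case: fz => d ed /(_ _ Ac); lra.
    have := cmod_Re (quot c' c z - 1); rewrite !ReImE /=.
    move=> h1 h2; have := le_lt_trans h1 h2; rewrite ltr_norml; lra.
  have [[l Hl] E] := Hg z fz.
  have zc' : z != c by rewrite -subr_eq0.
  have [m Hm] := cdiff_quot c' zc'; have [n Hn] := iter_sqrtc k pos.
  split; first by eexists; exact: cdiffM Hl (cdiff_comp Hm Hn).
  by rewrite exprMn E iter_sqrtcX /quot; field; rewrite zc zb.
apply: (@connected_propagate A P b cA Ab) => //.
- exists (fun=> 1) => z fz; split; first by exists 0; exact: cdiff_cst.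
  by rewrite expr1n /quot divff// (far_neq (ltW e0) fz Ab).
- by move=> z Az Pz; exists e => // w Aw wz; exact: step Pz.
- move=> z Az nPz; exists e => // w Aw wz Pw; apply: nPz.
  by apply: (step w z) => //; rewrite cmodBC.
Qed.

(** The sets [O n] exhaust [D], but the roots [g n] given by [root_far] for different [n] need not
    agree. They are normalised at one base point per class of points joined in some [O n];
    [root_unique] then makes them coherent. *)
Lemma holomorphic_root A D a b k : connected A -> A a -> A b -> open D -> (forall z, D z -> ~ A z) ->
  exists2 g, holomorphic_on D g & forall z, D z -> g z ^+ (2 ^ k) = quot a b z.
Proof.
move=> cA Aa Ab oD DA.
pose O n := far A (irad R n).
have oO n : open (O n) by exact: far_open.
have i0 n : 0 <= irad R n by exact: ltW (irad_gt0 R n).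
have OO n m : (n <= m)%N -> O n `<=` O m.
  by move=> nm; apply: far_subset; rewrite /irad lef_pV2 ?posrE// ler_nat ltnS.
have DO z : D z -> exists n, O n z.
  move=> Dz; have [e e0 He] := (open_cmodP D).1 oD z Dz.
  have [n _ ne] := irad_small 0 e0; exists n; exists e => // c Ac.
  by rewrite leNgt; apply/negP => h; apply: (DA c) => //; apply: He; rewrite /disk/= cmodBC.
have /choice[g Hg] n : exists g, forall z, O n z -> (exists l, cdiff g z l) /\ g z ^+ (2 ^ k) = quot a b z.
  exact: root_far (irad_gt0 R n) cA Aa Ab.
have q0 n z : O n z -> quot a b z != 0.
  by move=> Oz; rewrite mulf_neq0 ?invr_eq0 ?(far_neq (i0 n) Oz).
have g0 n z : O n z -> g n z != 0.
  move=> Oz; have [_ E] := Hg n z Oz; have := q0 n z Oz; rewrite -E.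
  by apply: contraNneq => ->; rewrite expr0n expn_eq0.
pose s x : CC R := iter k (@sqrtc R) (quot a b x).
(* Rescaling by a constant gives the prescribed value [s x] at [x]; the constant is a root of unity
   of order dividing [2 ^ k], so the result is still a root of the quotient. *)
pose G x n z := g n z * (s x / g n x).
have dG x n z : O n z -> exists l, cdiff (G x n) z l.
  by move=> /Hg[[l Hl] _]; eexists; exact: cdiffM Hl (@cdiff_cst R _ z).
have EG x n z : O n x -> O n z -> G x n z ^+ (2 ^ k) = quot a b z.
  move=> Ox Oz; have [_ Ez] := Hg n z Oz; have [_ Ex] := Hg n x Ox.
  by rewrite /G exprMn Ez expr_div_n Ex /s iter_sqrtcX divff ?mulr1 ?(q0 n).
have Gx x n : O n x -> G x n x = s x.
  by move=> Ox; rewrite /G mulrC divfK ?g0.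
have G0 x n z : O n x -> O n z -> G x n z != 0.
  move=> Ox Oz; have := q0 n z Oz; rewrite -(EG x n z Ox Oz).
  by apply: contraNneq => ->; rewrite expr0n expn_eq0.
have coh x n m z : (n <= m)%N -> connected_component (O n) x z -> G x m z = G x n z.
  move=> nm Hz.
  have Ox : O n x by apply: contrapT => nO; move: Hz; rewrite (connected_component_out nO).
  have sub w : connected_component (O n) x w -> O n w by exact: connected_component_sub.
  apply: (@root_unique k (connected_component (O n) x) x (G x m) (G x n)) => //.
  - exact: component_connected.
  - exact: connected_component_refl.
  - by move=> w /sub /(OO _ _ nm); exact: dG.
  - by move=> w /sub; exact: dG.
  - by move=> w /sub; exact: G0.
  - move=> w /sub Ow; rewrite (EG x n w Ox Ow) EG//; [exact: OO Ox|exact: OO Ow].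
  - by rewrite !Gx//; exact: OO Ox.
pose V x : set (CC R) := [set z | exists n, connected_component (O n) x z].
have lift n m x z : (n <= m)%N -> connected_component (O n) x z -> connected_component (O m) x z.
  by move=> nm; apply: component_subset; exact: OO.
have Vsym x z : V x z -> V z x by move=> [n Hn]; exists n; exact: connected_component_sym.
have Vtr x y z : V x y -> V y z -> V x z.
  move=> [n Hn] [m Hm]; exists (maxn n m).
  apply: (@connected_component_trans _ _ y); first by apply: lift Hn; exact: leq_maxl.
  by apply: lift Hm; exact: leq_maxr.
have VE x z : V x z -> V x = V z.
  by move=> Vxz; apply/seteqP; split => y; [exact: Vtr (Vsym _ _ Vxz)|exact: Vtr Vxz].
(* [rep] chooses from the class [V z] itself, so equal classes give the same base point. The choice
   made by [ind] is harmless by [coh]. *)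
pose rep z := xget 0 (V z).
pose ind z := xget 0%N [set n | connected_component (O n) (rep z) z].
have Dcomp z : D z -> connected_component (O (ind z)) (rep z) z.
  move=> /DO[n On].
  have : V z (rep z) by apply: (@xgetPex _ 0 (V z)); exists z, n; exact: connected_component_refl.
  by move=> /Vsym[m Hm]; apply: (@xgetPex _ 0%N [set n | connected_component (O n) (rep z) z]); exists m.
exists (fun z => G (rep z) (ind z) z).
  move=> z Dz; apply/derivable_cdiffP.
  have Hz := Dcomp z Dz; have Oz := connected_component_sub Hz.
  have [e e0 He] := (open_cmodP _).1 (openI (oO (ind z)) oD) z (conj Oz Dz).
  have [l Hl] := dG (rep z) _ z Oz.
  exists l => r r0; have [d d0 Hd] := Hl r r0.
  exists (Num.min d e); first by rewrite lt_min d0.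
  move=> w; rewrite lt_min => /andP[wd we].
  have Hw : connected_component (O (ind z)) (rep z) w.
    by apply: (component_disk _ Hz) we => v /He[].
  have [_ Dw] := He w we.
  have Vzw : V z w.
    by apply: (Vtr _ (rep z)); [apply: Vsym|]; exists (ind z).
  have repE : rep w = rep z.
    by rewrite /rep (VE _ _ Vzw).
  rewrite repE.
  have Hw' := Dcomp w Dw; rewrite repE in Hw'.
  have -> : G (rep z) (ind w) w = G (rep z) (ind z) w.
    have [le|/ltnW le] := leqP (ind z) (ind w); first exact: coh.
    by rewrite (coh _ _ _ _ le Hw').
  exact: Hd.
move=> z Dz; have Hz := Dcomp z Dz; have Oz := connected_component_sub Hz.
apply: EG => //; apply: contrapT => nO; move: Hz.
by rewrite (connected_component_out nO).
Qed.

End roots.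

(** * Open and dense conditions *)

Section generic_sets.
Variable R : realType.
Implicit Types (f g h : CC R -> CC R) (z w : CC R) (p r e : R).

Lemma powR_cont (a r e : R) : 0 <= a -> 0 < r -> 0 < e -> exists2 d : R, 0 < d &
  forall b, 0 <= b -> `|b - a| < d -> `|b `^ r - a `^ r| < e.
Proof.
move=> a0 r0 e0; have [->|an0] := eqVneq a 0.
  exists (e `^ r^-1); first by rewrite powR_gt0.
  move=> b b0; rewrite subr0 powR0 ?gt_eqF// subr0 !ger0_norm ?powR_ge0// => be.
  have -> : e = (e `^ r^-1) `^ r by rewrite -powRrM mulVf ?gt_eqF// powRr1// ltW.
  by apply: gt0_ltr_powR => //; rewrite ?in_itv/= ?nnegrE ?andbT ?powR_ge0.
have ap : 0 < a by rewrite lt_neqAle eq_sym an0.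
have dr : derivable (fun x : R => x `^ r) a 1 by apply: derivable_powR; rewrite in_itv/= ap.
have := differentiable_continuous ((derivable1_diffP _ _).1 dr).
move=> /cvgrPdist_lt /(_ e e0) /nbhs_normP[d d0 H].
exists d => // b b0 bd; rewrite distrC; apply: H; by rewrite /= distrC.
Qed.

Variables (D : set (CC R)) (q : \bar R) (ps : nat -> R).
Hypotheses (oD : open D) (bD : bounded_C D) (hps : exponent_seq q ps).

Lemma ps_lt1 j : 1 < ps j.
Proof.
have [p0 [pS _]] := hps; elim: j => [//|j IH].
exact: lt_trans IH (pS j).
Qed.

Lemma ps_le1 j : 1 <= ps j. Proof. exact: ltW (ps_lt1 j). Qed.

Lemma ps_mono : {homo ps : m n / (m <= n)%N >-> m <= n}.
Proof. by have [_ [pS _]] := hps; apply: homo_leq => [//|? ? ?|n]; [exact: le_trans|exact: ltW]. Qed.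

Lemma ps_ltq j : ((ps j)%:E < q)%E.
Proof.
have [_ [pS pc]] := hps.
apply: (@lt_le_trans _ _ (ps j.+1)%:E); first by rewrite lte_fin.
rewrite -(cvg_lim _ pc)//; apply: lime_ge; first by apply/cvg_ex; exists q.
by near=> n; rewrite lee_fin ps_mono//; near: n; exists j.+1.
Unshelve. all: by end_near. Qed.

Lemma ps_cofinal (p : R) : (p%:E < q)%E -> exists j, p <= ps j.
Proof.
have [_ [_ pc]] := hps; move=> pq; apply: contrapT => H.
have : (q <= p%:E)%E.
  rewrite -(cvg_lim _ pc)//; apply: lime_le; first by apply/cvg_ex; exists q.
  near=> n; rewrite lee_fin leNgt; apply/negP => /ltW h; apply: H; by exists n.
by rewrite leNgt pq.
Unshelve. all: by end_near. Qed.

Definition zerof : CC R -> CC R := fun=> 0.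

Lemma pint0 p : 0 < p -> pint D p zerof = 0%E.
Proof.
move=> p0; rewrite /pint; apply: integral0_eq => xy _.
by rewrite cmod0 powR0 ?gt_eqF.
Qed.

Lemma OLlt0 : OLlt D q zerof.
Proof.
split; first exact: holo_cst.
by move=> p p1 _; rewrite pint0 ?ltry//; lra.
Qed.

Lemma nsmall0 J e : nsmall D ps J e zerof.
Proof. by move=> j _; rewrite pint0 ?lee_fin ?powR_ge0//; have := ps_lt1 j; lra. Qed.

Lemma addzerof f : (fun z => f z + zerof z) = f.
Proof. by apply/funext => z; rewrite /zerof addr0. Qed.

(** The zero perturbation settles the case [U f]. The gain is the hypothesis [~ U f], which bounds
    [f] where the perturbation has to dominate it. *)
Lemma seminorm_denseW (U : set (CC R -> CC R)) :
  (forall f, OLlt D q f -> ~ U f -> forall J e, 0 < e ->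
    exists h, [/\ OLlt D q h, nsmall D ps J e h & U (fun z => f z + h z)]) ->
  seminorm_dense D q ps U.
Proof.
move=> H f Hf J e e0; have [Uf|nUf] := pselect (U f); last exact: H.
by exists zerof; split; [exact: OLlt0|exact: nsmall0|rewrite addzerof].
Qed.

Lemma dense_Gdelta (T : countType) (W : T -> set (CC R -> CC R)) :
  (forall t, seminorm_open D q ps [set f | OLlt D q f /\ W t f]) ->
  (forall t, seminorm_dense D q ps [set f | OLlt D q f /\ W t f]) ->
  forall S, S = [set f | OLlt D q f /\ forall t, W t f] ->
  OL_dense D q ps S /\ OL_Gdelta D q ps S.
Proof.
move=> oW dW S ->.
(* Indices that decode to nothing receive the whole space, which is open and dense. *)
pose U m := if unpickle m is Some t then [set f | OLlt D q f /\ W t f] else [set f | OLlt D q f].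
have USub m : U m `<=` OLlt D q by rewrite /U; case: unpickle => [t|] f // [].
have oU m : seminorm_open D q ps (U m).
  rewrite /U; case: unpickle => [t|]; first exact: oW.
  by move=> f Hf; exists 0%N, 1; split.
have dU m : seminorm_dense D q ps (U m).
  rewrite /U; case: unpickle => [t|]; first exact: dW.
  apply: seminorm_denseW => f Hf nH; by case: nH.
have SU : [set f | OLlt D q f /\ forall t, W t f] = \bigcap_m U m.
  apply/seteqP; split => f.
    by move=> [Hf Wf] m _; rewrite /U; case: unpickle => [t|] //; split.
  move=> Uf; split; first exact: USub (Uf 0%N I).
  by move=> t; have := Uf (pickle t) I; rewrite /U pickleK => -[].
split; split; try by move=> f [].
  move=> f Hf r r0; have [J [e [e0 He]]] := nsmall_dist D ps_le1 r0.
  have [g [Og Ug gf]] := @baire_dense R D q ps oD bD ps_le1 ps_cofinal U f J e oU dU Hf e0.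
  exists g; split; last exact: He.
  by rewrite SU => m _; exact: Ug.
exists U; split; last exact: SU.
by move=> n; apply: (seminorm_open_OL oD ps_le1 ps_ltq) => //; exact: USub.
Qed.

Lemma bounded_near_point z r : 0 < r -> square z (2 * r) `<=` D ->
  exists2 K : R, 0 < K & forall f g e, 0 < e -> OLlt D q f -> OLlt D q g ->
    nsmall D ps 1 e (g \- f) -> cmod (g z - f z) <= e * K.
Proof.
move=> r0 sD; exists (16 * (16 * r ^+ 2 + 1) / r ^+ 2).
  by rewrite divr_gt0 ?exprn_gt0//; have := sqr_ge0 r; lra.
move=> f g e e0 [hf _] [hg _] H.
exact: (point_bound oD (holoB hg hf) r0 sD (ps_le1 0) e0 (H 0%N isT)).
Qed.

Lemma pointwise_limit z f : D z -> OLlt D q f -> forall eta : R, 0 < eta ->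
  exists2 e, 0 < e & forall g, OLlt D q g -> nsmall D ps 1 e (g \- f) -> cmod (g z - f z) < eta.
Proof.
move=> Dz Hf eta eta0; have [s s0 sD] := square_nbhd oD Dz.
have r0 : 0 < s / 2 by lra.
have sE : 2 * (s / 2) = s by lra.
have sD' : square z (2 * (s / 2)) `<=` D by rewrite sE.
have [K K0 HK] := bounded_near_point r0 sD'.
have e0 : 0 < eta / K / 2 by rewrite !divr_gt0.
exists (eta / K / 2) => // g Hg H; apply: le_lt_trans (HK f g _ e0 Hf Hg H) _.
by rewrite mulrAC divfK ?gt_eqF//; lra.
Qed.

(** The inequality is strict at one witness point, and evaluation there is continuous for the first
    norm. *)
Lemma tu_open a b n : seminorm_open D q ps [set f | OLlt D q f /\ (crossing D a b n -> tu_at f D a b n)].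
Proof.
move=> f [Hf Uf]; have [cr|ncr] := pselect (crossing D a b n); last first.
  by exists 0%N, 1; split; [exact: ltr01|move=> g Hg _; split; [exact: Hg|move/ncr]].
have [z Hz nz] := Uf cr.
have [_ Dz] := connected_component_sub Hz.
have eta0 : 0 < cmod (f z) - n%:R by rewrite subr_gt0.
have [e e0 He] := pointwise_limit Dz Hf eta0.
exists 1%N, e; split => // g Hg H; split => // _; exists z => //.
have := cmodBl (f z) (g z); rewrite cmodBC; have := He g Hg H; lra.
Qed.

Definition spike a b n := forall J (e M : R), 0 < e -> exists h, [/\ OLlt D q h, nsmall D ps J e h &
  exists2 z, connected_component (disk (rpt R a b) (irad R n) `&` D) (rpt R a b) z & M < cmod (h z)].

(** If [f] fails the condition, [|f|] is at most [n] on the component, so a spike exceeding [2 * n]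
    survives the addition of [f]. *)
Lemma tu_dense a b n : (crossing D a b n -> spike a b n) ->
  seminorm_dense D q ps [set f | OLlt D q f /\ (crossing D a b n -> tu_at f D a b n)].
Proof.
move=> sp; apply: seminorm_denseW => f Hf nUf J e e0.
have [cr|ncr] := pselect (crossing D a b n); last by case: nUf; split.
have [h [Oh hs [z Hz Mz]]] := sp cr J e (2 * n%:R) e0.
have fz : cmod (f z) <= n%:R.
  rewrite leNgt; apply/negP => nz; apply: nUf; split => // _; by exists z.
exists h; split; [exact: Oh|exact: hs|split; first exact: (OLltD oD Hf Oh)].
move=> _; exists z; first exact: Hz.
have := cmodBl (h z) (- f z); rewrite cmodN opprK (addrC (h z)); lra.
Qed.

Definition lq_at r f a b n := (n%:R%:E < pint (disk (rpt R a b) (irad R n) `&` D) r f)%E.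

(** The integral is only lower semicontinuous, and possibly infinite. If the condition failed
    arbitrarily close to [f], a sequence [g] of violators would converge pointwise to [f], and
    Fatou's lemma would bound the integral of [f] by [n]. *)
Lemma lq_open r a b n : 0 < r ->
  seminorm_open D q ps [set f | OLlt D q f /\ (crossing D a b n -> lq_at r f a b n)].
Proof.
move=> r0 f [Hf Uf]; have [cr|ncr] := pselect (crossing D a b n); last first.
  by exists 0%N, 1; split; [exact: ltr01|move=> g Hg _; split; [exact: Hg|move/ncr]].
apply: contrapT => H.
set E := disk (rpt R a b) (irad R n) `&` D.
have oE : open E by apply: openI => //; exact: disk_open.
have mE := measurable_toP oE.
have hE g : OLlt D q g -> holomorphic_on E g by move=> [hg _] z [_ /hg].
have /choice[g Hg] k : exists g, [/\ OLlt D q g, nsmall D ps 1 (irad R k) (g \- f) & ~ lq_at r g a b n].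
  apply: contrapT => Hk; apply: H; exists 1%N, (irad R k); split; first exact: irad_gt0.
  move=> g Og gs; split; first exact: Og.
  move=> _; apply: contrapT => ng; apply: Hk; by exists g.
have := Uf cr; rewrite /lq_at -/E ltNge => /negP; apply.
pose F k xy : \bar R := ((cmod (g k (toC xy))) `^ r)%:E.
have := @fatou _ _ _ (@lebesgue_measure R \x @lebesgue_measure R)%E (toP E) mE F _ _.
have mF k : measurable_fun (toP E) (F k).
  by have [Og _ _] := Hg k; exact: (measurable_pow r oE (hE _ Og)).
have F0 k xy : toP E xy -> (0 <= F k xy)%E by move=> _; rewrite lee_fin powR_ge0.
move=> /(_ mF F0) fat.
have -> : pint E r f = (\int[(@lebesgue_measure R \x @lebesgue_measure R)%E]_(xy in toP E) limn_einf (F^~ xy))%E.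
  apply: eq_integral => xy; rewrite inE => -[_ Dxy].
  have cv : F^~ xy @ \oo --> ((cmod (f (toC xy))) `^ r)%:E.
    apply: cvg_EFin; first by apply: nearW => k.
    apply/cvgrPdist_lt => e e0.
    have [d d0 Hd] := powR_cont (cmod_ge0 (f (toC xy))) r0 e0.
    have [eps eps0 Heps] := pointwise_limit Dxy Hf d0.
    have [m _ mi] := irad_small 0 eps0.
    exists m => // k /= mk; rewrite distrC; apply: Hd; first exact: cmod_ge0.
    have [Og gs _] := Hg k.
    have : cmod (g k (toC xy) - f (toC xy)) < d.
      apply: Heps => //; apply: (nsmall_le ps_le1 (leqnn 1)) gs.
      rewrite (ltW (irad_gt0 R k))/= (le_trans _ (ltW mi))//.
      by rewrite /irad lef_pV2 ?posrE// ler_nat ltnS.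
    have := cmodBl (g k (toC xy)) (f (toC xy)); have := cmodBl (f (toC xy)) (g k (toC xy)).
    rewrite (cmodBC (f _)) ltr_norml; lra.
  by have [-> _] := cvg_limn_einf_sup cv.
apply: le_trans fat _; rewrite limn_einf_lim.
apply: lime_le; first exact: is_cvg_einfs.
near=> k; apply: (@le_trans _ _ (\int[(@lebesgue_measure R \x @lebesgue_measure R)%E]_(xy in toP E) F k xy)%E).
  by apply: ereal_inf_lbound; exists k => /=.
by rewrite leNgt; apply/negP; have [_ _] := Hg k.
Unshelve. all: by end_near. Qed.

Definition heavy r a b n := forall J (e M : R), 0 < e -> exists h, [/\ OLlt D q h, nsmall D ps J e h &
  (M%:E < pint (disk (rpt R a b) (irad R n) `&` D) r h)%E].

(** Writing [h] as [(f + h) - f] and using [pintD], both integrals being at most [n] would bound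
    that of [h] by the r-th power of 2 times [n + n], the very height asked of [h]. *)
Lemma lq_dense r a b n : 0 < r -> (crossing D a b n -> heavy r a b n) ->
  seminorm_dense D q ps [set f | OLlt D q f /\ (crossing D a b n -> lq_at r f a b n)].
Proof.
move=> r0 sp; apply: seminorm_denseW => f Hf nUf J e e0.
have [cr|ncr] := pselect (crossing D a b n); last by case: nUf; split.
set E := disk (rpt R a b) (irad R n) `&` D.
have oE : open E by apply: openI => //; exact: disk_open.
have hE g : OLlt D q g -> holomorphic_on E g by move=> [hg _] z [_ /hg].
have [h [Oh hs Mh]] := sp cr J e (2 `^ r * (n%:R + n%:R)) e0.
have fn : (pint E r f <= n%:R%:E)%E.
  rewrite leNgt; apply/negP => nz; apply: nUf; split => // _.
have Ofh := OLltD oD Hf Oh.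
exists h; split; [exact: Oh|exact: hs|split; first exact: Ofh].
move=> _; rewrite /lq_at -/E ltNge; apply/negP => fh.
move: Mh; rewrite -/E ltNge => /negP; apply.
have -> : h = (fun z => (f z + h z) + (-1) * f z).
  by apply/funext => z; rewrite mulN1r addrAC subrr add0r.
apply: le_trans (pintD oE (ltW r0) (hE _ Ofh) (holoZ (c := -1) (hE _ Hf))) _.
rewrite EFinM; apply: lee_wpmul2l; first by rewrite lee_fin powR_ge0.
rewrite EFinD; apply: leeD; first exact: fh.
by rewrite (pintZ r (-1) oE (hE _ Hf)) cmodN cmod1 powR1 mul1e.
Qed.

End generic_sets.

(** * Dyadic powers of quotients, their integrability, and scaling *)

Section blocks.
Variable R : realType.
Implicit Types (f g h : CC R -> CC R) (a b v z w : CC R) (p r e : R).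

Lemma ratio_big (c al M : R) : 0 < c -> 0 < al -> exists2 e : R, 0 < e &
  forall u v : R, c <= u -> 0 < v < e -> M < (u / v) `^ al.
Proof.
move=> c0 al0; pose X : R := (Num.max M 0 + 1) `^ al^-1.
have m0 : 0 < Num.max M 0 + 1 by rewrite ltr_wpDl// le_max lexx orbT.
have X0 : 0 < X by rewrite powR_gt0.
exists (c / X); first by rewrite divr_gt0.
move=> u v cu /andP[v0 ve].
have XE : X `^ al = Num.max M 0 + 1 by rewrite /X -powRrM mulVf ?gt_eqF// powRr1// ltW.
apply: (@lt_le_trans _ _ (X `^ al)).
  by rewrite XE; apply: (@le_lt_trans _ _ (Num.max M 0)); [rewrite le_max lexx|rewrite ltrDl].
apply: ge0_ler_powR; rewrite ?nnegrE ?(ltW X0) ?(ltW al0)//.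
  by rewrite divr_ge0 ?(ltW v0)// (le_trans (ltW c0)).
rewrite ler_pdivlMr//; move: ve; rewrite ltr_pdivlMr// mulrC => /ltW h.
exact: le_trans h cu.
Qed.

Lemma root_ratio (x y : R) (m k : nat) : 0 <= x -> 0 <= y -> x ^+ (2 ^ k) = y ->
  x ^+ m = y `^ (m%:R / 2 ^+ k).
Proof.
move=> x0 y0 E; rewrite -E -powR_mulrn// -powR_mulrn// -powRrM natrX.
by congr (_ `^ _); field; rewrite expf_neq0.
Qed.

Lemma root_block A D a b (m k : nat) : connected A -> A a -> A b -> open D ->
  (forall z, D z -> ~ A z) ->
  exists2 f, holomorphic_on D f &
    forall z, D z -> cmod (f z) = (cmod (z - a) / cmod (z - b)) `^ (m%:R / 2 ^+ k).
Proof.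
move=> cA Aa Ab oD DA.
have [g hg Hg] := holomorphic_root k cA Aa Ab oD DA.
exists (fun z => g z ^+ m).
  by move=> z Dz; apply/derivable_cdiffP; apply: cdiffX; apply/derivable_cdiffP; exact: hg.
move=> z Dz; rewrite cmodX; apply: root_ratio; first exact: cmod_ge0.
  by rewrite divr_ge0 ?cmod_ge0.
by rewrite -cmodX Hg// /quot cmodM cmodV.
Qed.

Variables (D : set (CC R)) (q : \bar R) (ps : nat -> R).
Hypotheses (oD : open D) (bD : bounded_C D).

Lemma closure_bound (M : R) v : (forall z, D z -> cmod z <= M) -> closure D v -> cmod v <= M.
Proof.
move=> HM /closure_cmodP cv; apply/ler_addgt0Pr => e e0; have [w Dw wv] := cv e e0.
have := HM w Dw; have := cmodBl v w; rewrite cmodBC; lra.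
Qed.

Lemma bounded_square (M B : R) b : (forall z, D z -> cmod z <= M) -> cmod b <= B ->
  D `<=` square b (M + B).
Proof.
move=> HM bB z /HM zM; apply/squareP.
have : cmod (z - b) <= M + B.
  by apply: le_trans (cmodD _ _) _; rewrite cmodN lerD.
move=> H; rewrite -!ReN -!ImN -ReD -ImD.
by split; [apply: le_trans (cmod_Re _) H|apply: le_trans (cmod_Im _) H].
Qed.

Lemma holo_sub b : holomorphic_on D (fun z => z - b).
Proof. by move=> z _; apply/derivable_cdiffP; exists 1; exact: cdiff_sub. Qed.

Lemma pint_ratio f b (L al p C : R) : holomorphic_on D f -> 0 <= L -> 0 <= al -> 0 <= p ->
  (forall z, D z -> cmod (f z) <= (L / cmod (z - b)) `^ al) ->
  (pint D (- (al * p))%R (fun z => (z - b)%R) <= C%:E)%E ->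
  (pint D p f <= (L `^ (al * p) * C)%:E)%E.
Proof.
move=> hf L0 al0 p0 Hf HC.
rewrite EFinM.
apply: (@le_trans _ _ ((L `^ (al * p))%:E * pint D (- (al * p))%R (fun z => (z - b)%R))%E); last first.
  by apply: lee_wpmul2l => //; rewrite lee_fin powR_ge0.
have mD := measurable_toP oD.
rewrite /pint -/(toP D) -ge0_integralZl_EFin ?powR_ge0//; last 2 first.
- by move=> xy _; rewrite lee_fin powR_ge0.
- exact: (measurable_pow _ oD (@holo_sub b)).
apply: ge0_le_integral => //.
- by move=> xy _; rewrite lee_fin powR_ge0.
- exact: (measurable_pow _ oD hf).
- exact: (measurable_funeM _ (measurable_pow _ oD (@holo_sub b))).
move=> xy Dxy; rewrite -EFinM lee_fin.
apply: (@le_trans _ _ (((L / cmod (toC xy - b)) `^ al) `^ p)).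
  apply: ge0_ler_powR; rewrite ?nnegrE ?cmod_ge0 ?powR_ge0//; exact: Hf.
rewrite -powRrM powRM ?invr_ge0 ?cmod_ge0// -powR_inv1 ?cmod_ge0// -powRrM.
by rewrite mulN1r.
Qed.

Lemma OLlt_bounded f (B : R) : holomorphic_on D f -> (forall z, D z -> cmod (f z) <= B) -> OLlt D q f.
Proof.
move=> hf HB; split => // p p1 _.
have mD := measurable_toP oD.
apply: (@le_lt_trans _ _ (\int[@leb2 R]_(xy in toP D) ((Num.max B 0) `^ p)%:E)%E).
  apply: ge0_le_integral => //.
  - by move=> xy _; rewrite lee_fin powR_ge0.
  - exact: (measurable_pow _ oD hf).
  move=> xy Dxy; rewrite lee_fin; apply: ge0_ler_powR; rewrite ?nnegrE ?cmod_ge0//.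
  - lra.
  - by rewrite le_max lexx orbT.
  - by rewrite le_max HB.
rewrite integral_cst// lte_mul_pinfty ?lee_fin ?powR_ge0//; exact: leb2_bounded.
Qed.

Hypothesis hps : exponent_seq q ps.

Lemma scale_small J (N : nat -> R) (e : R) : 0 < e -> (forall j, 0 <= N j) ->
  exists2 t : R, 0 < t & forall j, (j < J)%N -> t * N j <= e.
Proof.
move=> e0 N0; pose S := \sum_(0 <= j < J) N j.
have S0 : 0 <= S by apply: sumr_ge0 => j _.
exists (e / (1 + S)); first by rewrite divr_gt0// ltr_pwDl.
move=> j jJ; rewrite mulrAC ler_pdivrMr ?ltr_pwDl// ler_pM2l//.
apply: (@le_trans _ _ S); last by rewrite lerDr.
rewrite /S (@big_cat_nat _ _ _ j)//=; last exact: ltnW.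
rewrite [X in _ + X]big_ltn// addrCA lerDl addr_ge0//.
- by apply: sumr_ge0 => i _.
- by apply: sumr_ge0 => i _.
Qed.

Lemma nsmall_scale J f (N : nat -> R) (t e : R) : holomorphic_on D f -> 0 < t ->
  (forall j, (j < J)%N -> 0 <= N j /\ (pint D (ps j) f <= (N j `^ ps j)%:E)%E) ->
  (forall j, (j < J)%N -> t * N j <= e) -> nsmall D ps J e (fun z => (t%:C)%C * f z).
Proof.
move=> hf t0 HN tN j jJ; have [N0 Hj] := HN j jJ.
have pj0 : 0 < ps j by have := ps_lt1 hps j; lra.
rewrite (pintZ _ _ oD hf) cmod_real ger0_norm ?(ltW t0)//.
apply: (@le_trans _ _ ((t `^ ps j)%:E * (N j `^ ps j)%:E)%E).
  by apply: lee_wpmul2l => //; rewrite lee_fin powR_ge0.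
rewrite -EFinM lee_fin -powRM ?(ltW t0)//.
by apply: ge0_ler_powR; rewrite ?nnegrE ?mulr_ge0 ?(ltW pj0) ?(ltW t0)// (le_trans _ (tN j jJ))// mulr_ge0// ltW.
Qed.

(** One unbounded member of the space suffices: multiplied by a small positive [t] it becomes small
    in the first [J] norms and stays unbounded. *)
Lemma spike_of_unbounded (a b : rat) n f : OLlt D q f ->
  (forall M : R, exists2 z, connected_component (disk (rpt R a b) (irad R n) `&` D) (rpt R a b) z & M < cmod (f z)) ->
  spike D q ps a b n.
Proof.
move=> Of Hf J e M e0; have [hf _] := Of.
have [t t0 Ht] := scale_small J e0 (fun j => Lpnorm_ge0 D (ps j) f).
have [z Hz zM] := Hf (M / t).
exists (fun z => (t%:C)%C * f z); split.
- exact: OLltZ.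
- apply: (nsmall_scale hf t0 _ Ht) => j _; split; first exact: Lpnorm_ge0.
  rewrite -Lpnorm_pow//; first by have := ps_lt1 hps j; lra.
  by have [_ H] := Of; apply: H; [exact: ps_le1 hps j|exact: ps_ltq hps j].
- by exists z => //; rewrite cmodM cmod_real ger0_norm ?(ltW t0)// mulrC -ltr_pdivrMr.
Qed.

Lemma holo_inv_sub v : ~ D v -> holomorphic_on D (fun z => (z - v)^-1).
Proof.
move=> nDv z Dz; apply/derivable_cdiffP; apply: cdiff_inv_sub.
by apply/eqP => zv; apply: nDv; rewrite -zv.
Qed.

Lemma ratio_OLlt f b (L al : R) : holomorphic_on D f -> 0 <= L -> 0 <= al -> closure D b ->
  (forall z, D z -> cmod (f z) <= (L / cmod (z - b)) `^ al) ->
  (forall p, 1 <= p -> (p%:E < q)%E -> al * p < 2) -> OLlt D q f.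
Proof.
move=> hf L0 al0 cb Hf Hq; split => // p p1 pq.
have [M HM] := bD.
have HM' z : D z -> cmod z <= Num.max M 1 by move=> /HM h; rewrite le_max h.
have M1 : 1 <= Num.max M 1 by rewrite le_max lexx orbT.
have p0 : 0 <= p by lra.
have ap : 0 <= al * p < 2 by rewrite mulr_ge0//= Hq.
have M0 : 0 < Num.max M 1 + Num.max M 1 by lra.
have [C C0 HC] := singular_bound ap M0.
have sub : D `<=` square b (Num.max M 1 + Num.max M 1).
  exact: bounded_square HM' (closure_bound HM' cb).
apply: le_lt_trans (pint_ratio hf L0 al0 p0 Hf (HC D b oD sub)) _.
exact: ltry.
Qed.

End blocks.

(** * The generic sets of (i) and (ii) *)

Section first_two_parts.
Variable R : realType.

Lemma tu_setE (D : set (CC R)) (q : \bar R) : open D ->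
  [set g | OLlt D q g /\ totally_unbounded D g] =
  [set f | OLlt D q f /\ forall t : rat * rat * nat, crossing D t.1.1 t.1.2 t.2 -> tu_at f D t.1.1 t.1.2 t.2].
Proof.
move=> oD; apply/seteqP; split => f [Of H]; split => //.
  by move=> [[a b] n] /=; exact: tu_crossing.
by apply: crossing_tu => // a b n; exact: (H (a, b, n)).
Qed.

Lemma tu_dense_Gdelta (D : set (CC R)) (q : \bar R) ps : open D -> bounded_C D -> exponent_seq q ps ->
  (forall a b n, crossing D a b n -> spike D q ps a b n) ->
  let S := [set g | OLlt D q g /\ totally_unbounded D g] in
  OL_dense D q ps S /\ OL_Gdelta D q ps S.
Proof.
move=> oD bD hps sp S.
apply: (@dense_Gdelta R D q ps oD bD hps (rat * rat * nat)%type
  (fun t => [set f | crossing D t.1.1 t.1.2 t.2 -> tu_at f D t.1.1 t.1.2 t.2])).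
- by move=> t; exact: (tu_open oD hps).
- by move=> t; apply: (tu_dense oD hps); exact: sp.
- by rewrite /S tu_setE.
Qed.

Lemma spike_inverse (D : set (CC R)) ps a b n : open D -> bounded_C D -> exponent_seq (2%:E)%E ps ->
  crossing D a b n -> spike D (2%:E)%E ps a b n.
Proof.
move=> oD bD hps cr; have [v [vr /(bdry_open _ oD)[cv nDv]] Hv] := crossing_touch oD cr.
have hf := @holo_inv_sub R D v nDv.
apply: (@spike_of_unbounded R D _ ps oD hps a b n (fun z => (z - v)^-1)).
  apply: (@ratio_OLlt R D _ oD bD _ v 1 1 hf ler01 ler01 cv).
    by move=> z Dz; rewrite cmodV powRr1 ?mul1r// invr_ge0 cmod_ge0.
  by move=> p p1; rewrite lte_fin mul1r.
move=> M; have [e e0 He] := @ratio_big R 1 1 M ltr01 ltr01.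
have [w wv Hw] := Hv e e0; exists w => //.
have [_ Dw] := connected_component_sub Hw.
have w0 : 0 < cmod (w - v).
  by rewrite cmod_gt0 subr_eq0; apply/eqP => wE; apply: nDv; rewrite -wE.
have := He 1 (cmod (w - v)) (lexx _); rewrite w0 wv => /(_ isT).
by rewrite powRr1 ?mul1r ?cmodV// invr_ge0 cmod_ge0.
Qed.

Lemma dyadic_small (x : R) : exists k : nat, x < 2 ^+ k.
Proof.
exists (Num.bound (Num.max x 0)).
apply: (@le_lt_trans _ _ (Num.max x 0)); first by rewrite le_max lexx.
apply: lt_trans (archi_boundP _) _; first by rewrite le_max lexx orbT.
by rewrite -natrX ltr_nat; apply: ltn_expl.
Qed.

(** The order satisfies [q / 2 < 2 ^+ k], so the exponent [1 / 2 ^+ k] times any [p < q] stays below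
    2, the threshold of local integrability in the plane. Near [v] the numerator is at least half of
    [cmod (c - v)]. *)
Lemma spike_root (D : set (CC R)) (q : R) ps a b n : open D -> bounded_C D ->
  (forall zeta, bdry D zeta -> exists z, z <> zeta /\ connected_component (~` D) zeta z) ->
  1 < q -> exponent_seq (q%:E)%E ps -> crossing D a b n -> spike D (q%:E)%E ps a b n.
Proof.
move=> oD bD HD q1 hps cr; have [v [vr vb] Hv] := crossing_touch oD cr.
have [cv nDv] := (bdry_open _ oD).1 vb.
have [c [cv' Hc]] := HD v vb.
have [k Hk] := dyadic_small (q / 2).
have k0 : (0 : R) < 2 ^+ k by rewrite exprn_gt0.
have [|f hf Hf] := @root_block R _ D c v 1 k (@component_connected _ (~` D) v) Hc
  (@connected_component_refl _ (~` D) v nDv) oD.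
  by move=> z Dz /connected_component_sub.
have al0 : 0 < 1%:R / 2 ^+ k :> R by rewrite divr_gt0.
have [M HM] := bD.
have cvp : 0 < cmod (c - v) by rewrite cmod_gt0 subr_eq0; apply/eqP.
apply: (@spike_of_unbounded R D _ ps oD hps a b n f).
  have L0 : 0 <= Num.max (M + cmod c) 0 by rewrite le_max lexx orbT.
  apply: (@ratio_OLlt R D _ oD bD _ v _ _ hf L0 (ltW al0) cv).
    move=> z Dz; rewrite Hf//; apply: ge0_ler_powR; rewrite ?nnegrE ?(ltW al0) ?divr_ge0 ?cmod_ge0//.
    rewrite ler_wpM2r ?invr_ge0 ?cmod_ge0// le_max; apply/orP; left.
    by apply: le_trans (cmodD _ _) _; rewrite cmodN lerD2r HM.
  move=> p p1; rewrite lte_fin => pq.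
  rewrite mulrC mulrA mulr1 ltr_pdivrMr//; lra.
move=> K; have c20 : 0 < cmod (c - v) / 2 by lra.
have [e e0 He] := ratio_big K c20 al0.
have m0 : 0 < Num.min e (cmod (c - v) / 2) by rewrite lt_min e0.
have [w wv Hw] := Hv _ m0; exists w => //.
have [_ Dw] := connected_component_sub Hw.
move: wv; rewrite lt_min => /andP[we wc].
rewrite Hf//; apply: He.
  by have := cmod_tri c v w; rewrite (cmodBC c w); lra.
rewrite we andbT cmod_gt0 subr_eq0; apply/eqP => wE; apply: nDv; by rewrite -wE.
Qed.

End first_two_parts.

(** * Smooth boundaries *)

Section cones.
Variable R : realType.
Implicit Types (z w v zeta : CC R) (D : set (CC R)) (rho : CC R -> R).

(** [dx] and [dy] differentiate at parameter 0 on a line through the point considered; this moves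
    the parameter, so that the mean value theorem applies along one fixed line. *)
Lemma line_is_derive rho (l : R -> CC R) z (t0 : R) :
  (forall s t : R, l (s + t) = l s + l t) -> l 0 = 0 ->
  derivable (fun t => rho (z + l t0 + l t)) 0 1 ->
  is_derive t0 1 (fun t => rho (z + l t)) (derive1 (fun t => rho (z + l t0 + l t)) 0).
Proof.
move=> lD l0 dG.
pose G t := rho (z + l t0 + l t); pose u t := rho (z + l t).
have E : (fun h : R => h^-1 *: ((u \o shift t0) (h *: (1 : R)) - u t0)) =
         (fun h : R => h^-1 *: ((G \o shift 0) (h *: (1 : R)) - G 0)).
  apply/funext => h; rewrite /u /G /= addr0 l0 addr0; congr (_ *: (rho _ - _)).
  by rewrite [h *: 1 + t0]addrC lD addrA.
apply: DeriveDef; first by rewrite /derivable E.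
by rewrite derive1E /derive E.
Qed.

Lemma mvt_estimate (u du : R -> R) (G eta h : R) :
  (forall t : R, `|t| <= `|h| -> is_derive t 1 u (du t) /\ `|du t - G| <= eta) ->
  `|u h - u 0 - G * h| <= eta * `|h|.
Proof.
move=> H.
have seg a b : a <= b -> (forall t, a <= t <= b -> `|t| <= `|h|) ->
    `|u b - u a - G * (b - a)| <= eta * (b - a).
  move=> ab Hab.
  have [||c cab E] := @MVT_segment R u du a b ab.
  - by move=> x; rewrite in_itv/= => /andP[? ?]; apply: (H x _).1; apply: Hab; lra.
  - apply: continuous_in_subspaceT => x; rewrite inE/= in_itv/= => xab.
    have [[dx _] _] := H x (Hab x xab).
    exact: differentiable_continuous ((derivable1_diffP _ _).1 dx).
  rewrite in_itv/= in cab.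
  rewrite E -mulrBl normrM (ger0_norm (_ : 0 <= b - a)) ?subr_ge0//.
  by rewrite ler_wpM2r ?subr_ge0//; exact: (H c (Hab c cab)).2.
have [h0|/ltW h0] := leP 0 h.
  have := seg 0 h h0; rewrite subr0 (ger0_norm h0); apply.
  by move=> t /andP[t0 th]; rewrite ger0_norm.
have := seg h 0 h0; rewrite sub0r (ler0_norm h0) => H'.
have -> : u h - u 0 - G * h = - (u 0 - u h - G * - h) by ring.
rewrite normrN; apply: H' => t /andP[th t0]; rewrite !ler0_norm ?lerN2//.
Qed.

Local Notation hl := (fun t : R => (t +i* 0)%C : CC R).
Local Notation vl := (fun t : R => (0 +i* t)%C : CC R).

(** Only partial derivatives are given, so [zeta + h] is reached by a vertical and then a horizontal
    segment, both within [cmod h] of [zeta]. Each contributes one [eta] by the mean value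
    theorem. *)
Lemma C1_expansion rho zeta (r eta : R) : 0 < r -> 0 < eta ->
  (forall z, disk zeta r z ->
       derivable (fun t : R => rho (z + (t +i* 0)%C)) 0 1 /\
       derivable (fun t : R => rho (z + (0 +i* t)%C)) 0 1 /\
       {for z, continuous (dx rho)} /\ {for z, continuous (dy rho)} /\
       (dx rho z != 0 \/ dy rho z != 0)) ->
  exists2 d : R, 0 < d <= r & forall h, cmod h < d ->
    `|rho (zeta + h) - rho zeta - (dx rho zeta * Re h + dy rho zeta * Im h)| <= 2 * eta * cmod h.
Proof.
move=> r0 eta0 H.
have [_ [_ [cx [cy _]]]] := H zeta (disk_center zeta r0).
have [d1 d10 H1] := (rcont_cmodP (dx rho) zeta).1 cx eta eta0.
have [d2 d20 H2] := (rcont_cmodP (dy rho) zeta).1 cy eta eta0.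
exists (Num.min r (Num.min d1 d2)); first by rewrite !lt_min r0 d10 d20 ge_min lexx.
move=> h; rewrite !lt_min => /and3P[hr h1 h2].
have hlD (s t : R) : hl (s + t) = hl s + hl t by apply: eqC; rewrite ReImE /= ?addr0.
have vlD (s t : R) : vl (s + t) = vl s + vl t by apply: eqC; rewrite ReImE /= ?addr0.
have hE : h = vl (Im h) + hl (Re h).
  by apply: eqC; rewrite ReImE /= ?addr0 ?add0r.
pose b := zeta + vl (Im h).
have near1 (t : R) : `|t| <= `|Re h| -> cmod (b + hl t - zeta) <= cmod h.
  move=> th; have -> : b + hl t - zeta = (t +i* Im h)%C.
    by rewrite /b; apply: eqC; rewrite !ReImE /=; ring.
  case: h th {hr h1 h2 hE b} => hx hy /= th; rewrite /cmod ler_sqrt ?addr_ge0 ?sqr_ge0//.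
  by rewrite lerD2r -[t ^+ 2]real_normK ?num_real// -[hx ^+ 2]real_normK ?num_real// lerXn2r ?nnegrE.
have near2 (t : R) : `|t| <= `|Im h| -> cmod (zeta + vl t - zeta) <= cmod h.
  move=> th; rewrite addrC addKr cmod_imag; apply: le_trans th _; exact: cmod_Im.
have e1 : `|rho (b + hl (Re h)) - rho (b + hl 0) - dx rho zeta * Re h| <= eta * `|Re h|.
  apply: (@mvt_estimate (fun t => rho (b + hl t)) (fun t => dx rho (b + hl t))).
  move=> t /near1 tn; have rz : disk zeta r (b + hl t) by exact: le_lt_trans hr.
  split; last by apply/ltW/H1; exact: le_lt_trans h1.
  exact: (@line_is_derive rho hl b t hlD erefl (H _ rz).1).
have e2 : `|rho (zeta + vl (Im h)) - rho (zeta + vl 0) - dy rho zeta * Im h| <= eta * `|Im h|.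
  apply: (@mvt_estimate (fun t => rho (zeta + vl t)) (fun t => dy rho (zeta + vl t))).
  move=> t /near2 tn; have rz : disk zeta r (zeta + vl t) by exact: le_lt_trans hr.
  split; last by apply/ltW/H2; exact: le_lt_trans h2.
  exact: (@line_is_derive rho vl zeta t vlD erefl (H _ rz).2.1).
have z1 : b + hl 0 = b by exact: addr0.
have z2 : zeta + vl 0 = zeta by exact: addr0.
have z3 : b + hl (Re h) = zeta + h by rewrite [in RHS]hE addrA.
rewrite z1 z3 in e1; rewrite z2 -/b in e2.
have hx := ler_wpM2l (ltW eta0) (cmod_Re h); have hy := ler_wpM2l (ltW eta0) (cmod_Im h).
have -> : rho (zeta + h) - rho zeta - (dx rho zeta * Re h + dy rho zeta * Im h) =
  (rho (zeta + h) - rho b - dx rho zeta * Re h) + (rho b - rho zeta - dy rho zeta * Im h) by ring.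
apply: le_trans (ler_normD _ _) _; lra.
Qed.

(* [nu] is the unit outer normal: near [v] the set contains an open cone
   about [- nu] and avoids one about [nu]. *)
Lemma C1_cones D v : open D -> C1_boundary D -> bdry D v ->
  exists nu, cmod nu = 1 /\ exists2 s0 : R, 0 < s0 & forall (s : R) z, 0 < s <= s0 ->
    (cmod (z - (v + (s%:C)%C * nu)) < s / 2 -> ~ D z) /\
    (cmod (z - (v - (s%:C)%C * nu)) < s / 2 -> D z).
Proof.
move=> oD HC vb; have [cv nDv] := (bdry_open _ oD).1 vb.
have [r [r0 [rho [Hrho H]]]] := HC v vb.
have [_ [_ [_ [_ nz]]]] := H v (disk_center v r0).
pose N : CC R := toC (dx rho v, dy rho v); pose G := cmod N.
have G0 : 0 < G.
  rewrite /G cmod_gt0; apply/eqP => /(f_equal (fun z : CC R => (Re z, Im z))) /= [e1 e2].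
  by case: nz; rewrite ?e1 ?e2 eqxx.
have G2 : G ^+ 2 = dx rho v ^+ 2 + dy rho v ^+ 2.
  by rewrite /G /cmod /N /= sqr_sqrtr// addr_ge0 ?sqr_ge0.
have lin h : `|dx rho v * Re h + dy rho v * Im h| <= G * cmod h.
  pose N' : CC R := toC (dx rho v, - dy rho v).
  have -> : dx rho v * Re h + dy rho v * Im h = Re (N' * h) by rewrite ReM /=; ring.
  apply: le_trans (cmod_Re _) _; rewrite cmodM ler_wpM2r ?cmod_ge0//.
  by rewrite /G /cmod /= sqrrN.
(* Not part of [C1_boundary]: [rho v] is nonnegative as [v] is outside [D], and a positive value
   would persist near [v], against [v] being adherent to [D]. *)
have rv : rho v = 0.
  apply/eqP; rewrite eq_le; apply/andP; split; last first.
    by rewrite leNgt; apply/negP => h; apply: nDv; apply/(Hrho v (disk_center v r0)).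
  rewrite leNgt; apply/negP => rv0.
  have [d /andP[d0 dr] Hd] := C1_expansion r0 ltr01 H.
  have c0 : 0 < G + 2 by lra.
  have m0 : 0 < Num.min d (rho v / (G + 2)) by rewrite lt_min d0 divr_gt0.
  have [w Dw] := (closure_cmodP D v).1 cv _ m0.
  rewrite lt_min ltr_pdivlMr// => /andP[wd wr].
  have /(Hrho w) : disk v r w by exact: lt_le_trans wd dr.
  move=> /(fun h => h.1 Dw) rw.
  have := Hd (w - v) wd; rewrite (addrC v) subrK.
  have := lin (w - v); rewrite !ler_norml; lra.
(* At distance below [3 / 2 * s] from [v] the expansion error is at most [s * G / 4]. The deviation
   from the normal adds at most [s * G / 2], and the sum stays below the main term [s * G]. *)
have eta0 : 0 < G / 12 by lra.
have [d /andP[d0 dr] Hd] := C1_expansion r0 eta0 H.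
pose nu : CC R := ((G^-1)%:C)%C * N.
have nu1 : cmod nu = 1.
  by rewrite cmodM cmod_real ger0_norm ?invr_ge0 ?(ltW G0)// mulVf ?gt_eqF.
exists nu; split => //; exists (d / 2); first by lra.
move=> s z /andP[s0 sd].
have dir (t : R) : dx rho v * Re ((t%:C)%C * nu) + dy rho v * Im ((t%:C)%C * nu) = t * G.
  rewrite /nu !ReImE /= !mul0r !subr0 !addr0.
  have -> : dx rho v * (t * (G^-1 * dx rho v)) + dy rho v * (t * (G^-1 * dy rho v)) =
    t * G^-1 * (dx rho v ^+ 2 + dy rho v ^+ 2) by ring.
  by rewrite -G2; field; rewrite gt_eqF.
have main (t : R) : `|t| = s -> cmod (z - (v + (t%:C)%C * nu)) < s / 2 ->
    disk v r z /\ `|rho z - t * G| <= 3 / 4 * (s * G).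
  move=> ts zt; set k := z - (v + (t%:C)%C * nu) in zt.
  have zE : z = v + ((t%:C)%C * nu + k) by rewrite /k; ring.
  have hn : cmod ((t%:C)%C * nu + k) < 3 / 2 * s.
    by apply: le_lt_trans (cmodD _ _) _; rewrite cmodM cmod_real nu1 ts; lra.
  have hd : cmod ((t%:C)%C * nu + k) < d by lra.
  split; first by rewrite /disk/= zE (addrC v) addrK; lra.
  have Gk : G * cmod k <= G * (s / 2) by rewrite ler_wpM2l ?ltW.
  have Gn : 2 * (G / 12) * cmod ((t%:C)%C * nu + k) <= 2 * (G / 12) * (3 / 2 * s).
    by rewrite ler_wpM2l ?(ltW hn)//; lra.
  have := le_trans (Hd _ hd) Gn; rewrite -zE rv subr0 ReD ImD.
  have := le_trans (lin k) Gk; have := dir t.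
  move: (Re ((t%:C)%C * nu)) (Im ((t%:C)%C * nu)) (Re k) (Im k) (dx rho v) (dy rho v) => x1 y1 x2 y2 A B.
  have -> : A * (x1 + x2) + B * (y1 + y2) = (A * x1 + B * y1) + (A * x2 + B * y2) by ring.
  move=> ->; move: (A * x2 + B * y2) (rho z) => u x; rewrite !ler_norml.
  have -> : G * (s / 2) = s * G / 2 by ring.
  have -> : 2 * (G / 12) * (3 / 2 * s) = s * G / 4 by field.
  move: (s * G) (t * G) => sG tG; lra.
split=> hz.
  have [|zr] := main s _ hz; first by rewrite ger0_norm ?ltW.
  move=> Hs /(Hrho z zr) rz; move: Hs; rewrite ler_norml; have := mulr_gt0 s0 G0; lra.
have [||zr] := main (- s).
- by rewrite normrN ger0_norm ?ltW.
- by rewrite rmorphN mulNr.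
move=> Hs; apply/(Hrho z zr); move: Hs; rewrite ler_norml; have := mulr_gt0 s0 G0; lra.
Qed.

End cones.

(** * Functions with a pole on the outer normal *)

Section third_part.
Variable R : realType.
Variables (D : set (CC R)) (q : \bar R) (ps : nat -> R).
Hypotheses (oD : open D) (bD : bounded_C D) (hps : exponent_seq q ps).
Variables (v nu : CC R) (s0 : R).
Hypotheses (cv : closure D v) (nu1 : cmod nu = 1) (s00 : 0 < s0).
Hypothesis cones : forall (s : R) z, 0 < s <= s0 ->
    (cmod (z - (v + (s%:C)%C * nu)) < s / 2 -> ~ D z) /\
    (cmod (z - (v - (s%:C)%C * nu)) < s / 2 -> D z).
Implicit Types (z w : CC R) (s t e : R).

Local Notation out s := (v + (s%:C)%C * nu).

Lemma out_notin s : 0 < s <= s0 -> ~ D (out s).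
Proof.
move=> hs; apply: (cones (out s) hs).1; rewrite subrr cmod0.
by case/andP: hs => ? _; rewrite divr_gt0.
Qed.

Lemma out_v s : 0 <= s -> cmod (out s - v) = s.
Proof. by move=> s1; rewrite addrC addKr cmodM cmod_real nu1 mulr1 ger0_norm. Qed.

Lemma ray_out s s' (u : R) : ray (out s) (out s') u = out (s + u * (s' - s)).
Proof. by rewrite /ray realC_D realC_M realC_B; ring. Qed.

(* [((z - out s0) / (z - out s)) ^ al], with a single-valued branch because
   the segment of the outer normal from [out s] to [out s0] misses [D]. *)
Lemma normal_family J e (m k : nat) : 0 < e -> (0 < m)%N ->
  (forall j, (j < J)%N -> m%:R / 2 ^+ k * ps j < 2) ->
  exists2 t : R, 0 < t & forall s, 0 < s <= s0 -> exists h, [/\ OLlt D q h, nsmall D ps J e h &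
    forall z, D z -> cmod (h z) = t * (cmod (z - out s0) / cmod (z - out s)) `^ (m%:R / 2 ^+ k)].
Proof.
move=> e0 m0 Hal; have s0p := s00; set al : R := m%:R / 2 ^+ k in Hal *.
have al0 : 0 < al by rewrite divr_gt0 ?ltr0n.
have [M HM M1] : exists2 M, (forall z, D z -> cmod z <= M) & 1 <= M.
  have [M0 HM0] := bD; exists (Num.max M0 1); last by rewrite le_max lexx orbT.
  by move=> z /HM0 h; rewrite le_max h.
have vM := closure_bound HM cv.
pose B := M + s0.
have outB s : 0 < s <= s0 -> cmod (out s) <= B.
  move=> /andP[s1 s2]; apply: le_trans (cmodD _ _) _.
  by rewrite cmodM cmod_real nu1 mulr1 ger0_norm ?(ltW s1)// lerD.
pose L := M + B.
have L0 : 0 < L by rewrite /L /B; lra.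
have zL z s : D z -> 0 < s <= s0 -> cmod (z - out s) <= L.
  by move=> Dz hs; apply: le_trans (cmodD _ _) _; rewrite cmodN lerD ?HM ?outB.
(* The constants of [singular_bound] are uniform in the pole [b], so the scaling [t] can be fixed
   before [s]. *)
have /choice[C HC] j : exists C, (j < J)%N -> 0 <= C /\ forall b, D `<=` square b L ->
    (pint D (- (al * ps j))%R (fun z => (z - b)%R) <= C%:E)%E.
  have [jJ|_] := boolP (j < J)%N; last by exists 0.
  have p0 : 0 <= al * ps j < 2.
    rewrite Hal// andbT mulr_ge0 ?(ltW al0)//.
    by have := ps_lt1 hps j; lra.
  have [C C0 HC] := singular_bound p0 L0.
  by exists C => _; split => // b; exact: HC.
pose K j := L `^ (al * ps j) * C j.
pose N j := K j `^ (ps j)^-1.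
have N0 j : 0 <= N j by exact: powR_ge0.
have [t t0 Ht] := scale_small J e0 N0.
exists t => // s hs.
have [s1 s2] := andP hs.
have hs0 : 0 < s0 <= s0 by rewrite s00 lexx.
pose A := ray (out s) (out s0) @` `[0, 1].
have Aa : A (out s0) by exists 1; rewrite /= ?in_itv/= ?lexx ?ler01// ray1.
have Ab : A (out s) by exists 0; rewrite /= ?in_itv/= ?lexx ?ler01// ray0.
have DA z : D z -> ~ A z.
  move=> Dz [u]; rewrite /= in_itv/= => /andP[u0 u1] E; move: Dz; rewrite -E ray_out.
  apply: out_notin; have d0 : 0 <= s0 - s by rewrite subr_ge0.
  have := mulr_ge0 u0 d0; have : u * (s0 - s) <= 1 * (s0 - s) by rewrite ler_wpM2r.
  by move=> ? ?; apply/andP; split; lra.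
have [f hf Hf] := root_block m k (@ray_connected R (out s) (out s0) 0 1) Aa Ab oD DA.
have far z : D z -> s / 2 <= cmod (z - out s).
  by move=> Dz; rewrite leNgt; apply/negP => h; exact: (cones z hs).1 h Dz.
have fL z : D z -> cmod (f z) <= (L / cmod (z - out s)) `^ al.
  move=> Dz; rewrite Hf//; apply: ge0_ler_powR; rewrite ?nnegrE ?(ltW al0) ?divr_ge0 ?cmod_ge0 ?(ltW L0)//.
  by rewrite ler_wpM2r ?invr_ge0 ?cmod_ge0// zL.
exists (fun z => (t%:C)%C * f z); split.
(* The exterior cone keeps [D] at distance at least [s / 2] from the pole, so for fixed [s] the
   function is bounded and belongs to the space whatever the exponent. *)
- apply: OLltZ => //; apply: (@OLlt_bounded R D q oD bD f ((L / (s / 2)) `^ al) hf) => z Dz.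
  apply: le_trans (fL z Dz) _.
  apply: ge0_ler_powR; rewrite ?nnegrE ?(ltW al0) ?divr_ge0 ?cmod_ge0 ?(ltW L0)//; first by lra.
  rewrite ler_pM2l// lef_pV2 ?posrE; [exact: far|apply: lt_le_trans (far z Dz); lra|lra].
- apply: (nsmall_scale oD hps hf t0 _ Ht) => j jJ; split; first exact: N0.
  have [C0 HCj] := HC j jJ.
  have pj0 : 0 < ps j by have := ps_lt1 hps j; lra.
  have -> : N j `^ ps j = K j.
    by rewrite /N -powRrM mulVf ?gt_eqF// powRr1// /K mulr_ge0 ?powR_ge0.
  apply: (pint_ratio oD hf (ltW L0) (ltW al0) (ltW pj0) fL).
  by apply: HCj; exact: bounded_square HM (outB s hs).
- by move=> z Dz; rewrite cmodM cmod_real ger0_norm ?(ltW t0)// Hf.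
Qed.

(** As [q] may be infinite, the exponent [1 / 2 ^+ k] is chosen after [J], from the bound on [ps J]
    alone. *)
Lemma spike_normal (a b : rat) n :
  (forall e : R, 0 < e -> exists2 w, cmod (w - v) < e &
    connected_component (disk (rpt R a b) (irad R n) `&` D) (rpt R a b) w) ->
  spike D q ps a b n.
Proof.
move=> Hv J e M e0; have s0p := s00.
have [k Hk] := dyadic_small (ps J / 2).
have k0 : (0 : R) < 2 ^+ k by rewrite exprn_gt0.
have Hal j : (j < J)%N -> 1%:R / 2 ^+ k * ps j < 2.
  move=> jJ; rewrite mulrAC ltr_pdivrMr// mul1r.
  have := ps_mono hps (ltnW jJ); lra.
have [t t0 Ht] := normal_family e0 (ltn0Sn 0) Hal.
have al0 : 0 < 1%:R / 2 ^+ k :> R by rewrite divr_gt0.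
have c0 : 0 < s0 / 2 by lra.
have [e' e'0 He'] := ratio_big (M / t) c0 al0.
(* With [w] within [e' / 2] and the pole within [e' / 4] of [v], their distance is below [e'];
   [s0 / 2] keeps [w] at least that far from the zero [out s0]. *)
have m0 : 0 < Num.min (e' / 2) (s0 / 2) by rewrite lt_min; apply/andP; split; lra.
have [w wv Hw] := Hv _ m0.
have [_ Dw] := connected_component_sub Hw.
pose s := Num.min s0 (e' / 4).
have hs : 0 < s <= s0 by rewrite ge_min lexx lt_min s00 andbT /=; lra.
have se : s <= e' / 4 by rewrite ge_min lexx orbT.
have [h [Oh hn Eh]] := Ht s hs.
exists h; split => //; exists w => //; rewrite Eh// mulrC -ltr_pdivrMr//.
have [s1 s2] := andP hs.
move: wv; rewrite lt_min => /andP[w1 w2].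
apply: He'.
  have := cmod_tri (out s0) v w; rewrite (out_v (ltW s00)) (cmodBC (out s0) w); lra.
apply/andP; split.
  rewrite cmod_gt0 subr_eq0; apply/eqP => E; apply: (out_notin hs); by rewrite -E.
have := cmod_tri w (out s) v; rewrite (cmodBC v) (out_v (ltW s1)); lra.
Qed.

(** Half-side [tau / 8] means distance at most [tau / 4] from the centre, inside the disc of radius
    [tau / 2] contained in [D]; the centre itself is at distance [tau] from [v]. *)
Lemma inner_square (tau : R) z : 0 < tau <= s0 -> square (v - (tau%:C)%C * nu) (tau / 8) z ->
  D z /\ 3 / 4 * tau <= cmod (z - v) <= 5 / 4 * tau.
Proof.
move=> ht /squareP[h1 h2]; have [t0 t1] := andP ht.
have zc : cmod (z - (v - (tau%:C)%C * nu)) <= tau / 4.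
  by apply: le_trans (cmod_ReIm _) _; rewrite ReD ImD ReN ImN; lra.
split; first by apply: (cones z ht).2; lra.
have vc : cmod (v - (v - (tau%:C)%C * nu)) = tau.
  by rewrite subKr cmodM cmod_real nu1 mulr1 ger0_norm// ltW.
have := cmod_tri z v (v - (tau%:C)%C * nu); rewrite [cmod (v - (tau%:C)%C * nu - v)]cmodBC vc.
have := cmod_tri v (v - (tau%:C)%C * nu) z; rewrite vc (cmodBC v z); lra.
Qed.

(* Dyadic squares in the inner cone, each contributing the same amount. *)
Lemma heavy_normal (r : R) (a b : rat) n : q = (r%:E)%E -> 1 < r ->
  disk (rpt R a b) (irad R n) v -> heavy D q ps r a b n.
Proof.
move=> qr r1 vr J e M e0; have s0p := s00.
have Pr : ps J < r by have := ps_ltq hps J; rewrite qr lte_fin.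
clear qr.
have P1 := ps_lt1 hps J.
have gap : 0 < 2 / ps J - 2 / r.
  by rewrite subr_gt0 ltr_pM2l// ltf_pV2 ?posrE; lra.
(* The step [1 / 2 ^+ k] is finer than the interval from [2 / r] to [2 / ps J], so the least
   multiple above [2 / r] falls inside: the r-th power is not integrable at the limiting pole, the
   [ps J]-th is. *)
have [k Hk] := dyadic_small (2 / ps J - 2 / r)^-1.
have k0 : (0 : R) < 2 ^+ k by rewrite exprn_gt0.
have [m [m0 mr mP]] : exists m : nat, [/\ (0 < m)%N, 2 <= m%:R / 2 ^+ k * r & m%:R / 2 ^+ k * ps J < 2].
  have ex : exists m : nat, 2 / r * 2 ^+ k <= m%:R.
    exists (Num.bound (2 / r * 2 ^+ k)); apply: ltW; apply: archi_boundP.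
    by rewrite mulr_ge0 ?divr_ge0 ?(ltW k0)//; lra.
  have [m Hm minm] := ex_minnP ex.
  have m0 : (0 < m)%N.
    rewrite lt0n; apply/eqP => E; move: Hm; rewrite E leNgt mulr_gt0 ?divr_gt0//; lra.
  exists m; split => //.
    have r0 : 0 < r by lra.
    by rewrite mulrAC ler_pdivlMr// -ler_pdivrMr// mulrAC.
  have lt1 : m.-1%:R < 2 / r * 2 ^+ k.
    rewrite ltNge; apply/negP => /minm; case: (m) m0 => //= m' _; by rewrite ltnn.
  have mE : m%:R = m.-1%:R + 1 :> R by rewrite natr1 prednK.
  have g1 : 1 < (2 / ps J - 2 / r) * 2 ^+ k by rewrite mulrC -ltr_pdivrMr// mul1r.
  have p0 : 0 < ps J by lra.
  rewrite mulrAC ltr_pdivrMr// -ltr_pdivlMr// mE mulrAC.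
  by apply: (@lt_le_trans _ _ (2 / r * 2 ^+ k + 1)); [rewrite ltrD2r|move: g1; rewrite mulrBl; lra].
have Hal j : (j < J)%N -> m%:R / 2 ^+ k * ps j < 2.
  move=> jJ; apply: le_lt_trans mP; rewrite ler_wpM2l ?divr_ge0 ?(ltW k0)//.
  exact: (ps_mono hps (ltnW jJ)).
have [t t0 Ht] := normal_family e0 m0 Hal.
set al : R := m%:R / 2 ^+ k in mr mP Hal Ht *.
have al0 : 0 <= al by rewrite divr_ge0 ?(ltW k0).
have [d d0 dE] := (open_cmodP _).1 (@disk_open R (rpt R a b) (irad R n)) v vr.
(* Small enough for the squares to lie in the disc of the crossing, to stay at distance at least
   [s0 / 2] from [out s0], and to make the ratio of distances at least 1. *)
pose t00 := Num.min (s0 / 12) (d / 2).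
have t000 : 0 < t00 by rewrite lt_min; apply/andP; split; lra.
have [t0s t0d] : t00 <= s0 / 12 /\ t00 <= d / 2 by rewrite !ge_min !lexx orbT.
pose tau i : R := t00 / 2 ^+ i.
have tau0 i : 0 < tau i by rewrite divr_gt0 ?exprn_gt0.
have tauS i : tau i.+1 = tau i / 2 by rewrite /tau exprS; field; rewrite expf_neq0.
have taun i j : (i <= j)%N -> tau j <= tau i.
  move=> ij; rewrite ler_pM2l// lef_pV2 ?posrE ?exprn_gt0//.
  by rewrite ler_eXn2l// ltr1n.
have tau_t0 i : tau i <= t00 by have := taun 0%N i (leq0n i); rewrite {2}/tau expr0 divr1.
have tau_s0 i : 0 < tau i <= s0 by rewrite tau0/=; have := tau_t0 i; lra.
(* The squared lower bound [2 * s0 / (9 * tau i)] on the ratio, times the area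
   [4 * (tau i / 8) ^+ 2]: the scale cancels and leaves 324. *)
pose kap := t `^ r * (s0 ^+ 2 / 324).
have kap0 : 0 < kap.
  by apply: mulr_gt0; [exact: powR_gt0|apply: divr_gt0; [exact: exprn_gt0|rewrite ltr0n]].
have [K HK] : exists K : nat, M < K%:R * kap.
  exists (Num.bound (Num.max M 0 / kap)); rewrite -ltr_pdivrMr//.
  apply: (@le_lt_trans _ _ (Num.max M 0 / kap)).
    by rewrite ler_pM2r ?invr_gt0// le_max lexx.
  by apply: archi_boundP; rewrite divr_ge0 ?(ltW kap0)// le_max lexx orbT.
(* With the pole at height [tau K], each of the [K] larger squares is within [9 / 4 * tau i] of
   it. *)
have [h [Oh hn Eh]] := Ht (tau K) (tau_s0 K).
exists h; split => //.
set E := disk (rpt R a b) (irad R n) `&` D.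
have oE : open E by apply: openI => //; exact: disk_open.
have hE : holomorphic_on E h by move=> z [_ Dz]; have [H _] := Oh; exact: H.
have mE := measurable_toP oE.
pose S i := toP (square (v - ((tau i)%:C)%C * nu) (tau i / 8)).
have mS i : measurable (S i) by exact: measurable_square.
have SE i : S i `<=` toP E.
  move=> xy /(inner_square (tau_s0 i))[Dz /andP[_ zv]]; split => //.
  by apply: dE; rewrite /disk/=; have := tau_t0 i; lra.
have triv : trivIset [set` iota 0 K] S.
  (* The distances to [v] separate the squares: [5 / 4] of the next scale is [5 / 8] of the present
     one, below [3 / 4]. *)
  have disj i j : (i < j)%N -> S i `&` S j = set0.
    move=> ij; rewrite -subset0 => xy [].
    move=> /(inner_square (tau_s0 i))[_ /andP[h1 _]] /(inner_square (tau_s0 j))[_ /andP[_ h2]].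
    have := taun _ _ ij; rewrite tauS; have := tau0 i; lra.
  apply/trivIsetP => i j _ _; rewrite neq_ltn => /orP[|] /disj //.
  by rewrite setIC.
pose F xy : \bar R := ((cmod (h (toC xy))) `^ r)%:E.
have mF : measurable_fun (toP E) F by exact: (measurable_pow r oE hE).
have mU : measurable (\big[setU/set0]_(i <- iota 0 K) S i) by apply: bigsetU_measurable => i _.
have UE : \big[setU/set0]_(i <- iota 0 K) S i `<=` toP E.
  by rewrite -bigcup_seq => xy [i _]; exact: SE.
rewrite /pint -/(toP E) -/F.
apply: (@lt_le_trans _ _ (\int[@leb2 R]_(xy in \big[setU/set0]_(i <- iota 0 K) S i) F xy)%E); last first.
  by apply: ge0_subset_integral => // xy _; rewrite lee_fin powR_ge0.
rewrite ge0_integral_bigsetU//; first last.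
- by move=> xy _; rewrite lee_fin powR_ge0.
- by apply: measurable_funS mF.
- exact: iota_uniq.
apply: (@lt_le_trans _ _ (\sum_(i <- iota 0 K) kap%:E)%E).
  rewrite sumEFin lte_fin big_const_seq count_predT size_iota iter_addr_0.
  by rewrite -mulr_natl.
rewrite big_seq [leRHS]big_seq; apply: lee_sum => i; rewrite mem_iota add0n => /andP[_ iK].
have mFS : measurable_fun (S i) F by apply: measurable_funS mF.
pose c := t `^ r * (2 * s0 / (9 * tau i)) ^+ 2.
suff H : (kap%:E <= \int[@leb2 R]_(xy in S i) F xy)%E by exact: H.
apply: (@le_trans _ _ (\int[@leb2 R]_(xy in S i) c%:E)%E).
  have t8 : 0 <= tau i / 8 by have := tau0 i; lra.
  rewrite integral_cst; last exact: mS.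
  rewrite [X in (_ * X)%E](leb2_square (v - ((tau i)%:C)%C * nu) t8).
  rewrite -EFinM lee_fin le_eqVlt; apply/orP; left; apply/eqP.
  by rewrite /c /kap; field; rewrite gt_eqF.
apply: ge0_le_integral; [exact: mS| |exact: measurable_cst|exact: mFS|].
  by move=> xy _; rewrite lee_fin mulr_ge0 ?powR_ge0 ?sqr_ge0.
move=> xy Sxy; rewrite lee_fin.
have [Dz /andP[z1 z2]] := inner_square (tau_s0 i) Sxy.
rewrite Eh// powRM ?powR_ge0 ?(ltW t0)// /c ler_wpM2l ?powR_ge0//.
set z : CC R := toC xy in Dz z1 z2 *.
have ti := tau0 i; have tis := tau_t0 i; have tK := taun i K (ltnW iK); have tK0 := tau0 K.
have za : s0 / 2 <= cmod (z - out s0).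
  have := cmod_tri (out s0) v z; rewrite (out_v (ltW s00)) (cmodBC (out s0) z); lra.
have zb : cmod (z - out (tau K)) <= 9 / 4 * tau i.
  have := cmod_tri z (out (tau K)) v; rewrite (cmodBC v) (out_v (ltW tK0)); lra.
have zb0 : 0 < cmod (z - out (tau K)).
  by rewrite cmod_gt0 subr_eq0; apply/eqP => zE; apply: (out_notin (tau_s0 K)); rewrite -zE.
have rho1 : 2 * s0 / (9 * tau i) <= cmod (z - out s0) / cmod (z - out (tau K)).
  have -> : 2 * s0 / (9 * tau i) = (s0 / 2) / (9 / 4 * tau i) by field; lra.
  apply: ler_pM => //; [lra|rewrite invr_ge0; lra|].
  by rewrite lef_pV2 ?posrE; [|lra|].
have one : 1 <= 2 * s0 / (9 * tau i) by rewrite ler_pdivlMr; lra.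
rewrite -powRrM.
(* The exponent [al * r] is at least 2 and the ratio at least 1, so the square is a lower bound. *)
apply: (@le_trans _ _ ((cmod (z - out s0) / cmod (z - out (tau K))) ^+ 2)).
  by rewrite lerXn2r ?nnegrE ?divr_ge0 ?cmod_ge0//; lra.
rewrite -powR_mulrn ?divr_ge0 ?cmod_ge0// ler_powR//.
exact: le_trans rho1.
Qed.

End third_part.

(** * The generic set of (iii) *)

Section third_part_conclusion.
Variable R : realType.
Variables (D : set (CC R)) (q : \bar R) (ps : nat -> R).
Hypotheses (oD : open D) (bD : bounded_C D) (hps : exponent_seq q ps).
Implicit Types (f g : CC R -> CC R) (zeta : CC R) (r eps : R).

Lemma C1_spike a b n : C1_boundary D -> crossing D a b n -> spike D q ps a b n.
Proof.
move=> C1 cr; have [v [vr vb] Hv] := crossing_touch oD cr.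
have [nu [nu1 [s0 s00 cones]]] := C1_cones oD C1 vb.
have [cv _] := (bdry_open _ oD).1 vb.
exact: (@spike_normal R D q ps oD bD hps v nu s0 cv nu1 s00 cones a b n Hv).
Qed.

Lemma C1_heavy r a b n : q = (r%:E)%E -> 1 < r -> C1_boundary D -> crossing D a b n ->
  heavy D q ps r a b n.
Proof.
move=> qr r1 C1 cr; have [v [vr vb] Hv] := crossing_touch oD cr.
have [nu [nu1 [s0 s00 cones]]] := C1_cones oD C1 vb.
have [cv _] := (bdry_open _ oD).1 vb.
exact: (@heavy_normal R D q ps oD bD hps v nu s0 cv nu1 s00 cones r a b n qr r1 vr).
Qed.

Lemma tu_not_bounded f zeta eps : totally_unbounded D f -> bdry D zeta -> 0 < eps ->
  ~ OL (disk zeta eps `&` D) (+oo)%E f.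
Proof.
move=> tu zb e0 [_ [M HM]]; have [cz _] := (bdry_open _ oD).1 zb.
have [w Dw wz] := (@closure_cmodP R D zeta).1 cz eps e0.
have [|z [Ez Mz]] := tu zeta zb eps e0 (connected_component (disk zeta eps `&` D) w) _ M.
  by exists w.
by have := HM z (connected_component_sub Ez); rewrite leNgt Mz.
Qed.

Lemma lq_crossing r f a b n : holomorphic_on D f ->
  (forall zeta, bdry D zeta -> forall eps, 0 < eps -> ~ OL (disk zeta eps `&` D) (r%:E)%E f) ->
  crossing D a b n -> lq_at D r f a b n.
Proof.
move=> hf H cr; have [v [vr vb] _] := crossing_touch oD cr.
have oE : open (disk (rpt R a b) (irad R n) `&` D) by apply: openI => //; exact: disk_open.
have hE : holomorphic_on (disk (rpt R a b) (irad R n) `&` D) f by move=> z [_ Dz]; exact: hf.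
have [d d0 dE] := (open_cmodP _).1 (@disk_open R (rpt R a b) (irad R n)) v vr.
rewrite /lq_at ltNge; apply/negP => le_n; apply: (H v vb d d0); split.
  by move=> z [_ Dz]; exact: hf.
apply: le_lt_trans (ltry n%:R); apply: le_trans le_n.
apply: (pint_subset r (openI (@disk_open _ _ _) oD) oE _ hE).
by move=> z [/dE ? ?]; split.
Qed.

(** A finite integral near [zeta] is at most some [N]. A crossing with [n >= N] and centre close to
    [zeta] has its disc inside [disk zeta eps] and contradicts this bound. *)
Lemma crossing_not_OL r f zeta eps : holomorphic_on D f ->
  (forall a b n, crossing D a b n -> lq_at D r f a b n) -> bdry D zeta -> 0 < eps ->
  ~ OL (disk zeta eps `&` D) (r%:E)%E f.
Proof.
move=> hf H zb e0 [_ fin]; have [cz nDz] := (bdry_open _ oD).1 zb.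
have oE : open (disk zeta eps `&` D) by apply: openI => //; exact: disk_open.
have hE : holomorphic_on (disk zeta eps `&` D) f by move=> z [_ Dz]; exact: hf.
have [N HN] : exists N : nat, (pint (disk zeta eps `&` D) r f <= N%:R%:E)%E.
  have P0 : (0 <= pint (disk zeta eps `&` D) r f)%E.
    by apply: integral_ge0 => xy _; rewrite lee_fin powR_ge0.
  move: P0 fin; case: pint => [x| |] // x0 _.
  by exists (Num.bound x); rewrite lee_fin ltW// archi_boundP.
have e20 : 0 < eps / 2 by lra.
have [n Nn ne] := irad_small N e20.
have n0 := irad_gt0 R n.
have [w Dw wz] := (@closure_cmodP R D zeta).1 cz _ n0.
have oI : open (disk zeta (irad R n) `&` D) by apply: openI => //; exact: disk_open.
have [d d0 dI] := (open_cmodP _).1 oI w (conj wz Dw).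
have [a [b ab]] := rpt_dense w d0.
have [xz Dx] := dI _ ab.
have cr : crossing D a b n.
  split => // /(_ zeta); rewrite /disk /= cmodBC => /(_ xz); exact: nDz.
have := H a b n cr; rewrite /lq_at ltNge => /negP; apply.
apply: (@le_trans _ _ (N%:R%:E)%E); last by rewrite lee_fin ler_nat.
apply: le_trans HN; apply: (pint_subset r (openI (@disk_open _ _ _) oD) oE _ hE).
move=> z [zr Dz]; split => //; move: zr xz; rewrite /disk /=.
have := cmod_tri z zeta (rpt R a b); have := ne; clear; lra.
Qed.

Lemma lq_tu_dense_Gdelta r : q = (r%:E)%E -> 1 < r -> C1_boundary D ->
  let S := [set g | OLlt D q g /\ totally_unbounded D g /\
     forall zeta, bdry D zeta -> forall eps, 0 < eps -> ~ OL (disk zeta eps `&` D) (r%:E)%E g] in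
  OL_dense D q ps S /\ OL_Gdelta D q ps S.
Proof.
move=> qr r1 C1 S; have r0 : 0 < r by lra.
(* The boolean merges the two countable families into one: [true] for unboundedness, [false] for the
   integral. *)
apply: (@dense_Gdelta R D q ps oD bD hps (bool * (rat * rat * nat))%type
  (fun t => let: (u, (a, b, n)) := t in
     if u then [set f | crossing D a b n -> tu_at f D a b n]
     else [set f | crossing D a b n -> lq_at D r f a b n])).
- by move=> [[] [[a b] n]]; [exact: (tu_open oD hps)|exact: (lq_open oD hps)].
- move=> [[] [[a b] n]].
    by apply: (tu_dense oD hps) => cr; exact: (C1_spike C1 cr).
  by apply: (lq_dense oD hps r0) => cr; exact: (C1_heavy qr r1 C1 cr).
- apply/seteqP; split => f.
    move=> [Of [tu nOL]]; split; first exact: Of.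
    move=> [[] [[a b] n]] cr; first exact: (tu_crossing oD tu cr).
    by have [hf _] := Of; exact: (lq_crossing hf nOL cr).
  move=> [Of H]; have [hf _] := Of; split; first exact: Of.
  split; first by apply: (crossing_tu oD) => a b n; exact: (H (true, (a, b, n))).
  move=> zeta zb eps e0; apply: (crossing_not_OL hf _ zb e0) => a b n.
  exact: (H (false, (a, b, n))).
Qed.

End third_part_conclusion.

Theorem theorem10 (R : realType) :
  (* (i) arbitrary bounded open set, q = 2 *)
  (forall (Omega : set (CC R)) (ps : nat -> R),
     open Omega -> bounded_C Omega -> exponent_seq (2%:E)%E ps ->
     let S := [set g | OLlt Omega (2%:E)%E g /\ totally_unbounded Omega g] in
     OL_dense Omega (2%:E)%E ps S /\ OL_Gdelta Omega (2%:E)%E ps S) /\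
  (* (ii) complement components at boundary points are not singletons, 1 < q < oo *)
  (forall (Omega : set (CC R)) (q : R) (ps : nat -> R),
     open Omega -> bounded_C Omega ->
     (forall zeta, bdry Omega zeta ->
        exists z, z <> zeta /\ connected_component (~` Omega) zeta z) ->
     1 < q -> exponent_seq (q%:E)%E ps ->
     let S := [set g | OLlt Omega (q%:E)%E g /\ totally_unbounded Omega g] in
     OL_dense Omega (q%:E)%E ps S /\ OL_Gdelta Omega (q%:E)%E ps S) /\
  (* (iii) C^1 boundary, 1 < q <= oo *)
  (forall (Omega : set (CC R)) (q : \bar R) (ps : nat -> R),
     open Omega -> bounded_C Omega -> C1_boundary Omega ->
     (1 < q)%E -> exponent_seq q ps ->
     let S := [set g | OLlt Omega q g /\ totally_unbounded Omega g /\
                 forall zeta, bdry Omega zeta -> forall eps : R, 0 < eps ->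
                   ~ OL (disk zeta eps `&` Omega) q g] in
     OL_dense Omega q ps S /\ OL_Gdelta Omega q ps S).
Proof.
split; last split.
- move=> D ps oD bD hps; apply: (tu_dense_Gdelta oD bD hps) => a b n.
  exact: (spike_inverse oD bD hps).
- move=> D q ps oD bD HD q1 hps; apply: (tu_dense_Gdelta oD bD hps) => a b n.
  exact: (spike_root oD bD HD q1 hps).
- move=> D [r| |] ps oD bD C1 q1 hps S.
  + by apply: (lq_tu_dense_Gdelta oD bD hps erefl _ C1); rewrite -lte_fin.
  (* For [q = +oo] the local condition says that [g] is unbounded near each boundary point, which
     total unboundedness already implies. *)
  + have -> : S = [set g | OLlt D (+oo)%E g /\ totally_unbounded D g].
      apply/seteqP; split => g; first by move=> [? []].
      move=> [Og tu]; split; first exact: Og.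
      by split; first exact: tu; move=> zeta zb eps e0; exact: (tu_not_bounded oD tu zb e0).
    apply: (tu_dense_Gdelta oD bD hps) => a b n cr.
    exact: (C1_spike oD bD hps C1 cr).
  + by move: q1; rewrite ltNge leNye.
Qed.
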